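(* Assume that conditions $(\mathscr{A}_1)$, $(\mathscr{A}_2)$, $(\mathscr{A}_3)$, $(\mathscr{A}_4)$, $(\mathscr{A}_5)$ listed in the context hold, and let $\gamma\in\,]0,1]$. Let $\{(X_i,Y_i)\}_{i\ge 1}$ be i.i.d. copies of $(X,Y)$, and let $$\widehat{\boldsymbol H}_{n,\gamma}=\frac{1}{n^2}\sum_{i,j=1}^{n} k_{ij}\ell_{ij} + \frac{1}{n^4}\sum_{i,j,q,r=1}^{n} k_{ij}\ell_{qr} - \frac{2}{n^3} \sum_{i,j,q=1}^{n}w_{i,n}(\gamma)\, k_{ij }\ell_{iq},\qquad k_{ij}=K(X_i,X_j),\ \ \ell_{ij}=L(Y_i,Y_j).$$ Then, as $n\to+\infty$, $$\sqrt{n}\,\bigl(\widehat{\boldsymbol H}_{n,\gamma}-\boldsymbol H\bigr)\longrightarrow \mathcal N(0,\sigma_\gamma^2)\quad\text{in distribution},$$ where $$\sigma_\gamma^2=4\,\mathrm{Var}\bigl(\mathcal U(X_1,Y_1)\bigr)+4\,w^2(\gamma)\,\mathrm{Var}\bigl(\mathcal V(X_1,Y_1)\bigr)-8\,\mathrm{Cov}\bigl(\mathcal U(X_1,Y_1),\mathcal V(X_1,Y_1)\bigr).$$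
   Context: $X$ and $Y$ are random variables on a probability space $(\Omega,\mathscr A,\mathbb P)$ with values in metric spaces $\mathcal X$ and $\mathcal Y$ respectively. $\mathcal H_{\mathcal X}$ and $\mathcal H_{\mathcal Y}$ are reproducing kernel Hilbert spaces (RKHS) of real-valued functions on $\mathcal X$ and $\mathcal Y$, with reproducing kernels $K:\mathcal X^2\to\mathbb R$ and $L:\mathcal Y^2\to\mathbb R$. For $(f,g)\in\mathcal H_{\mathcal X}\times\mathcal H_{\mathcal Y}$, $g\otimes f$ is the linear operator from $\mathcal H_{\mathcal Y}$ to $\mathcal H_{\mathcal X}$ given by $(g\otimes f)(h)=\langle g,h\rangle_{\mathcal H_{\mathcal Y}}f$. $\langle\cdot,\cdot\rangle_{\mathrm{HS}}$ and $\|\cdot\|_{\mathrm{HS}}$ are the Hilbert-Schmidt inner product and norm of operators. Notation: $m_X=\mathbb E(K(X,\cdot))$, $m_Y=\mathbb E(L(Y,\cdot))$, $\mu=\mathbb E\bigl(L(Y,\cdot)\otimes K(X,\cdot)\bigr)$, $\nu=m_Y\otimes m_X$. The Hilbert-Schmidt Independence Criterion is $\boldsymbol H=\|\mu-\nu\|_{\mathrm{HS}}^2$. The functions $\mathcal U,\mathcal V:\mathcal X\times\mathcal Y\to\mathbb R$ are $$\mathcal U(x,y)=\langle L(y,\cdot)\otimes K(x,\cdot)-\mu,\ \mu\rangle_{\mathrm{HS}}+\langle L(y,\cdot)\otimes m_X+m_Y\otimes K(x,\cdot)-2\nu,\ \nu-\mu\rangle_{\mathrm{HS}},$$ $$\mathcal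 V(x,y)=\langle L(y,\cdot)\otimes K(x,\cdot)-\mu,\ \nu\rangle_{\mathrm{HS}}.$$ An RKHS is universal if its kernel is continuous and it is dense, with respect to the $L_\infty$ norm, in the space of continuous maps. For $\gamma\in\,]0,1]$ and $r\in\mathbb N^*$ (positive integers), $(w_{i,r}(\gamma))_{1\le i\le r}$ is a sequence of positive (deterministic) numbers. Conditions: $(\mathscr A_1)$: $\|K\|_\infty:=\sup_{(x,y)\in\mathcal X^2}K(x,y)<+\infty$ and $\|L\|_\infty:=\sup_{(x,y)\in\mathcal Y^2}L(x,y)<+\infty$. $(\mathscr A_2)$: $\mathcal H_{\mathcal X}$ and $\mathcal H_{\mathcal Y}$ are universal, and $\mathcal X$ and $\mathcal Y$ are compact metric spaces. $(\mathscr A_3)$: there exist a strictly positive real number $\tau$ and an integer $n_0$ such that for all $r>n_0$, $r\left|\frac1r\sum_{i=1}^r w_{i,r}(\gamma)-1\right|\le\tau$. $(\mathscr A_4)$: there exists $C>0$ such that $\max_{1\le i\le r}w_{i,r}(\gamma)<C$ for all $r\in\mathbb N^*$ and all $\gamma\in\,]0,1]$. $(\mathscr A_5)$: for any $\gamma\in\,]0,1]$, $\lim_{r\to+\infty}\frac1r\sum_{i=1}^r w_{i,r}^2(\gamma)=w^2(\gamma)>1$ (this defines the number $w^2(\gamma)$). *)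

(* Defs.v *)
From HB Require Import structures.
From mathcomp Require Import all_boot all_order all_algebra finmap.
From mathcomp Require Import all_classical all_reals all_analysis.
From mathcomp Require Import sesquilinear.

Set Implicit Arguments.
Unset Strict Implicit.
Unset Printing Implicit Defensive.

Import Order.TTheory GRing.Theory Num.Theory.
Import numFieldNormedType.Exports.

Local Open Scope classical_set_scope.
Local Open Scope ring_scope.

(* Library measurable types are pointed, so Borel spaces are built on metric
   spaces with a distinguished point, i.e. on nonempty metric spaces. *)
#[short(type="pointedMetricType")]
HB.structure Definition PointedMetric (K : numDomainType) :=
  { M of Metric K M & Pointed M }.

(* A Hilbert space of real functions on [X]: its elements [f] are identified,
   through the injective linear map [rkhs_eval], with functions [X -> R];
   [rkhs_section x] is the element K(x, .). *)
Record rkhs (R : realType) (X : Type) := Rkhs {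
  rkhs_space :> completeNormedModType R ;
  rkhs_dot : {dot rkhs_space for idfun} ;
  rkhs_normE : forall f : rkhs_space, `|f| ^+ 2 = rkhs_dot f f ;
  rkhs_eval : rkhs_space -> X -> R ;
  rkhs_eval_linear : forall (a : R) (f g : rkhs_space) (x : X),
    rkhs_eval (a *: f + g) x = a * rkhs_eval f x + rkhs_eval g x ;
  rkhs_eval_inj : injective rkhs_eval ;
  rkhs_kernel : X -> X -> R ;
  rkhs_section : X -> rkhs_space ;
  rkhs_sectionE : forall x, rkhs_eval (rkhs_section x) = rkhs_kernel x ;
  rkhs_reproducing : forall (f : rkhs_space) (x : X),
    rkhs_dot f (rkhs_section x) = rkhs_eval f x
}.

Definition kernel_bounded (R : realType) (X : Type) (H : rkhs R X) : Prop :=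
  (ereal_sup [set (rkhs_kernel H z.1 z.2)%:E | z in [set: X * X]] < +oo)%E.

Definition sup_dist (R : realType) (X : Type) (f g : X -> R) : \bar R :=
  ereal_sup [set (`|f x - g x|)%:E | x in [set: X]].

Definition universal (R : realType) (X : metricType R) (H : rkhs R X) : Prop :=
  continuous (fun z : X * X => rkhs_kernel H z.1 z.2) /\
  forall g : X -> R, continuous g -> forall eps : R, 0 < eps ->
    exists f : H, (sup_dist (rkhs_eval f) g < eps%:E)%E.

Section hilbert_schmidt.
Context {R : realType} {X Y : Type} (HX : rkhs R X) (HY : rkhs R Y).

Definition orthonormal_basis (B : set HY) : Prop :=
  [/\ forall e, B e -> rkhs_dot HY e e = 1,
      forall e e', B e -> B e' -> e <> e' -> rkhs_dot HY e e' = 0 &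
      forall h, (forall e, B e -> rkhs_dot HY h e = 0) -> h = 0].

(* The Hilbert-Schmidt notions do not depend on the choice of the basis. *)
Definition onb : set HY := xget set0 [set B | orthonormal_basis B].

Definition hilbert_schmidt (A : HY -> HX) : Prop :=
  [/\ linear A, continuous A & (\esum_(e in onb) (`|A e| ^+ 2)%:E < +oo)%E].

(* [\esum] is only meaningful for nonnegative terms, hence the splitting of the
   absolutely convergent sum of <A e, B e> into its two parts. *)
Definition hs_dot (A B : HY -> HX) : R :=
  let t e := (rkhs_dot HX (A e) (B e))%:E in
  fine (\esum_(e in onb) t^\+ e - \esum_(e in onb) t^\- e)%E.

Definition hs_norm (A : HY -> HX) : R := Num.sqrt (hs_dot A A).

(* g (x) f : h |-> <g, h> f *)
Definition tensor (g : HY) (f : HX) : HY -> HX :=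
  fun h => rkhs_dot HY g h *: f.

End hilbert_schmidt.

(* Expectation of a random element [Z] of a Hilbert space, given as a subset [D]
   of a Z-module [V] with inner product [dot]: the element [m] of [D] such that
   <m, h> = E <Z, h> for all h in [D] (junk value 0 if there is none). *)
Definition hilbert_expectation d (Omega : measurableType d) (R : realType)
    (P : probability Omega R) (V : zmodType) (D : set V) (dot : V -> V -> R)
    (Z : Omega -> V) : V :=
  xget 0 [set m | D m /\ forall h, D h ->
    P.-integrable [set: Omega] (EFin \o (fun w => dot (Z w) h)) /\
    (dot m h)%:E = ('E_P[fun w => dot (Z w) h])%E].

Section hsic.
Context d (Omega : measurableType d) {R : realType} (P : probability Omega R).
Context {TX TY : Type} (HX : rkhs R TX) (HY : rkhs R TY).
Variables (X : Omega -> TX) (Y : Omega -> TY).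

Definition meanX : HX := hilbert_expectation P setT (rkhs_dot HX)
  (fun w => rkhs_section HX (X w)).

Definition meanY : HY := hilbert_expectation P setT (rkhs_dot HY)
  (fun w => rkhs_section HY (Y w)).

Definition hsic_mu : HY -> HX :=
  hilbert_expectation P (@hilbert_schmidt R TX TY HX HY) (@hs_dot R TX TY HX HY)
    (fun w => tensor (rkhs_section HY (Y w)) (rkhs_section HX (X w))).

Definition hsic_nu : HY -> HX := tensor meanY meanX.

Definition hsic : R := hs_norm (hsic_mu - hsic_nu) ^+ 2.

Definition hsic_U (x : TX) (y : TY) : R :=
  let Kx := rkhs_section HX x in
  let Ly := rkhs_section HY y in
  hs_dot (tensor Ly Kx - hsic_mu) hsic_mu +
  hs_dot (tensor Ly meanX + tensor meanY Kx - hsic_nu *+ 2)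
         (hsic_nu - hsic_mu).

Definition hsic_V (x : TX) (y : TY) : R :=
  hs_dot (tensor (rkhs_section HY y) (rkhs_section HX x) - hsic_mu) hsic_nu.

End hsic.

(* The sample and the weights are indexed from 0: [Xs i], [Ys i] and [w n i]
   stand for X_(i+1), Y_(i+1) and w_(i+1, n). *)
Definition hsic_hat (Omega : Type) (R : realType) (TX TY : Type)
    (HX : rkhs R TX) (HY : rkhs R TY)
    (Xs : nat -> Omega -> TX) (Ys : nat -> Omega -> TY)
    (w : nat -> nat -> R) (n : nat) (omega : Omega) : R :=
  let k (i j : nat) := rkhs_kernel HX (Xs i omega) (Xs j omega) in
  let l (i j : nat) := rkhs_kernel HY (Ys i omega) (Ys j omega) in
  (n%:R ^+ 2)^-1 * (\sum_(i < n) \sum_(j < n) k i j * l i j)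
  + (n%:R ^+ 4)^-1 *
      (\sum_(i < n) \sum_(j < n) \sum_(q < n) \sum_(r < n) k i j * l q r)
  - 2 / n%:R ^+ 3 *
      (\sum_(i < n) \sum_(j < n) \sum_(q < n) w n i * k i j * l i q).

Definition borel (R : realType) (T : pointedMetricType R) :
    measurableType (sigma_display (@open T)) :=
  g_sigma_algebraType (@open T).

Definition mutually_independent d (Omega : measurableType d) (R : realType)
    (P : probability Omega R) d' (T : measurableType d') (I : choiceType)
    (Z : I -> Omega -> T) : Prop :=
  forall (J : {fset I}) (A : I -> set T), (forall i, measurable (A i)) ->
    P (\bigcap_(i in [set` J]) (Z i @^-1` A i))
    = (\prod_(i <- J) P (Z i @^-1` A i))%E.

Definition identically_distributed d (Omega : measurableType d) (R : realType)
    (P : probability Omega R) d' (T : measurableType d')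
    (Z Z' : Omega -> T) : Prop :=
  forall A : set T, measurable A -> P (Z @^-1` A) = P (Z' @^-1` A).

Definition iid_copies d (Omega : measurableType d) (R : realType)
    (P : probability Omega R) d' (T : measurableType d')
    (Zs : nat -> Omega -> T) (Z : Omega -> T) : Prop :=
  mutually_independent P Zs /\ forall i, identically_distributed P (Zs i) Z.

(* N(m, v), parametrized by the variance v, with N(m, 0) the Dirac mass at m.
   [normal_prob m s] is parametrized by the standard deviation s, and is the
   uniform distribution on [0, 1] when s = 0. *)
Definition gaussian (R : realType) (m v : R) :
    {measure set (measurableTypeR R) -> \bar R} :=
  if v == 0
  then (@dirac _ (measurableTypeR R) m R :
          {measure set (measurableTypeR R) -> \bar R})
  else (normal_prob m (Num.sqrt v) :
          {measure set (measurableTypeR R) -> \bar R}).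

Definition cvg_in_distribution d (Omega : measurableType d) (R : realType)
    (P : probability Omega R) (Z : nat -> Omega -> R)
    (Q : {measure set (measurableTypeR R) -> \bar R}) : Prop :=
  (forall n, measurable_fun [set: Omega] (Z n)) /\
  forall f : R -> R, continuous f -> (exists M, forall x, `|f x| <= M) ->
    (\int[P]_omega (f (Z n omega))%:E)%E @[n --> \oo]
      --> (\int[Q]_x (f x)%:E)%E.

(* Main.v *)
Require Import Defs.
From HB Require Import structures.
From mathcomp Require Import all_boot all_order all_algebra finmap.
From mathcomp Require Import all_classical all_reals all_analysis.
From mathcomp Require Import measurable_realfun sesquilinear ring lra.

Set Implicit Arguments.
Unset Strict Implicit.
Unset Printing Implicit Defensive.

Import Order.TTheory GRing.Theory Num.Theory.
Import numFieldNormedType.Exports.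

Local Open Scope classical_set_scope.
Local Open Scope ring_scope.

(** Write [T_i] for the tensor of the sections at [Y_i] and [X_i], which is an element
    of the Hilbert space of Hilbert-Schmidt operators. The estimator is
    [|m|^2 + |p|^2 - 2 <m_w, p>], where [m] is the mean of the [T_i], [m_w] their
    weighted mean and [p] the tensor product of the two empirical embeddings. These
    three are perturbations of [mu], [mu] and [nu]. Expanding by bilinearity around
    the limits gives the criterion, plus a linear part which is exactly
    [2 / n] times the sum of [U(X_i, Y_i) - w_i V(X_i, Y_i)], plus a remainder in
    which every term contains two centered averages or the deviation of the mean
    weight from 1 ([hsic_expansion]).

    The remainder is negligible. A centered average of independent bounded elements of
    a Hilbert space has a second moment of order [1 / n], since the off-diagonal terms
    vanish ([degenerate_second_moment]), and the mean weight is within [tau / n] of 1;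
    so [sqrt n] times the remainder tends to 0 in mean.

    The linear part is a sum of independent, centered and uniformly bounded variables
    whose variance converges to [sigma2], because the mean of the weights tends to 1 and
    that of their squares to [w2]. Its asymptotic normality is proved by Stein's method
    ([central_limit_theorem]). For a bounded continuous [f] with Gaussian mean [c],
    Stein's equation [v g' - x g = f - c] has a solution with bounded continuous
    derivative ([stein_equation]): with [p] the density and [F] the primitive of
    [(f - c) p] that vanishes at both ends, it is [F / (v p)], and comparing [F] with
    [p] far from the origin bounds [x g]. Then [E f(S) - c] is the defect
    [v E g'(S) - E S g(S)], and replacing [S] by the sum without one summand shows that
    it is small ([stein_identity_approx]). Since second moments are bounded, uniform
    continuity is used on compact intervals only ([quadratic_modulus]), so that
    continuity of [f] suffices.

    It remains to see that [mu] and the embeddings exist, and that the Hilbert-Schmidt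
    product, defined by summation over a basis, is an inner product with
    [<g (x) f, B> = <f, B g>]. Riesz-Fischer gives Fourier expansions and
    Riesz's theorem; the embeddings are then weak expectations, [mu] is built one value
    at a time and is Hilbert-Schmidt by Bessel's inequality ([hsic_muP]). Continuous
    functions of the pair are measurable for the product of the Borel sigma-algebras
    because compact metric spaces are second countable ([continuous_borel_prod]). *)

(** * Bounded measurable functions and their expectations *)

Definition bounded_mfun d (T : measurableType d) (R : realType) (f : T -> R) :=
  measurable_fun [set: T] f /\ exists M : R, forall x, `|f x| <= M.

Section bounded_mfun.
Context d (T : measurableType d) (R : realType).
Implicit Types f g : T -> R.

Lemma bounded_mfun_cst (c : R) : bounded_mfun (fun _ : T => c).
Proof. by split; [exact: measurable_cst|exists `|c|]. Qed.

Lemma eq_bounded_mfun f g : f =1 g -> bounded_mfun g -> bounded_mfun f.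
Proof. by move=> /funext ->. Qed.

Lemma bounded_mfunD f g : bounded_mfun f -> bounded_mfun g ->
  bounded_mfun (fun x => f x + g x).
Proof.
move=> [mf [M fM]] [mg [N gN]]; split; first exact: measurable_funD.
by exists (M + N) => x; rewrite (le_trans (ler_normD _ _))// lerD.
Qed.

Lemma bounded_mfunM f g : bounded_mfun f -> bounded_mfun g ->
  bounded_mfun (fun x => f x * g x).
Proof.
move=> [mf [M fM]] [mg [N gN]]; split; first exact: measurable_funM.
by exists (M * N) => x; rewrite normrM ler_pM.
Qed.

Lemma bounded_mfunN f : bounded_mfun f -> bounded_mfun (fun x => - f x).
Proof.
by move=> [mf [M fM]]; split; [exact: measurable_funN|exists M => x; rewrite normrN].
Qed.

Lemma bounded_mfunB f g : bounded_mfun f -> bounded_mfun g ->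
  bounded_mfun (fun x => f x - g x).
Proof. by move=> bf bg; apply: bounded_mfunD => //; exact: bounded_mfunN. Qed.

Lemma bounded_mfunX f n : bounded_mfun f -> bounded_mfun (fun x => f x ^+ n).
Proof.
move=> [mf [M fM]]; split; first exact: measurable_funX.
by exists (M ^+ n) => x; rewrite normrX lerXn2r// ?nnegrE// (le_trans _ (fM x)).
Qed.

Lemma bounded_mfun_norm f : bounded_mfun f -> bounded_mfun (fun x => `|f x|).
Proof.
move=> [mf [M fM]]; split; first exact: measurableT_comp.
by exists M => x; rewrite normr_id.
Qed.

Lemma bounded_mfun_sum I (r : seq I) (Q : pred I) (F : I -> T -> R) :
  (forall i, bounded_mfun (F i)) ->
  bounded_mfun (fun x => \sum_(i <- r | Q i) F i x).
Proof.
move=> bF; elim: r => [|i r IH].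
  by under eq_fun do rewrite big_nil; exact: bounded_mfun_cst.
under eq_fun do rewrite big_cons.
by case: (Q i) => //; exact: bounded_mfunD.
Qed.

(** The values of [f] lie in a compact interval, on which [g] is bounded. *)
Lemma bounded_mfun_continuous (g : R -> R) f : continuous g -> bounded_mfun f ->
  bounded_mfun (fun x => g (f x)).
Proof.
move=> cg [mf [M fM]]; split.
  by apply: (measurableT_comp _ mf); exact: continuous_measurable_fun.
have M0 : - M <= M by have := fM point; rewrite ler_norml => /andP[/le_trans]; apply.
have cgM : {within `[- M, M], continuous (fun x => `|g x|)}.
  apply: continuous_subspaceT => x; apply: continuous_comp (cg x) _.
  exact: norm_continuous.
have [c _ gc] := EVT_max M0 cgM.
by exists `|g c| => x; apply: gc; rewrite in_itv/= -ler_norml.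
Qed.

Lemma bounded_mfun_comp d' (T' : measurableType d') (h : T' -> T) f :
  measurable_fun [set: T'] h -> bounded_mfun f ->
  bounded_mfun (fun x => f (h x)).
Proof.
by move=> mh [mf [M fM]]; split; [exact: measurableT_comp|exists M => x].
Qed.

End bounded_mfun.

(** Real-valued, since every integrand below is bounded. *)
Definition mean d (T : measurableType d) (R : realType) (P : probability T R)
  (f : T -> R) : R := fine (\int[P]_x (f x)%:E)%E.

Section mean.
Context d (T : measurableType d) (R : realType) (P : probability T R).
Implicit Types f g : T -> R.

Lemma bounded_mfun_integrable f : bounded_mfun f ->
  P.-integrable [set: T] (EFin \o f).
Proof.
move=> [mf [M fM]].
apply: measurable_bounded_integrable => //.
  by rewrite (le_lt_trans (probability_le1 _ _))// ltry.
exists M; split; first exact: num_real.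
by move=> x Mx y _ /=; rewrite (le_trans (fM y))// ltW.
Qed.

Lemma meanE f : bounded_mfun f -> (\int[P]_x (f x)%:E)%E = (mean P f)%:E.
Proof.
by move=> bf; rewrite fineK//; apply: integrable_fin_num => //;
  exact: bounded_mfun_integrable.
Qed.

Lemma eq_mean f g : f =1 g -> mean P f = mean P g.
Proof. by move=> fg; congr fine; apply: eq_integral => x _; rewrite fg. Qed.

Lemma mean_cst (c : R) : mean P (fun _ => c) = c.
Proof.
by rewrite /mean integral_cst//= probability_setT mule1.
Qed.

Lemma meanD f g : bounded_mfun f -> bounded_mfun g ->
  mean P (fun x => f x + g x) = mean P f + mean P g.
Proof.
move=> bf bg; apply: RintegralD => //; exact: bounded_mfun_integrable.
Qed.

Lemma meanZ (c : R) f : bounded_mfun f ->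
  mean P (fun x => c * f x) = c * mean P f.
Proof. by move=> bf; apply: RintegralZl => //; exact: bounded_mfun_integrable. Qed.

Lemma meanB f g : bounded_mfun f -> bounded_mfun g ->
  mean P (fun x => f x - g x) = mean P f - mean P g.
Proof.
move=> bf bg; apply: RintegralB => //; exact: bounded_mfun_integrable.
Qed.

Lemma mean_sum I (r : seq I) (Q : pred I) (F : I -> T -> R) :
  (forall i, bounded_mfun (F i)) ->
  mean P (fun x => \sum_(i <- r | Q i) F i x) = \sum_(i <- r | Q i) mean P (F i).
Proof.
move=> bF; elim: r => [|i r IH].
  by rewrite big_nil -[RHS]mean_cst; apply: eq_mean => x; rewrite big_nil.
rewrite big_cons; case: ifPn => Qi.
  rewrite -IH -meanD//; last exact: bounded_mfun_sum.
  by apply: eq_mean => x; rewrite big_cons Qi.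
by rewrite -IH; apply: eq_mean => x; rewrite big_cons (negbTE Qi).
Qed.

Lemma le_mean f g : bounded_mfun f -> bounded_mfun g ->
  (forall x, f x <= g x) -> mean P f <= mean P g.
Proof.
move=> bf bg fg; apply: le_Rintegral => //; exact: bounded_mfun_integrable.
Qed.

Lemma mean_ge0 f : (forall x, 0 <= f x) -> 0 <= mean P f.
Proof. by move=> f0; apply: Rintegral_ge0 => x _; exact: f0. Qed.

Lemma ler_norm_mean f : bounded_mfun f -> `|mean P f| <= mean P (fun x => `|f x|).
Proof.
by move=> bf; apply: le_normr_Rintegral => //; exact: bounded_mfun_integrable.
Qed.

Lemma ler_mean_cst f (c : R) : bounded_mfun f -> (forall x, f x <= c) ->
  mean P f <= c.
Proof.
by move=> bf fc; rewrite -(mean_cst c); apply: le_mean => //; exact: bounded_mfun_cst.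
Qed.

Lemma ler_norm_mean_cst f (c : R) : bounded_mfun f -> (forall x, `|f x| <= c) ->
  `|mean P f| <= c.
Proof.
move=> bf fc; rewrite (le_trans (ler_norm_mean bf))// ler_mean_cst//.
exact: bounded_mfun_norm.
Qed.

Lemma mean_pushforward d' (T' : measurableType d') (h : {mfun T >-> T'})
    (f : T' -> R) :
  bounded_mfun f -> mean (distribution P h) f = mean P (fun x => f (h x)).
Proof.
move=> bf; congr fine; rewrite /distribution integral_pushforward//=.
- by apply/measurable_EFinP; case: bf.
- by apply: bounded_mfun_integrable; exact: bounded_mfun_comp.
Qed.

Lemma eq_mean_measure (Q : probability T R) f :
  (forall A, measurable A -> P A = Q A) -> mean P f = mean Q f.
Proof. by move=> PQ; congr fine; apply: eq_measure_integral => A mA _; exact: PQ. Qed.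

Lemma mean_covariance f g : fine (covariance P f g) =
  mean P (fun x => (f x - mean P f) * (g x - mean P g)).
Proof. by rewrite unlock unlock. Qed.

End mean.

(** * Independence *)

Section joint_law.
Context d (Omega : measurableType d) (R : realType) (P : probability Omega R).
Context d1 d2 (T1 : measurableType d1) (T2 : measurableType d2).

Definition independent2 (U : Omega -> T1) (V : Omega -> T2) : Prop :=
  forall A B, measurable A -> measurable B ->
    P (U @^-1` A `&` V @^-1` B) = (P (U @^-1` A) * P (V @^-1` B))%E.

(** The joint law of two independent random elements is the product of their
    laws, so the expectation of a function of both can be computed by freezing
    the first one. *)
Lemma mean_independent2 (U : Omega -> T1) (V : Omega -> T2)
    (F : T1 * T2 -> R) :
  measurable_fun [set: Omega] U -> measurable_fun [set: Omega] V ->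
  independent2 U V -> bounded_mfun F ->
  mean P (fun w => F (U w, V w)) =
  mean P (fun w => mean P (fun w' => F (U w, V w'))).
Proof.
move=> mU mV UV bF.
pose U' : {mfun Omega >-> T1} := mfun_Sub (mem_set mU).
pose V' : {mfun Omega >-> T2} := mfun_Sub (mem_set mV).
have mUV : measurable_fun [set: Omega] (fun w => (U w, V w)).
  exact: measurable_fun_pair.
pose UV' : {mfun Omega >-> (T1 * T2)%type} := mfun_Sub (mem_set mUV).
have lawE (A : set (T1 * T2)) : measurable A ->
    (distribution P U' \x distribution P V')%E A = distribution P UV' A.
  apply: product_measure_unique => A1 A2 mA1 mA2.
  exact: UV.
rewrite -(mean_pushforward P UV' bF).
pose G x := mean P (fun w' => F (x, V w')).
have bFx x : bounded_mfun (fun y => F (x, y)).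
  by apply: (bounded_mfun_comp _ bF); exact: pair1_measurable.
have GE x : G x = mean (distribution P V') (fun y => F (x, y)).
  by rewrite mean_pushforward.
have mF : measurable_fun [set: T1 * T2] (EFin \o F).
  by apply/measurable_EFinP; case: bF.
have iF : (distribution P U' \x distribution P V')%E.-integrable
    [set: T1 * T2] (EFin \o F).
  have /integrableP[_ Foo] := bounded_mfun_integrable (distribution P UV') bF.
  apply/integrableP; split => //.
  rewrite (eq_measure_integral (distribution P UV'))// => A mA _.
  exact: lawE.
have FE : fubini_F (distribution P V') (EFin \o F) = EFin \o G.
  by apply/funext => x; rewrite /fubini_F/= meanE// GE.
have bG : bounded_mfun G.
  split.
    by apply/measurable_EFinP; rewrite -FE; apply: measurable_fubini_F; exact: iF.
  by case: (bF) => _ [M FM]; exists M => x; rewrite GE; apply: ler_norm_mean_cst.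
rewrite -/(mean P (fun w => G (U' w))) -(mean_pushforward P U' bG).
congr fine; under [RHS]eq_integral do rewrite -[(G _)%:E]/((EFin \o G) _) -FE.
rewrite integral12_prod_meas1//.
by apply: eq_measure_integral => A mA _; apply/esym; exact: lawE.
Qed.

Lemma mean_prod_independent2 (U : Omega -> T1) (V : Omega -> T2)
    (f : T1 -> R) (g : T2 -> R) :
  measurable_fun [set: Omega] U -> measurable_fun [set: Omega] V ->
  independent2 U V -> bounded_mfun f -> bounded_mfun g ->
  mean P (fun w => f (U w) * g (V w)) =
  mean P (fun w => f (U w)) * mean P (fun w => g (V w)).
Proof.
move=> mU mV UV bf bg.
have bfg : bounded_mfun (fun z : T1 * T2 => f z.1 * g z.2).
  apply: bounded_mfunM.
    exact: (bounded_mfun_comp measurable_fst bf).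
  exact: (bounded_mfun_comp measurable_snd bg).
rewrite (mean_independent2 mU mV UV bfg)/= [RHS]mulrC -meanZ; last first.
  exact: bounded_mfun_comp bf.
by apply: eq_mean => w; rewrite meanZ 1?mulrC//; exact: bounded_mfun_comp bg.
Qed.

(** Pi-lambda argument: rectangles form a pi-system that generates the product
    sigma-algebra, and the sets for which the product rule holds are stable
    under complement and countable disjoint union. *)
Lemma independent_event_pair (U : Omega -> T1) (V : Omega -> T2) (E : set Omega) :
  measurable_fun [set: Omega] U -> measurable_fun [set: Omega] V ->
  measurable E ->
  (forall A B, measurable A -> measurable B ->
    P (U @^-1` A `&` V @^-1` B `&` E) = (P (U @^-1` A `&` V @^-1` B) * P E)%E) ->
  forall C, measurable C ->
    P ((fun w => (U w, V w)) @^-1` C `&` E) =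
    (P ((fun w => (U w, V w)) @^-1` C) * P E)%E.
Proof.
move=> mU mV mE rect.
have mUV : measurable_fun [set: Omega] (fun w => (U w, V w)).
  exact: measurable_fun_pair.
set W := fun w => (U w, V w).
have mW A : measurable A -> measurable (W @^-1` A).
  by move=> mA; rewrite -[_ @^-1` _]setTI; exact: mUV.
have finE : P E \is a fin_num by exact: fin_num_measure.
move=> C; rewrite measurable_prod_measurableType.
apply: (@dynkin_induction _ _ _ (fun C => P (W @^-1` C `&` E) = (P (W @^-1` C) * P E)%E)) => //.
- exact: measurable_prod_measurableType.
- move=> _ _ [A1 mA1 [A2 mA2 <-]] [B1 mB1 [B2 mB2 <-]].
  by rewrite -setXI; exists (A1 `&` B1); [exact: measurableI|
    exists (A2 `&` B2) => //; exact: measurableI].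
- by rewrite preimage_setT setTI probability_setT mul1e.
- by move=> _ [A mA [B mB <-]]; exact: rect.
- move=> S mS IH.
  have -> : W @^-1` (~` S) `&` E = E `\` (W @^-1` S).
    by rewrite preimage_setC setIC setDE.
  rewrite measureD//; [|exact: mW|by rewrite -ge0_fin_numE].
  rewrite [X in (_ - P X)%E]setIC IH preimage_setC probability_setC; last exact: mW.
  by rewrite muleBl ?mul1e// fin_num_adde_defr.
- move=> F mF tF IH.
  have tWF : trivIset [set: nat] (fun n => W @^-1` F n).
    by apply/trivIsetP => i j _ _ ij; rewrite -preimage_setI (trivIsetP.1 tF)//
      preimage_set0.
  rewrite preimage_bigcup setI_bigcupl measure_bigcup//=; last 2 first.
  + by move=> i _; apply: measurableI => //; exact: mW.
  + exact: trivIset_setIr.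
  rewrite measure_bigcup//=; last by move=> i _; exact: mW.
  under eq_eseriesr do rewrite IH.
  rewrite -(fineK finE).
  under eq_eseriesr do rewrite muleC.
  by rewrite nneseriesZl; [exact: muleC|move=> n _; exact: measure_ge0].
Qed.

End joint_law.

Section independence_of_sums.
Context d (Omega : measurableType d) (R : realType) (P : probability Omega R).
Context d' (T : measurableType d') (Z : nat -> Omega -> T).
Hypothesis mZ : forall i, measurable_fun [set: Omega] (Z i).
Hypothesis indZ : mutually_independent P Z.

Let mZA i A : measurable A -> measurable (Z i @^-1` A).
Proof. by move=> mA; rewrite -[_ @^-1` _]setTI; exact: mZ. Qed.

Let mcap (L : {fset nat}) (A : nat -> set T) : (forall i, measurable (A i)) ->
  measurable (\bigcap_(i in [set` L]) (Z i @^-1` A i)).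
Proof.
by move=> mA; apply: fin_bigcap_measurable => // i _; exact: mZA.
Qed.

Let mutual_independentU1 (j : nat) (L : {fset nat}) (C : set T) (A : nat -> set T) :
  j \notin L -> measurable C -> (forall i, measurable (A i)) ->
  P (Z j @^-1` C `&` \bigcap_(i in [set` L]) (Z i @^-1` A i)) =
  (P (Z j @^-1` C) * P (\bigcap_(i in [set` L]) (Z i @^-1` A i)))%E.
Proof.
move=> jL mC mA; pose A' i := if i == j then C else A i.
have mA' i : measurable (A' i) by rewrite /A'; case: eqP.
have A'L i : i \in L -> A' i = A i.
  by move=> iL; rewrite /A'; case: eqP => // ij; move: jL; rewrite -ij iL.
have LE : \bigcap_(i in [set` L]) (Z i @^-1` A' i) =
          \bigcap_(i in [set` L]) (Z i @^-1` A i).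
  by apply: eq_bigcapr => i /= iL; rewrite A'L.
rewrite -LE (indZ L mA').
have := indZ (j |` L)%fset mA'.
rewrite big_fsetU1//= {2}/A' eqxx => <-; congr (P _).
rewrite bigcap_fsetU1 {2}/A' eqxx//.
Qed.

Lemma independent2_pair (i j : nat) : i != j -> independent2 P (Z i) (Z j).
Proof.
move=> ij A B mA mB.
have := @mutual_independentU1 i [fset j]%fset A (fun=> B) _ mA (fun=> mB).
rewrite set_fset1 bigcap_set1; apply.
by rewrite in_fset1.
Qed.

Variable b : nat -> T -> R.
Hypothesis mb : forall i, measurable_fun [set: T] (b i).

Let S (J : seq nat) w := \sum_(i <- J) b i (Z i w).

Let mS J : measurable_fun [set: Omega] (S J).
Proof.
by apply: measurable_sum => i; exact: measurableT_comp.
Qed.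

(** The sum is built one summand at a time. Keeping an arbitrary event about the
    variables indexed by [L] in the statement makes the induction go through: the
    next variable to be added is first part of that event. *)
Let independent_sum (J : seq nat) (L : {fset nat}) (A : nat -> set T) (B : set R) :
  uniq J -> (forall j, j \in J -> j \notin L) ->
  (forall i, measurable (A i)) -> measurable B ->
  P (S J @^-1` B `&` \bigcap_(i in [set` L]) (Z i @^-1` A i)) =
  (P (S J @^-1` B) * P (\bigcap_(i in [set` L]) (Z i @^-1` A i)))%E.
Proof.
elim: J L A B => [|j J IH] L A B.
  move=> _ _ mA mB.
  have S0 : S [::] = cst 0 by apply/funext => w; rewrite /S big_nil.
  rewrite S0 preimage_cst; case: ifPn => _.
    by rewrite setTI probability_setT mul1e.
  by rewrite set0I measure0 mul0e.
move=> /= /andP[jJ uJ] JL mA mB.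
have jL : j \notin L by apply: JL; rewrite mem_head.
set E := \bigcap_(i in _) _.
have mE : measurable E by exact: mcap.
have fin A' : measurable A' -> P A' \is a fin_num by exact: fin_num_measure.
have rect B' A' : measurable B' -> measurable A' ->
    P (S J @^-1` B' `&` Z j @^-1` A' `&` E) =
    (P (S J @^-1` B' `&` Z j @^-1` A') * P E)%E.
  move=> mB' mA'.
  have -> : P (S J @^-1` B' `&` Z j @^-1` A') =
            (P (S J @^-1` B') * P (Z j @^-1` A'))%E.
    have := IH [fset j]%fset (fun=> A') B' uJ _ (fun=> mA') mB'.
    rewrite set_fset1 bigcap_set1; apply => i iJ.
    by rewrite in_fset1; apply: contraNneq jJ => <-.
  rewrite -setIA -muleA -mutual_independentU1//.
  pose A'' i := if i == j then A' else A i.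
  have -> : Z j @^-1` A' `&` E =
      \bigcap_(i in [set` (j |` L)%fset]) (Z i @^-1` A'' i).
    rewrite bigcap_fsetU1 {1}/A'' eqxx; congr (_ `&` _).
    apply: eq_bigcapr => i /= iL; rewrite /A''; case: eqP => // ij.
    by move: jL; rewrite -ij iL.
  apply: IH => //.
    move=> i iJ; rewrite in_fset1U negb_or; apply/andP; split.
      by apply: contraNneq jJ => <-.
    by apply: JL; rewrite inE iJ orbT.
  by move=> i; rewrite /A''; case: eqP.
have mh : measurable_fun [set: R * T] (fun z : R * T => b j z.2 + z.1).
  apply: measurable_funD; last exact: measurable_fst.
  exact: measurableT_comp measurable_snd.
have := independent_event_pair (mS J) (mZ j) mE rect
  (C := (fun z : R * T => b j z.2 + z.1) @^-1` B).
have -> : S (j :: J) = fun w => b j (Z j w) + S J w.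
  by apply/funext => w; rewrite /S big_cons.
by apply; rewrite -[_ @^-1` _]setTI; exact: mh.
Qed.

Lemma independent2_sum (k : nat) (J : seq nat) : uniq J -> k \notin J ->
  independent2 P (Z k) (fun w => \sum_(i <- J) b i (Z i w)).
Proof.
move=> uJ kJ A B mA mB.
have := @independent_sum J [fset k]%fset (fun=> A) B uJ _ (fun=> mA) mB.
rewrite set_fset1 bigcap_set1 setIC muleC; apply => j jJ.
by rewrite in_fset1; apply: contraNneq kJ => <-.
Qed.

End independence_of_sums.

(** * Stein's equation *)

Section mean_value.
Context {R : realType} (f df : R -> R).
Hypothesis fdf : forall x : R, is_derive x 1 f (df x).

Lemma is_derive_continuous : continuous f.
Proof.
move=> x; apply: differentiable_continuous; apply/derivable1_diffP.
by have := fdf x => -[].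
Qed.

Lemma mean_value_lt (a b : R) : a < b ->
  exists2 c, a < c < b & f b - f a = df c * (b - a).
Proof.
move=> ab; have [//|c cab E] := MVT ab (fun x _ => fdf x).
  by apply: continuous_subspaceT; exact: is_derive_continuous.
by exists c => //; move: cab; rewrite in_itv.
Qed.

End mean_value.

Section stein_bound.
Context {R : realType} (v M : R) (h p F : R -> R).
Hypotheses (v0 : 0 < v) (p0 : forall x, 0 < p x) (hM : forall x, `|h x| <= M).
Hypothesis dp : forall x : R, is_derive x 1 p (- (x / v) * p x).
Hypothesis dF : forall x : R, is_derive x 1 F (h x * p x).
Hypothesis FNy : forall e, 0 < e -> forall x, exists2 y, y < x & `|F y| <= e.
Hypothesis Fy : forall e, 0 < e -> forall x, exists2 y, x < y & `|F y| <= e.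

Let M0 : 0 <= M. Proof. exact: le_trans (normr_ge0 _) (hM 0). Qed.

Let G (c t : R) := M * v * p t + c * F t.

Let dG c (t : R) : is_derive t 1 (G c) (p t * (c * h t - M * t)).
Proof.
have -> : G c = (M * v) \*: p + c \*: F by apply/funext.
apply: is_derive_eq; rewrite /GRing.scale/=.
by field; rewrite gt_eqF.
Qed.

(** The function [M v p + c F] with [`|c| = `|x|] is monotone on the side of [x]
    away from the origin, and its limit at infinity on that side is nonnegative. *)
Let G_ge0 c x : `|c| = `|x| -> 0 <= G c x.
Proof.
move=> cx.
have [x0|x0|x0] := ltgtP x 0; last first.
- move: cx; rewrite x0 normr0 => /normr0_eq0 ->.
  by rewrite /G mul0r addr0 !mulr_ge0// ?ltW.
- apply/ler_addgt0Pr => e e0.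
  have [y xy Fe] := Fy (divr_gt0 e0 x0) x.
  have [t /andP[xt ty] E] := mean_value_lt (dG c) xy.
  have Gyx : G c y <= G c x.
    rewrite -subr_le0 E; apply: mulr_le0_ge0; last by rewrite subr_ge0 ltW.
    apply: mulr_ge0_le0; first exact: ltW.
    rewrite subr_le0 (le_trans (ler_norm _))// normrM cx.
    by rewrite mulrC ler_pM// (le_trans _ (ltW xt))// ger0_norm// ltW.
  rewrite (le_trans _ (lerD Gyx (lexx e)))// /G -addrA addr_ge0//.
    by rewrite !mulr_ge0// ?ltW.
  have : `|c * F y| <= e by rewrite normrM cx (gtr0_norm x0) mulrC -ler_pdivlMr.
  by rewrite ler_norml => /andP[+ _]; rewrite -subr_ge0 opprK.
- apply/ler_addgt0Pr => e e0.
  have x0' : 0 < - x by rewrite oppr_gt0.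
  have [y yx Fe] := FNy (divr_gt0 e0 x0') x.
  have [t /andP[yt tx] E] := mean_value_lt (dG c) yx.
  have Gyx : G c y <= G c x.
    rewrite -subr_ge0 E; apply: mulr_ge0; last by rewrite subr_ge0 ltW.
    apply: mulr_ge0; first exact: ltW.
    rewrite subr_ge0 -lerN2 (le_trans (ler_norm _))//.
    rewrite normrN normrM cx (ltr0_norm x0) -mulrN mulrC ler_pM//.
      by rewrite ltW.
    by rewrite lerN2 ltW.
  rewrite (le_trans _ (lerD Gyx (lexx e)))// /G -addrA addr_ge0//.
    by rewrite !mulr_ge0// ?ltW.
  have : `|c * F y| <= e by rewrite normrM cx (ltr0_norm x0) mulrC -ler_pdivlMr.
  by rewrite ler_norml => /andP[+ _]; rewrite -subr_ge0 opprK.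
Qed.

(** A bound of Mills type: it makes [x * F x / (v * p x)] bounded, hence also the
    derivative of the solution of Stein's equation. *)
Lemma stein_tail_bound x : `|x * F x| <= M * v * p x.
Proof.
have := G_ge0 (erefl `|x|); have := G_ge0 (normrN x).
by rewrite /G mulNr subr_ge0 => ? ?; rewrite ler_norml; apply/andP; split; lra.
Qed.

End stein_bound.

Section gaussian_density.
Context {R : realType} (v : R).
Hypothesis v0 : 0 < v.

Local Notation s := (Num.sqrt v).
Local Notation p := (normal_pdf 0 s).
Local Notation N := (normal_prob 0 s).
Local Notation mu := (@lebesgue_measure R).

Let s0 : s != 0. Proof. by rewrite gt_eqF// sqrtr_gt0. Qed.
Let k0 : 0 < normal_peak s. Proof. exact: normal_peak_gt0. Qed.

Let pE x : p x = normal_peak s * expR (- (2 * v)^-1 * x ^+ 2).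
Proof.
rewrite normal_pdfE// /normal_fun subr0 sqr_sqrtr ?ltW//.
by congr (_ * expR _); field; rewrite gt_eqF.
Qed.

Let p_gt0 x : 0 < p x.
Proof. by rewrite pE mulr_gt0// expR_gt0. Qed.

Let dp (x : R) : is_derive x 1 p (- (x / v) * p x).
Proof.
rewrite pE.
have -> : p = normal_peak s \*: (fun y : R => expR (- (2 * v)^-1 * y ^+ 2)).
  by apply/funext => y; rewrite pE.
apply: is_derive_eq; rewrite /GRing.scale/=.
by field; rewrite gt_eqF.
Qed.

(** The density is the Radon-Nikodym derivative of the normal law. *)
Lemma integral_normal_prob (f : R -> R) : bounded_mfun f ->
  (\int[N]_x (f x)%:E = \int[mu]_x (f x * p x)%:E)%E.
Proof.
move=> bf; have mf : measurable_fun [set: R] (EFin \o f).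
  by apply/measurable_EFinP; case: bf.
have intf : N.-integrable [set: R] (EFin \o f).
  exact: (bounded_mfun_integrable N bf).
have mp : measurable_fun [set: R] (EFin \o p).
  by apply/measurable_EFinP; exact: measurable_normal_pdf.
have dom := @normal_prob_dominates R 0 s.
rewrite -[LHS](Radon_Nikodym_change_of_variables dom)//=.
under [RHS]eq_integral do rewrite EFinM.
have mRN : measurable_fun [set: R] (Radon_Nikodym (charge_of_finite_measure N) mu).
  by apply: (measurable_int mu); exact: Radon_Nikodym_integrable.
apply: ae_eq_integral => //.
- exact: emeasurable_funM.
- exact: emeasurable_funM.
- apply: ae_eqe_mul2l => /=.
  rewrite Radon_NikodymE//=.
  case: cid => /= h [h1 h2 h3].
  apply: integral_ae_eq => //=.
  by move=> E _ mE; rewrite -h3.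
Qed.

Let idN : measurableTypeR R -> R := idfun.

#[local] HB.instance Definition _ :=
  @isMeasurableFun.Build _ _ _ _ idN (@measurable_id _ _ setT).

Let mass_Ny (e : R) : 0 < e -> forall x, exists2 y, y < x & (N `]-oo, y] <= e%:E)%E.
Proof.
move=> e0 x.
have /fine_cvgP[_ /cvgrPdist_le/(_ _ e0) near0] := cvg_cdfNy0 (idN : {RV N >-> R}).
near (ninfty_nbhs R) => y; exists y.
  by near: y; apply: nbhs_ninfty_lt; exact: num_real.
have : `|0 - fine (cdf (idN : {RV N >-> R}) y)| <= e by near: y.
have fin : N `]-oo, y] \is a fin_num by exact: fin_num_measure.
rewrite sub0r normrN ger0_norm ?fine_ge0// -lee_fin fineK.
Unshelve. all: by end_near. Qed.

Let mass_y (e : R) : 0 < e -> forall x, exists2 y, x < y & (N `]y, +oo[ <= e%:E)%E.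
Proof.
move=> e0 x.
have /fine_cvgP[_ /cvgrPdist_le/(_ _ e0) near0] := cvg_ccdfy0 (idN : {RV N >-> R}).
near (pinfty_nbhs R) => y; exists y.
  by near: y; apply: nbhs_pinfty_gt; exact: num_real.
have : `|0 - fine (ccdf (idN : {RV N >-> R}) y)| <= e by near: y.
have fin : N `]y, +oo[ \is a fin_num by exact: fin_num_measure.
by rewrite sub0r normrN ger0_norm ?fine_ge0// -lee_fin fineK.
Unshelve. all: by end_near. Qed.

Variables (f : R -> R) (M : R).
Hypotheses (cf : continuous f) (fM : forall x, `|f x| <= M).

Let bf : bounded_mfun f.
Proof. by split; [exact: continuous_measurable_fun|exists M]. Qed.

Let c := mean N f.
Let h x := f x - c.

Let hM x : `|h x| <= M + M.
Proof. by rewrite (le_trans (ler_normB _ _))// lerD// ler_norm_mean_cst. Qed.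

Let ch : continuous h.
Proof. by move=> x; apply: cvgB; [exact: cf|exact: cvg_cst]. Qed.

Let q x := h x * p x.

Let bh : bounded_mfun h.
Proof. by split; [exact: continuous_measurable_fun|exists (M + M)]. Qed.

Let iq : mu.-integrable [set: R] (EFin \o q).
Proof.
apply: (@le_integrable _ _ _ mu _ measurableT _ (fun x => (M + M)%:E * (p x)%:E)%E).
- apply/measurable_EFinP; apply: measurable_funM; first by case: bh.
  exact: measurable_normal_pdf.
- move=> x _; rewrite -EFinM !abse_EFin lee_fin /q !normrM.
  by rewrite ler_wpM2r// (le_trans (hM x))// ler_norm.
- exact/integrableZl/integrable_normal_pdf.
Qed.

Let iqS A : measurable A -> mu.-integrable A (EFin \o q).
Proof. by move=> mA; apply: integrableS iq. Qed.

Let q_mass A : measurable A -> forall e, (N A <= e%:E)%E ->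
  `|\int[mu]_(x in A) q x| <= (M + M) * e.
Proof.
move=> mA e NAe; have M0 : 0 <= M + M by rewrite (le_trans (normr_ge0 _) (hM 0)).
rewrite (le_trans (le_normr_Rintegral mA (iqS mA)))//.
have ip : mu.-integrable A (EFin \o p).
  by apply: integrableS (integrable_normal_pdf 0 s).
have pE' : \int[mu]_(x in A) p x = fine (N A) by [].
apply: (@le_trans _ _ (\int[mu]_(x in A) ((M + M) * p x))).
  apply: le_Rintegral => //.
  - by apply: integrable_norm; exact: iqS.
  - exact: (integrableZl mA (M + M) ip).
  - by move=> x _; rewrite normrM (ger0_norm (normal_pdf_ge0 _ _ _)) ler_wpM2r ?normal_pdf_ge0.
rewrite RintegralZl// pE' ler_wpM2l// -lee_fin fineK//.
exact: fin_num_measure.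
Qed.

Let F x := \int[mu]_(t in `]-oo, x]) q t.

Let dF (x : R) : is_derive x 1 F (q x).
Proof.
have cq : {for x, continuous q}.
  by apply: cvgM; [exact: ch|exact: continuous_normal_pdf].
have [] := @continuous_FTC1 R q -oo%O x (x + 1) _ (iqS _) _ cq.
- by rewrite ltrDl.
- exact: measurable_itv.
- by rewrite ltNyr.
- by move=> dFx FxE; apply: DeriveDef; [exact: dFx|rewrite -FxE derive1E].
Qed.

Let q0 : \int[mu]_x q x = 0.
Proof.
rewrite /Rintegral -integral_normal_prob//.
by rewrite -/(mean N h) meanB ?mean_cst ?subrr//; exact: bounded_mfun_cst.
Qed.

Let FC x : F x = - \int[mu]_(t in `]x, +oo[) q t.
Proof.
apply/eqP; rewrite -addr_eq0 -Rintegral_setU//=.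
- by rewrite -setCitvl setUv q0.
- by rewrite -setCitvl setUv.
- by rewrite -setCitvl; apply/disj_setPS; rewrite setICr.
Qed.

Let FNy e : 0 < e -> forall x, exists2 y, y < x & `|F y| <= e.
Proof.
move=> e0 x; have M1 : 0 < M + M + 1.
  by rewrite ltr_wpDl// (le_trans (normr_ge0 _) (hM 0)).
have [y yx Ny] := mass_Ny (divr_gt0 e0 M1) x; exists y => //.
rewrite (le_trans (q_mass _ Ny))// mulrCA ger_pMr// ler_pdivrMr// mul1r.
by rewrite lerDl.
Qed.

Let Fy e : 0 < e -> forall x, exists2 y, x < y & `|F y| <= e.
Proof.
move=> e0 x; have M1 : 0 < M + M + 1.
  by rewrite ltr_wpDl// (le_trans (normr_ge0 _) (hM 0)).
have [y yx Ny] := mass_y (divr_gt0 e0 M1) x; exists y => //.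
rewrite FC normrN (le_trans (q_mass _ Ny))// mulrCA ger_pMr// ler_pdivrMr// mul1r.
by rewrite lerDl.
Qed.

(** With density [p] of the normal law, the solution of Stein's equation is
    [F / (v p)], where [F] is the primitive of [(f - c) p] vanishing at minus
    infinity; [F] also vanishes at plus infinity because [c] is the mean of [f]. *)
Lemma stein_equation : exists g dg : R -> R,
  [/\ forall x : R, is_derive x 1 g (dg x), continuous dg,
      exists B, forall x, `|dg x| <= B &
      forall x, v * dg x - x * g x = f x - c].
Proof.
pose k := normal_peak s.
pose e x := (v * k)^-1 * expR ((2 * v)^-1 * x ^+ 2).
have de (x : R) : is_derive x 1 e (x / v * e x).
  have -> : x / v * e x =
      (v * k)^-1 * (x / v * expR ((2 * v)^-1 * x ^+ 2)) by rewrite mulrCA.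
  have -> : e = (v * k)^-1 \*: (fun y : R => expR ((2 * v)^-1 * y ^+ 2)).
    by [].
  apply: is_derive_eq; rewrite /GRing.scale/=.
  by field; rewrite gt_eqF//= gt_eqF.
have pe x : p x * e x = v^-1.
  rewrite pE /e mulrACA -expRD mulNr addNr expR0 mulr1.
  by rewrite invfM mulrCA divff ?mulr1// gt_eqF.
pose g x := F x * e x.
pose dg x := (h x + x * g x) / v.
have gM x : `|x * g x| <= M + M.
  rewrite /g mulrA normrM [X in _ * X]ger0_norm; last first.
    by rewrite mulr_ge0 ?expR_ge0// invr_ge0 mulr_ge0 ?ltW.
  rewrite (le_trans (ler_wpM2r _ (stein_tail_bound v0 p_gt0 hM dp dF FNy Fy x)))//.
    by rewrite mulr_ge0 ?expR_ge0// invr_ge0 mulr_ge0 ?ltW.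
  by rewrite -[leLHS]mulrA pe -mulrA divff ?mulr1// gt_eqF.
have dgP (x : R) : is_derive x 1 g (dg x).
  have -> : g = F * e by apply/funext.
  apply: (is_derive_eq (is_deriveM (dF x) (de x))).
  rewrite /GRing.scale/= /dg /g /q [e x * (h x * p x)]mulrCA [e x * p x]mulrC pe.
  by field; rewrite gt_eqF.
exists g, dg; split => //.
- move=> x; apply: cvgM; last exact: cvg_cst.
  apply: cvgD; first exact: ch.
  apply: cvgM; first exact: cvg_id.
  exact: (is_derive_continuous dgP).
- exists ((M + M + (M + M)) / v) => x.
  have iv0 : 0 < v^-1 by rewrite invr_gt0.
  rewrite /dg normrM (gtr0_norm iv0); apply: ler_wpM2r; first exact: ltW.
  by rewrite (le_trans (ler_normD _ _))// lerD.
- by move=> x; rewrite /dg mulrC divfK ?gt_eqF// addrK.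
Qed.

End gaussian_density.

(** * A central limit theorem for triangular arrays of bounded variables *)

(** Uniform continuity of a bounded continuous function on a compact interval,
    completed outside of it by a quadratic term, which bounded second moments
    make harmless. *)
Lemma quadratic_modulus (R : realType) (f : R -> R) (M e : R) :
  continuous f -> (forall x, `|f x| <= M) -> 0 < e ->
  exists2 r, 0 < r & forall x y, `|y - x| <= r -> `|f y - f x| <= e + e * x ^+ 2.
Proof.
move=> cf fM e0; have M0 : 0 <= M by exact: le_trans (normr_ge0 _) (fM 0).
pose A := (M + M) / e + 1.
have A1 : 1 <= A by rewrite lerDr divr_ge0 ?(ltW e0)// addr_ge0.
have unif : \forall r \near 0^'+, `[- A, A] `<=`
    [set x | forall y, `|y - x| <= r -> `|f y - f x| <= e].
  have /compact_near_coveringP cov := @segment_compact R (- A) A.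
  apply: (cov R (0^'+) (fun r x => forall y, `|y - x| <= r -> `|f y - f x| <= e)) => x _.
  have e20 : 0 < e / 2 by rewrite divr_gt0.
  have /cvgrPdist_le/(_ _ e20)/nbhs_normP[r /= r0 rP] := cf x.
  have r20 : 0 < r / 2 by rewrite divr_gt0.
  exists (ball x (r / 2), [set z | z < r / 2]) => /=.
    by split; [exact: nbhsx_ballx|exact: nbhs_right_lt].
  move=> [x' r'] [/= xx' r'r] y yx'.
  have fx' : `|f x - f x'| <= e / 2.
    by apply: rP => /=; rewrite (lt_trans xx')// gtr_pMr// invf_lt1// ltr1n.
  have fy : `|f x - f y| <= e / 2.
    apply: rP => /=; rewrite (splitr r) -(subrKA x') (le_lt_trans (ler_normD _ _))//.
    by rewrite ltrD// (le_lt_trans _ r'r)// distrC.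
  by rewrite (splitr e) -(subrKA (f x)) (le_trans (ler_normD _ _))// lerD// distrC.
have [r r0 rP] : exists2 r, 0 < r & `[- A, A] `<=`
    [set x | forall y, `|y - x| <= r -> `|f y - f x| <= e].
  near (0 : R)^'+ => r; exists r => //.
  by near: r.
exists r => // x y yx; have [xA|xA] := leP `|x| A.
  rewrite (le_trans (rP x _ y yx))//; first by rewrite /= in_itv/= -ler_norml.
  by rewrite lerDl mulr_ge0 ?sqr_ge0// ltW.
have x1 : 1 <= `|x| by rewrite (le_trans A1)// ltW.
have MMx : M + M <= e * x ^+ 2.
  rewrite -real_normK ?num_real// mulrC -ler_pdivrMr//.
  rewrite (@le_trans _ _ `|x|)//.
    by rewrite (le_trans _ (ltW xA))// lerDl.
  by rewrite expr2 ler_peMr.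
rewrite (le_trans (ler_normB _ _))// (le_trans (lerD (fM _) (fM _)))//.
by rewrite (le_trans MMx)// lerDr ltW.
Unshelve. all: by end_near. Qed.

(** Clipping turns a function that is only bounded along a random variable into a
    bounded one without changing the composite. *)
Lemma bounded_mfun_clip d (T : measurableType d) (R : realType) (f : T -> R) (A : R) :
  measurable_fun [set: T] f ->
  bounded_mfun (fun x => Num.max (- `|A|) (Num.min `|A| (f x))).
Proof.
move=> mf; split; first by apply: measurable_maxr => //; exact: measurable_minr.
exists `|A| => x; rewrite ler_norml le_max lexx/= ge_max ge_min lexx/= andbT.
by rewrite (le_trans _ (normr_ge0 A))// oppr_le0.
Qed.

Lemma clipK (R : realType) (A x : R) : `|x| <= A ->
  Num.max (- `|A|) (Num.min `|A| x) = x.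
Proof.
move=> xA; have := le_trans xA (ler_norm A).
rewrite ler_norml => /andP[Ax xA'].
by rewrite min_r// max_r.
Qed.

Section stein_row.
Context d (Omega : measurableType d) (R : realType) (P : probability Omega R).
Context d' (T : measurableType d') (Z : nat -> Omega -> T).
Hypothesis mZ : forall i, measurable_fun [set: Omega] (Z i).
Hypothesis indZ : mutually_independent P Z.
Variables (n : nat) (a : nat -> T -> R) (r : R).
Hypothesis ba : forall i, bounded_mfun (a i).
Hypothesis ar : forall i, (i < n)%N -> forall z, `|a i z| <= r.
Hypothesis a0 : forall i, (i < n)%N -> mean P (fun w => a i (Z i w)) = 0.

Local Notation E := (mean P).

Let S w := \sum_(i < n) a i (Z i w).
Let S' k w := S w - a k (Z k w).
Let V := \sum_(i < n) E (fun w => a i (Z i w) ^+ 2).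

Let baZ i : bounded_mfun (fun w => a i (Z i w)).
Proof. exact: bounded_mfun_comp (mZ i) (ba i). Qed.

Let bS : bounded_mfun S.
Proof. by apply: bounded_mfun_sum => i; exact: baZ. Qed.

Let bS' k : bounded_mfun (S' k).
Proof. exact: bounded_mfunB. Qed.

(** Only the values that [g] takes along [S' k] matter, so [g] may be clipped to a
    bounded function; a summand is independent of the sum of the others. *)
Let mean_mul k (u : T -> R) (g : R -> R) : (k < n)%N ->
  bounded_mfun u -> continuous g ->
  E (fun w => u (Z k w) * g (S' k w)) =
  E (fun w => u (Z k w)) * E (fun w => g (S' k w)).
Proof.
move=> kn bu cg.
pose J := [seq i <- index_iota 0 n | i != k].
have S'E : S' k = fun w => \sum_(i <- J) a i (Z i w).
  apply/funext => w; rewrite /S' /S -(big_mkord xpredT (fun i => a i (Z i w))).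
  rewrite (bigD1_seq k) ?iota_uniq ?mem_index_iota//= addrC addrK.
  by rewrite big_filter.
have ind : independent2 P (Z k) (S' k).
  rewrite S'E; apply: (@independent2_sum _ _ _ P _ _ Z mZ indZ a _ k J).
  - by move=> i; case: (ba i).
  - by rewrite filter_uniq// iota_uniq.
  - by rewrite mem_filter eqxx.
have bg := bounded_mfun_continuous cg (bS' k).
have [_ [A gA]] := bg.
have := mean_prod_independent2 (mZ k) (bS' k).1 ind bu
  (bounded_mfun_clip A (continuous_measurable_fun cg)).
have clipE w : Num.max (- `|A|) (Num.min `|A| (g (S' k w))) = g (S' k w).
  by apply: clipK; exact: gA.
rewrite (eq_mean P (fun w => congr1 _ (clipE w))) => ->; congr (_ * _).
exact: eq_mean.
Qed.

Let mean_centered k (g : R -> R) : (k < n)%N -> continuous g ->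
  E (fun w => a k (Z k w) * g (S' k w)) = 0.
Proof. by move=> kn cg; rewrite mean_mul// a0// mul0r. Qed.

Let baX i m : bounded_mfun (fun w => a i (Z i w) ^+ m).
Proof. exact: bounded_mfunX. Qed.

Lemma second_moment_sum : E (fun w => S w ^+ 2) = V.
Proof.
have -> : E (fun w => S w ^+ 2) =
    E (fun w => \sum_(i < n) (a i (Z i w) * S' i w + a i (Z i w) ^+ 2)).
  apply: eq_mean => w; rewrite expr2 {1}/S mulr_suml; apply: eq_bigr => i _.
  by rewrite /S' expr2 -mulrDr subrK.
rewrite mean_sum; last first.
  by move=> i; apply: bounded_mfunD => //; exact: bounded_mfunM.
apply: eq_bigr => i _; rewrite meanD//; last exact: bounded_mfunM.
rewrite (_ : E _ = 0) ?add0r//; apply: (@mean_centered i id) => //.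
by move=> x; exact: cvg_id.
Qed.

Let var_le i : (i < n)%N -> 0 <= E (fun w => a i (Z i w) ^+ 2) <= r ^+ 2.
Proof.
move=> ni; rewrite mean_ge0/=; last by move=> w; exact: sqr_ge0.
apply: ler_mean_cst => // w.
rewrite -real_normK ?num_real//.
by rewrite lerXn2r ?nnegrE//; [exact: le_trans (ar ni (Z i w))|exact: ar].
Qed.

Let V_le : V <= n%:R * r ^+ 2.
Proof.
rewrite -[n in n%:R]card_ord -sum1_card natr_sum mulr_suml ler_sum// => i _.
by rewrite mul1r; have /andP[] := var_le (ltn_ord i).
Qed.

(** In [E (a k) g(S)], replace [S] by [S' k]: the zeroth-order term vanishes by
    independence and centering, the first-order one gives the variance of [a k]
    times [E dg(S' k)], and what remains is controlled by the modulus of [dg] at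
    scale [r]. *)
Lemma stein_identity_approx (g dg : R -> R) (e : R) :
  (forall x : R, is_derive x 1 g (dg x)) -> continuous dg -> 0 <= e ->
  (exists B, forall x, `|dg x| <= B) ->
  (forall x y, `|y - x| <= r -> `|dg y - dg x| <= e + e * x ^+ 2) ->
  `|V * E (fun w => dg (S w)) - E (fun w => S w * g (S w))| <=
  3 * (n%:R * r ^+ 2) * (e + e * (n%:R * r ^+ 2)).
Proof.
move=> dgP cdg e0 [B dgB] dgr; have cg := is_derive_continuous dgP.
have bgS : bounded_mfun (fun w => g (S w)) by exact: bounded_mfun_continuous.
have bgS' k : bounded_mfun (fun w => g (S' k w)).
  exact: bounded_mfun_continuous.
have bdS : bounded_mfun (fun w => dg (S w)) by exact: bounded_mfun_continuous.
have bdS' k : bounded_mfun (fun w => dg (S' k w)).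
  exact: bounded_mfun_continuous.
pose D w := e + e * S w ^+ 2.
have bD : bounded_mfun D.
  apply: bounded_mfunD; first exact: bounded_mfun_cst.
  by apply: bounded_mfunM; [exact: bounded_mfun_cst|exact: bounded_mfunX].
have D0 w : 0 <= D w by rewrite addr_ge0// mulr_ge0// sqr_ge0.
have ED : 0 <= E D <= e + e * (n%:R * r ^+ 2).
  rewrite mean_ge0//= /D meanD; [|exact: bounded_mfun_cst|]; last first.
    by apply: bounded_mfunM; [exact: bounded_mfun_cst|exact: bounded_mfunX].
  rewrite mean_cst meanZ; last exact: bounded_mfunX.
  by rewrite second_moment_sum lerD2l ler_wpM2l.
(* one summand: a g(S) = a g(S') + a ^ 2 dg(S') + remainder *)
pose rem k w := a k (Z k w) * g (S w) - a k (Z k w) * g (S' k w)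
  - a k (Z k w) ^+ 2 * dg (S' k w).
have brem k : bounded_mfun (rem k).
  apply: bounded_mfunB; last exact: bounded_mfunM.
  by apply: bounded_mfunB; exact: bounded_mfunM.
have S'S (k : 'I_n) w : `|S' k w - S w| <= r.
  by rewrite /S' addrAC subrr sub0r normrN ar.
have remD (k : 'I_n) w : `|rem k w| <= r ^+ 2 * (D w + D w).
  have [c Sc gE] : exists2 c, `|c - S w| <= r &
      g (S w) - g (S' k w) = dg c * a k (Z k w).
    have aE : a k (Z k w) = S w - S' k w by rewrite /S' opprB addrC subrK.
    have := S'S k w.
    have [SS'|SS'|SS'] := ltgtP (S' k w) (S w) => S'r.
    - have [c /andP[c1 c2] cE] := mean_value_lt dgP SS'.
      exists c; last by rewrite aE.
      rewrite (le_trans _ S'r)// !ltr0_norm ?subr_lt0// lerN2 lerB// ltW//.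
    - have [c /andP[c1 c2] cE] := mean_value_lt dgP SS'.
      exists c; last by rewrite aE -opprB cE -mulrN opprB.
      rewrite (le_trans _ S'r)// !gtr0_norm ?subr_gt0// lerB// ltW//.
    - exists (S w); first by rewrite subrr normr0 (le_trans _ S'r).
      by rewrite aE -SS' !subrr mulr0.
  rewrite /rem -mulrBr gE.
  have -> : a k (Z k w) * (dg c * a k (Z k w)) - a k (Z k w) ^+ 2 * dg (S' k w)
      = a k (Z k w) ^+ 2 * ((dg c - dg (S w)) - (dg (S' k w) - dg (S w))) by ring.
  rewrite normrM ler_pM//.
    rewrite normrX lerXn2r ?nnegrE// ?(le_trans _ S'r) ?ar//.
    by rewrite (le_trans _ (ar (ltn_ord k) (Z k w))).
  by rewrite (le_trans (ler_normB _ _))// lerD// dgr.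
have termE (k : 'I_n) : `|E (fun w => a k (Z k w) ^+ 2) * E (fun w => dg (S w))
    - E (fun w => a k (Z k w) * g (S w))| <= 3 * r ^+ 2 * E D.
  have -> : E (fun w => a k (Z k w) * g (S w)) =
      E (rem k) + E (fun w => a k (Z k w) ^+ 2) * E (fun w => dg (S' k w)).
    rewrite -(@mean_mul k (fun z => a k z ^+ 2))//; last exact: bounded_mfunX.
    rewrite -[in RHS]meanD//; last exact: bounded_mfunM.
    rewrite -[LHS]addr0 -(oppr0 R) -(mean_centered (ltn_ord k) cg).
    rewrite -meanB; [|exact: bounded_mfunM..].
    by apply: eq_mean => w; rewrite /rem subrK.
  have -> (x y z t : R) : x * y - (z + x * t) = x * (y - t) - z by ring.
  rewrite (le_trans (ler_normB _ _))//.
  have -> : 3 * r ^+ 2 * E D = r ^+ 2 * E D + r ^+ 2 * (E D + E D) by ring.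
  apply: lerD.
    have /andP[v0 vr] := var_le (ltn_ord k).
    rewrite normrM (ger0_norm v0) ler_pM// -meanB//.
    rewrite (le_trans (ler_norm_mean _ _))//; first exact: bounded_mfunB.
    apply: le_mean => //; first exact/bounded_mfun_norm/bounded_mfunB.
    by move=> w; rewrite distrC dgr.
  rewrite (le_trans (ler_norm_mean _ _))// -meanD// -meanZ; last exact: bounded_mfunD.
  apply: le_mean; [exact: bounded_mfun_norm| |by move=> w; exact: remD].
  by apply: bounded_mfunM; [exact: bounded_mfun_cst|exact: bounded_mfunD].
have -> : E (fun w => S w * g (S w)) =
    \sum_(k < n) E (fun w => a k (Z k w) * g (S w)).
  rewrite -mean_sum; last by move=> i; exact: bounded_mfunM.
  by apply: eq_mean => w; rewrite mulr_suml.
rewrite mulr_suml -sumrB (le_trans (ler_norm_sum _ _ _))//.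
rewrite (le_trans (ler_sum _ (fun k _ => termE k)))//.
rewrite sumr_const card_ord -[_ *+ n]mulr_natl.
have -> : n%:R * (3 * r ^+ 2 * E D) = 3 * (n%:R * r ^+ 2) * E D by ring.
rewrite ler_wpM2l//; last by case/andP: ED.
by apply: mulr_ge0 => //; apply: mulr_ge0 => //; exact: sqr_ge0.
Qed.

End stein_row.

Section clt.
Context d (Omega : measurableType d) (R : realType) (P : probability Omega R).
Context d' (T : measurableType d') (Z : nat -> Omega -> T).
Hypothesis mZ : forall i, measurable_fun [set: Omega] (Z i).
Hypothesis indZ : mutually_independent P Z.
Variables (b : nat -> nat -> T -> R) (C s2 : R) (rem : nat -> Omega -> R).
Hypothesis bb : forall n i, bounded_mfun (b n i).
Hypothesis bC : forall n i, (i < n)%N -> forall z, `|b n i z| <= C.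
Hypothesis b0 : forall n i, (i < n)%N -> mean P (fun w => b n i (Z i w)) = 0.
Hypothesis bV :
  n%:R^-1 * (\sum_(i < n) mean P (fun w => b n i (Z i w) ^+ 2)) @[n --> \oo] --> s2.
Hypothesis brem : forall n, bounded_mfun (rem n).
Hypothesis rem0 : mean P (fun w => `|rem n w|) @[n --> \oo] --> (0 : R).
Variables (f : R -> R) (M : R).
Hypotheses (cf : continuous f) (fM : forall x, `|f x| <= M).

Local Notation E := (mean P).

Let a n i z := (Num.sqrt n%:R)^-1 * b n i z.
Let S n w := \sum_(i < n) a n i (Z i w).
Let r n : R := (Num.sqrt n%:R)^-1 * C.
Let V n := \sum_(i < n) E (fun w => a n i (Z i w) ^+ 2).

Let sqrV n : (Num.sqrt n%:R : R)^-1 ^+ 2 = n%:R^-1.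
Proof. by rewrite exprVn sqr_sqrtr. Qed.

Let M0 : 0 <= M. Proof. exact: le_trans (normr_ge0 _) (fM 0). Qed.

Let ba n i : bounded_mfun (a n i).
Proof. by apply: bounded_mfunM => //; exact: bounded_mfun_cst. Qed.

Let ar n i : (i < n)%N -> forall z, `|a n i z| <= r n.
Proof.
by move=> ni z; rewrite normrM ger0_norm ?invr_ge0// ler_wpM2l ?invr_ge0// bC.
Qed.

Let a0 n i : (i < n)%N -> E (fun w => a n i (Z i w)) = 0.
Proof.
by move=> ni; rewrite meanZ ?b0 ?mulr0//; exact: bounded_mfun_comp (mZ i) (bb n i).
Qed.

Let VE n : V n = n%:R^-1 * (\sum_(i < n) E (fun w => b n i (Z i w) ^+ 2)).
Proof.
rewrite mulr_sumr; apply: eq_bigr => i _; rewrite -sqrV -meanZ.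
  by apply: eq_mean => w; rewrite exprMn.
by apply: bounded_mfunX; exact: bounded_mfun_comp (mZ i) (bb n i).
Qed.

Let cvgV : V n @[n --> \oo] --> s2.
Proof. by under eq_fun do rewrite VE. Qed.

Let nr2 n : n%:R * r n ^+ 2 <= C ^+ 2.
Proof.
rewrite exprMn sqrV mulrA; case: n => [|n]; first by rewrite !mul0r sqr_ge0.
by rewrite divff ?mul1r.
Qed.

Let bS n : bounded_mfun (S n).
Proof.
by apply: bounded_mfun_sum => i; exact: bounded_mfun_comp (mZ i) (ba n i).
Qed.

Let ES2 n : E (fun w => S n w ^+ 2) = V n.
Proof. exact: (second_moment_sum mZ indZ (ba n) (@a0 n)). Qed.

Let V_le n : V n <= C ^+ 2.
Proof.
apply: le_trans (nr2 n).
rewrite -[n in n%:R]card_ord -sum1_card natr_sum mulr_suml ler_sum// => i _.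
rewrite mul1r; apply: ler_mean_cst.
  by apply: bounded_mfunX; exact: bounded_mfun_comp (mZ i) (ba n i).
move=> w; rewrite -real_normK ?num_real//.
by rewrite lerXn2r ?nnegrE ?ar// (le_trans _ (ar (ltn_ord i) (Z i w))).
Qed.

Let bfS n : bounded_mfun (fun w => f (S n w)).
Proof. exact: bounded_mfun_continuous. Qed.

Let r_small e : 0 < e -> \forall n \near \oo, r n <= e.
Proof.
move=> e0; near=> n.
have n0 : 0 < (Num.sqrt n%:R : R).
  by rewrite sqrtr_gt0 ltr0n; near: n; exists 1%N.
rewrite /r mulrC ler_pdivrMr// mulrC -ler_pdivrMr//.
rewrite (le_trans (ler_norm _))// -sqrtr_sqr ler_wsqrtr//.
by near: n; exact: nbhs_infty_ger.
Unshelve. all: by end_near. Qed.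

(** Stein's equation turns [E f (S n)] minus the Gaussian mean into the defect
    of Stein's identity. *)
Let clt_pos : 0 < s2 ->
  E (fun w => f (S n w)) @[n --> \oo] --> mean (normal_prob 0 (Num.sqrt s2)) f.
Proof.
move=> s20; have [g [dg [dgP cdg [B dgB] steinE]]] := stein_equation s20 cf fM.
set c := mean (normal_prob _ _) f.
have B0 : 0 <= B by exact: le_trans (normr_ge0 _) (dgB 0).
apply/cvgrPdist_le => e e0.
have K0 : 0 < 3 * C ^+ 2 * (1 + C ^+ 2) + 1.
  have C2 : 0 <= C ^+ 2 by exact: sqr_ge0.
  by apply: ltr_wpDl => //; apply: mulr_ge0; [exact: mulr_ge0|exact: addr_ge0].
pose K := 3 * C ^+ 2 * (1 + C ^+ 2) + 1.
pose eta := e / 2 / K.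
have eta0 : 0 < eta by rewrite !divr_gt0.
have [dl dl0 dlP] := quadratic_modulus cdg dgB eta0.
have B10 : 0 < B + 1 by rewrite ltr_wpDl.
have eB : 0 < e / 2 / (B + 1) by rewrite !divr_gt0.
have /cvgrPdist_le/(_ _ eB) Vs := cvgV.
near=> n.
have rdl : r n <= dl by near: n; exact: r_small.
have Vn : `|s2 - V n| <= e / 2 / (B + 1) by near: n.
have := stein_identity_approx mZ indZ (ba n) (@ar n) (@a0 n) dgP cdg
  (ltW eta0) (ex_intro _ B dgB) (fun x y yx => dlP x y (le_trans yx rdl)).
rewrite -/(V n) -/(S n) => D.
have bgS : bounded_mfun (fun w => g (S n w)).
  apply: bounded_mfun_continuous (bS n); exact: (is_derive_continuous dgP).
have bdS : bounded_mfun (fun w => dg (S n w)) by exact: bounded_mfun_continuous.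
have -> : c - E (fun w => f (S n w)) =
    E (fun w => S n w * g (S n w)) - s2 * E (fun w => dg (S n w)).
  rewrite -meanZ// -meanB; [|exact: bounded_mfunM|]; last first.
    by apply: bounded_mfunM => //; exact: bounded_mfun_cst.
  rewrite -{1}(mean_cst P c) -meanB//; last exact: bounded_mfun_cst.
  by apply: eq_mean => w; rewrite -opprB -steinE opprB.
have -> : E (fun w => S n w * g (S n w)) - s2 * E (fun w => dg (S n w)) =
    - (V n * E (fun w => dg (S n w)) - E (fun w => S n w * g (S n w)))
    - (s2 - V n) * E (fun w => dg (S n w)) by ring.
rewrite (splitr e) (le_trans (ler_normB _ _))// lerD//.
  rewrite normrN (le_trans D)//.
  apply: (@le_trans _ _ (eta * K)); last by rewrite divfK// gt_eqF.
  have -> : eta * K = 3 * C ^+ 2 * (eta + eta * C ^+ 2) + eta by rewrite /K; ring.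
  apply: ler_wpDr; first exact: ltW.
  have r2 : 0 <= n%:R * r n ^+ 2 by rewrite mulr_ge0// sqr_ge0.
  apply: ler_pM => //; first by rewrite mulr_ge0.
  - by apply: addr_ge0; [exact: ltW|apply: mulr_ge0 => //; exact: ltW].
  - by rewrite ler_wpM2l.
  - by rewrite lerD2l ler_wpM2l// ltW.
have dgM : `|E (fun w => dg (S n w))| <= B by exact: ler_norm_mean_cst.
rewrite normrM (@le_trans _ _ (e / 2 / (B + 1) * B))//; first exact: ler_pM.
rewrite -[leRHS](divfK (lt0r_neq0 B10)); apply: ler_wpM2l; first exact: ltW.
by rewrite lerDl.
Unshelve. all: by end_near. Qed.

Let clt_zero : s2 = 0 -> E (fun w => f (S n w)) @[n --> \oo] --> f 0.
Proof.
move=> s20; apply/cvgrPdist_le => e e0.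
have e20 : 0 < e / 2 by rewrite divr_gt0.
have [dl dl0 dlP] := quadratic_modulus cf fM e20.
pose K := (M + M) / dl ^+ 2.
have K0 : 0 <= K by rewrite divr_ge0 ?sqr_ge0// addr_ge0.
have fK x : `|f x - f 0| <= e / 2 + K * x ^+ 2.
  have [xdl|xdl] := leP `|x| dl.
    have := dlP 0 x; rewrite subr0 expr0n/= mulr0 addr0 => /(_ xdl) /le_trans; apply.
    by rewrite lerDl mulr_ge0// sqr_ge0.
  have MMx : M + M <= K * x ^+ 2.
    rewrite /K mulrAC -mulrA ler_peMr ?addr_ge0//.
    rewrite ler_pdivlMr ?exprn_gt0// mul1r -[x ^+ 2]real_normK ?num_real//.
    by rewrite lerXn2r ?nnegrE// ltW.
  rewrite (le_trans (ler_normB _ _))// (le_trans (lerD (fM _) (fM _)))//.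
  by rewrite (le_trans MMx)// lerDr ltW.
have eK : 0 < e / 2 / (K + 1) by rewrite divr_gt0// ltr_wpDl.
have := cvgV; rewrite s20 => /cvgrPdist_le/(_ _ eK) Vs.
near=> n.
have Vn : `|0 - V n| <= e / 2 / (K + 1) by near: n.
have bKS : bounded_mfun (fun w => K * S n w ^+ 2).
  by apply: bounded_mfunM; [exact: bounded_mfun_cst|exact: bounded_mfunX].
rewrite distrC -{1}(mean_cst P (f 0)) -meanB//; last exact: bounded_mfun_cst.
have bd : bounded_mfun (fun w => f (S n w) - f 0).
  by apply: bounded_mfunB => //; exact: bounded_mfun_cst.
rewrite (le_trans (ler_norm_mean _ bd))//.
apply: (@le_trans _ _ (E (fun w => e / 2 + K * S n w ^+ 2))).
  apply: le_mean; first exact: bounded_mfun_norm.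
    by apply: bounded_mfunD => //; exact: bounded_mfun_cst.
  by move=> w; exact: fK.
rewrite meanD//; last exact: bounded_mfun_cst.
rewrite mean_cst meanZ; last exact: bounded_mfunX.
rewrite ES2 [leRHS]splitr lerD2l.
apply: (@le_trans _ _ ((K + 1) * `|0 - V n|)).
  rewrite sub0r normrN ler_pM//.
  - by rewrite -ES2 mean_ge0// => w; exact: sqr_ge0.
  - by rewrite lerDl.
  - exact: ler_norm.
by rewrite mulrC -ler_pdivlMr// ltr_wpDl.
Unshelve. all: by end_near. Qed.

(** A perturbation smaller than the scale of the modulus moves [f] by little; a
    larger one is charged to [`|rem|] since [f] is bounded. *)
Let slutsky (L : R) : E (fun w => f (S n w)) @[n --> \oo] --> L ->
  E (fun w => f (S n w + rem n w)) @[n --> \oo] --> L.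
Proof.
move=> fL; apply: (cvg_sub0 _ fL) => /=.
apply/cvgrPdist_le => e e0.
have C1 : 0 < 1 + C ^+ 2 by rewrite ltr_pwDl// sqr_ge0.
have e20 : 0 < e / 2 / (1 + C ^+ 2) by rewrite !divr_gt0.
have [dl dl0 dlP] := quadratic_modulus cf fM e20.
set eta := e / 2 / _ in e20 dlP.
pose K := (M + M) / dl.
have K0 : 0 <= K by apply: divr_ge0; [exact: addr_ge0|exact: ltW].
have fK x y : `|f (x + y) - f x| <= (eta + eta * x ^+ 2) + K * `|y|.
  have x0 : 0 <= eta + eta * x ^+ 2.
    by apply: addr_ge0; [exact: ltW|rewrite mulr_ge0 ?sqr_ge0// ltW].
  have [ydl|ydl] := leP `|y| dl.
    rewrite (le_trans (dlP x (x + y) _))//; first by rewrite addrAC subrr add0r.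
    by rewrite lerDl mulr_ge0.
  rewrite (le_trans (ler_normB _ _))// (le_trans (lerD (fM _) (fM _)))//.
  apply: ler_wpDl => //; rewrite /K mulrAC -mulrA ler_peMr ?addr_ge0//.
  by rewrite ler_pdivlMr// mul1r ltW.
have eK : 0 < e / 2 / (K + 1) by rewrite !divr_gt0// ltr_wpDl.
have /cvgrPdist_le/(_ _ eK) rs := rem0.
near=> n.
have rn : `|0 - E (fun w => `|rem n w|)| <= e / 2 / (K + 1) by near: n.
have bfSr : bounded_mfun (fun w => f (S n w + rem n w)).
  by apply: bounded_mfun_continuous => //; exact: bounded_mfunD.
have br : bounded_mfun (fun w => `|rem n w|) by exact: bounded_mfun_norm.
have beS : bounded_mfun (fun w => eta * S n w ^+ 2).
  by apply: bounded_mfunM; [exact: bounded_mfun_cst|exact: bounded_mfunX].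
have beS' : bounded_mfun (fun w => eta + eta * S n w ^+ 2).
  by apply: bounded_mfunD => //; exact: bounded_mfun_cst.
have bKr : bounded_mfun (fun w => K * `|rem n w|).
  by apply: bounded_mfunM => //; exact: bounded_mfun_cst.
rewrite sub0r normrN /= -[X in `|X|]meanB//.
have bd : bounded_mfun (fun w => f (S n w + rem n w) - f (S n w)).
  exact: bounded_mfunB.
rewrite (le_trans (ler_norm_mean _ bd))//.
apply: (@le_trans _ _ (E (fun w => (eta + eta * S n w ^+ 2) + K * `|rem n w|))).
  apply: le_mean; [exact: bounded_mfun_norm|exact: bounded_mfunD|].
  by move=> w; exact: fK.
rewrite meanD// meanD//; last exact: bounded_mfun_cst.
rewrite mean_cst !meanZ//; last exact: bounded_mfunX.
rewrite ES2 [leRHS]splitr lerD//.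
  rewrite -{1}[eta]mulr1 -mulrDr (@le_trans _ _ (eta * (1 + C ^+ 2)))//.
    by apply: ler_wpM2l; [exact: ltW|rewrite lerD2l].
  by rewrite divfK// gt_eqF.
apply: (@le_trans _ _ ((K + 1) * `|0 - E (fun w => `|rem n w|)|)).
  rewrite sub0r normrN ler_pM//.
  - exact: mean_ge0.
  - by rewrite lerDl.
  - exact: ler_norm.
by rewrite mulrC -ler_pdivlMr// ltr_wpDl.
Unshelve. all: by end_near. Qed.

(** If the limit variance vanishes, the sums tend to 0 in mean square; otherwise
    Stein's equation applies. *)
Lemma central_limit_theorem :
  (\int[P]_w (f ((Num.sqrt n%:R)^-1 * (\sum_(i < n) b n i (Z i w)) + rem n w))%:E)%E
    @[n --> \oo] --> (\int[gaussian 0 s2]_x (f x)%:E)%E.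
Proof.
have bfSr n : bounded_mfun (fun w => f (S n w + rem n w)).
  by apply: bounded_mfun_continuous => //; exact: bounded_mfunD.
have -> : (fun n => (\int[P]_w
    (f ((Num.sqrt n%:R)^-1 * (\sum_(i < n) b n i (Z i w)) + rem n w))%:E)%E) =
    (fun n => (E (fun w => f (S n w + rem n w)))%:E).
  apply/funext => n; rewrite -meanE//; apply: eq_integral => w _.
  by rewrite mulr_sumr.
have mf : measurable_fun [set: R] f by exact: continuous_measurable_fun.
have s2ge0 : 0 <= s2.
  rewrite -(cvg_lim _ cvgV)//; apply: limr_ge; first exact: cvgP cvgV.
  by near=> n; rewrite -ES2 mean_ge0// => w; exact: sqr_ge0.
rewrite /gaussian; case: eqVneq => [s20|s20].
  rewrite integral_dirac//=; last exact/measurable_EFinP.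
  rewrite diracT mul1e; apply: cvg_EFin; first by near=> n.
  by apply: slutsky; exact: clt_zero.
have bf : bounded_mfun f by split => //; exists M.
rewrite (meanE (normal_prob 0 (Num.sqrt s2)) bf).
apply: cvg_EFin; first by near=> n.
by apply: slutsky; apply: clt_pos; rewrite lt_neqAle eq_sym s20.
Unshelve. all: by end_near. Qed.

End clt.

(** * Orthonormal bases of a reproducing kernel Hilbert space *)

(** Evaluate at the minimizer [b / c]; if [c] is zero the polynomial is affine, so
    [b] is zero as well. Every Cauchy-Schwarz inequality below comes from this. *)
Lemma discriminant_le (R : realFieldType) (a b c : R) : 0 <= c ->
  (forall t, 0 <= a - t * b *+ 2 + t ^+ 2 * c) -> b ^+ 2 <= a * c.
Proof.
move=> c0 q; have [c00|cN0] := eqVneq c 0.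
  have [->|bN0] := eqVneq b 0; first by rewrite c00 mulr0 expr0n.
  have := q ((a + 1) / (b *+ 2)).
  have -> : a - (a + 1) / (b *+ 2) * b *+ 2 + ((a + 1) / (b *+ 2)) ^+ 2 * c = - 1.
    by rewrite c00; field.
  by rewrite oppr_ge0 ler10.
have := q (b / c); have -> : a - b / c * b *+ 2 + (b / c) ^+ 2 * c = a - b ^+ 2 / c.
  by field.
by rewrite subr_ge0 ler_pdivrMr// lt_neqAle eq_sym cN0.
Qed.

Lemma sum_fsubset (V : nmodType) (T : choiceType) (t : T -> V) (J K : {fset T}) :
  (J `<=` K)%fset ->
  \sum_(e <- K) t e = \sum_(e <- J) t e + \sum_(e <- (K `\` J)%fset) t e.
Proof.
move=> JK; rewrite (big_fsetID _ (mem J))/=; congr (_ + _).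
  apply: eq_fbigl => e; rewrite !inE /=.
  by apply/andP/idP => [[]//|eJ]; split => //; exact: (fsubsetP JK).
by apply: eq_fbigl => e; rewrite !inE /= andbC.
Qed.

Section hilbert.
Context (R : realType) (X : Type) (H : rkhs R X).
Implicit Types f g h e : H.

Local Notation "<< f , g >>" := (rkhs_dot H f g).
Local Notation basis := (@onb R X H).

Lemma dotC f g : << f, g >> = << g, f >>.
Proof.
by have := @hermitian_subproof R H false idfun (rkhs_dot H) f g; rewrite expr0 mul1r.
Qed.

Lemma dotDl f g h : << f + g, h >> = << f, h >> + << g, h >>.
Proof. exact: linearDl. Qed.

Lemma dotDr f g h : << f, g + h >> = << f, g >> + << f, h >>.
Proof. exact: linearDr. Qed.

Lemma dotNl f g : << - f, g >> = - << f, g >>.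
Proof. exact: linearNl. Qed.

Lemma dotNr f g : << f, - g >> = - << f, g >>.
Proof. exact: linearNr. Qed.

Lemma dotBl f g h : << f - g, h >> = << f, h >> - << g, h >>.
Proof. by rewrite dotDl dotNl. Qed.

Lemma dotBr f g h : << f, g - h >> = << f, g >> - << f, h >>.
Proof. by rewrite dotDr dotNr. Qed.

Lemma dotZl a f g : << a *: f, g >> = a * << f, g >>.
Proof. by rewrite linearZl_LR. Qed.

Lemma dotZr a f g : << f, a *: g >> = a * << f, g >>.
Proof. by rewrite linearZr_LR. Qed.

Lemma dot0l f : << 0, f >> = 0. Proof. exact: linear0l. Qed.

Lemma dot_suml I (r : seq I) (Q : pred I) (F : I -> H) g :
  << \sum_(i <- r | Q i) F i, g >> = \sum_(i <- r | Q i) << F i, g >>.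
Proof. exact: linear_sumlz. Qed.

Lemma dot_sumr I (r : seq I) (Q : pred I) (F : I -> H) g :
  << g, \sum_(i <- r | Q i) F i >> = \sum_(i <- r | Q i) << g, F i >>.
Proof. exact: linear_sumr. Qed.

Lemma dot_ge0 f : 0 <= << f, f >>.
Proof. by rewrite -rkhs_normE sqr_ge0. Qed.

Lemma dot_cauchy_schwarz f g : `|<< f, g >>| <= `|f| * `|g|.
Proof.
rewrite -ler_sqr ?nnegrE ?mulr_ge0// exprMn !rkhs_normE real_normK ?num_real//.
apply: discriminant_le => [|t]; first exact: dot_ge0.
have := dot_ge0 (f - t *: g).
rewrite dotBl !dotBr !dotZl !dotZr (dotC g f).
by move=> h; rewrite (le_trans h)// le_eqVlt; apply/orP; left; apply/eqP; ring.
Qed.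

Lemma dot_continuous f : continuous (fun g => << f, g >>).
Proof.
move=> g; apply/cvgrPdist_le => e e0.
have f1 : 0 < `|f| + 1 by rewrite ltr_wpDl.
near=> h; rewrite -dotBr (le_trans (dot_cauchy_schwarz _ _))//.
have : `|g - h| <= e / (`|f| + 1).
  by near: h; apply: (@cvgr_dist_le _ _ _ (nbhs g) _ id g) => //; rewrite divr_gt0.
rewrite ler_pdivlMr// => gh; rewrite (le_trans _ gh)// mulrC ler_wpM2l//.
by rewrite lerDl.
Unshelve. all: by end_near. Qed.

(** By polarization, since the norm is continuous. *)
Lemma dot_continuous2 (Z : topologicalType) (u v : Z -> H) (z : Z) :
  {for z, continuous u} -> {for z, continuous v} ->
  {for z, continuous (fun x => << u x, v x >>)}.
Proof.
move=> cu cv.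
have -> : (fun x => << u x, v x >>) =
    (fun x => (`|u x + v x| ^+ 2 - `|u x - v x| ^+ 2) / 4).
  apply/funext => x; rewrite !rkhs_normE !(dotDl, dotDr, dotNl, dotNr) (dotC (v x)).
  by field.
have norm2 (g : Z -> H) : {for z, continuous g} ->
    `|g x| ^+ 2 @[x --> z] --> `|g z| ^+ 2.
  by move=> cg; rewrite expr2; under eq_fun do rewrite expr2;
    apply: cvgM; exact: cvg_norm.
apply: cvgM; last exact: cvg_cst.
by apply: cvgB; apply: norm2; [exact: cvgD|exact: cvgB].
Qed.

Lemma dot_eq f g : (forall h, << f, h >> = << g, h >>) -> f = g.
Proof.
move=> fg; apply/eqP; rewrite -subr_eq0 -normr_eq0 -sqrf_eq0 rkhs_normE.
by rewrite dotBl fg subrr.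
Qed.


(** Zorn's lemma: a maximal orthonormal set is an orthonormal basis, since a
    nonzero vector orthogonal to it could be normalized and added. *)
Lemma onbP : orthonormal_basis (basis).
Proof.
suff [B BP] : exists B : set H, orthonormal_basis B by exact: (xgetPex _ (ex_intro _ B BP)).
pose ortho (B : set H) := (forall e, B e -> << e, e >> = 1) /\
  (forall e e', B e -> B e' -> e <> e' -> << e, e' >> = 0).
have [F Fo totF|B [[B1 B0] Bmax]] := @Zorn_bigcup H ortho.
  split=> [e [A FA Ae]|e e' [A FA Ae] [A' FA' Ae']]; first by apply: (Fo A FA).1.
  have [AA'|A'A] := totF _ _ FA FA'.
    by apply: (Fo A' FA').2 => //; exact: AA'.
  by apply: (Fo A FA).2 => //; exact: A'A.
exists B; split => // h hB; apply: contrapT => /eqP h0.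
have nh0 : `|h| != 0 by rewrite normr_eq0.
pose u := `|h|^-1 *: h.
have u1 : << u, u >> = 1.
  by rewrite dotZl dotZr -rkhs_normE expr2 mulKf// mulVf.
have uB e : B e -> << u, e >> = 0 by move=> Be; rewrite dotZl hB// mulr0.
have Bu : ~ B u by move=> /uB; rewrite u1 => /eqP; rewrite oner_eq0.
apply: (Bmax (B `|` [set u])).
  split; first by left.
  by move=> /(_ u) uBB; apply: Bu; apply: uBB; right.
split=> [e [Be|->//]|e e' [Be|->] [Be'|->]//]; first exact: B1.
- by move=> ee'; exact: B0.
- by move=> _; rewrite dotC uB.
- by move=> _; rewrite uB.
Qed.

Let onb1 e : basis e -> << e, e >> = 1. Proof. by case: onbP => + _ _; apply. Qed.

Let onb0 e e' : basis e -> basis e' -> e != e' -> << e, e' >> = 0.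
Proof. by move=> Be Be' /eqP; case: onbP => _ + _; apply. Qed.

Let onb_total h : (forall e, basis e -> << h, e >> = 0) -> h = 0.
Proof. by case: onbP => _ _; apply. Qed.

Definition onb_comb (c : H -> R) (J : {fset H}) : H := \sum_(e <- J) c e *: e.

Let dot_comb c (J : {fset H}) e : [set` J] `<=` basis -> basis e ->
  << onb_comb c J, e >> = if e \in J then c e else 0.
Proof.
move=> JB Be; rewrite /onb_comb dot_suml; case: ifPn => eJ.
  rewrite (big_fsetD1 e)//= dotZl onb1// mulr1 big_seq big1 ?addr0// => e'.
  rewrite in_fsetD1 => /andP[e'e e'J]; rewrite dotZl onb0 ?mulr0//.
  exact: JB.
rewrite big_seq big1// => e' e'J; rewrite dotZl onb0 ?mulr0//; first exact: JB.
by apply: contraNneq eJ => <-.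
Qed.

Let norm_comb c (J : {fset H}) : [set` J] `<=` basis ->
  `|onb_comb c J| ^+ 2 = \sum_(e <- J) c e ^+ 2.
Proof.
move=> JB; rewrite rkhs_normE {2}/onb_comb dot_sumr big_seq [RHS]big_seq.
apply: eq_bigr => e eJ; rewrite dotZr dot_comb ?eJ -?expr2//; exact: JB.
Qed.

Let comb_sub c (J K : {fset H}) : (J `<=` K)%fset ->
  onb_comb c K - onb_comb c J = onb_comb c (K `\` J)%fset.
Proof. by move=> JK; rewrite /onb_comb (sum_fsubset _ JK) addrC addKr. Qed.

(** The combinations over finite sets whose sum of squares is nearly maximal form
    a Cauchy family. Its limit has the prescribed coefficients, because adding one
    more index to such a set increases the sum by little. *)
Lemma riesz_fischer (c : H -> R) (M : R) :
  (forall J : {fset H}, [set` J] `<=` basis -> \sum_(e <- J) c e ^+ 2 <= M) ->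
  exists h, (forall e, basis e -> << h, e >> = c e) /\
    forall eps, 0 < eps -> exists2 J : {fset H}, [set` J] `<=` basis &
      forall K : {fset H}, [set` K] `<=` basis -> (J `<=` K)%fset ->
        `|h - onb_comb c K| <= eps.
Proof.
move=> cM.
pose sums := [set \sum_(e <- J) c e ^+ 2 | J in [set J : {fset H} | [set` J] `<=` basis]].
have sup_sums : has_sup sums.
  split; first by exists (\sum_(e <- fset0) c e ^+ 2), fset0 => //= e.
  by exists M => _ [J JB <-]; exact: cM.
have le_sup (J : {fset H}) : [set` J] `<=` basis -> \sum_(e <- J) c e ^+ 2 <= sup sums.
  by move=> JB; apply: ub_le_sup; [case: sup_sums|exists J].
have near_sup eps : 0 < eps -> exists2 J : {fset H}, [set` J] `<=` basis &
    sup sums - eps < \sum_(e <- J) c e ^+ 2.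
  by move=> e0; have [_ [J JB <-] ?] := sup_adherent e0 sup_sums; exists J.
(* enlarging J beyond a near-maximal set changes the combination little *)
have near_comb eps (J K : {fset H}) : [set` J] `<=` basis -> [set` K] `<=` basis ->
    (J `<=` K)%fset -> sup sums - eps ^+ 2 < \sum_(e <- J) c e ^+ 2 -> 0 <= eps ->
    `|onb_comb c K - onb_comb c J| <= eps.
  move=> JB KB JK sJ eps0; rewrite -ler_sqr ?nnegrE// comb_sub// norm_comb.
    have := le_sup K KB; rewrite (sum_fsubset _ JK) => sK.
    by move: sJ; rewrite ltrBlDr => /ltW /(le_trans sK); rewrite lerD2l.
  by move=> e /=; rewrite inE => /andP[_] /KB.
have posn n : 0 < ((n.+1%:R : R)^-1) ^+ 2 by rewrite exprn_gt0.
pose J n := sval (cid2 (near_sup _ (posn n))).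
have JB n : [set` J n] `<=` basis by rewrite /J; case: cid2.
have Jsup n : sup sums - (n.+1%:R^-1) ^+ 2 < \sum_(e <- J n) c e ^+ 2.
  by rewrite /J; case: cid2.
have UB (A B : {fset H}) : [set` A] `<=` basis -> [set` B] `<=` basis ->
    [set` (A `|` B)%fset] `<=` basis.
  by move=> AB BB e /=; rewrite inE => /orP[/AB|/BB].
pose x n := onb_comb c (J n).
have x_near n (K : {fset H}) : [set` K] `<=` basis -> (J n `<=` K)%fset ->
    `|onb_comb c K - x n| <= n.+1%:R^-1.
  by move=> KB JK; apply: near_comb.
have xx m n : `|x m - x n| <= m.+1%:R^-1 + n.+1%:R^-1.
  rewrite -(subrKA (onb_comb c (J m `|` J n)%fset)) (le_trans (ler_normD _ _))//.
  rewrite lerD//; first by rewrite distrC x_near ?fsubsetUl//; exact: UB.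
  by rewrite x_near ?fsubsetUr//; exact: UB.
have small eps : 0 < eps -> \forall n \near \oo, n.+1%:R^-1 <= eps :> R.
  move=> e0; near=> n; rewrite invf_ple ?posrE//.
  rewrite (le_trans _ (_ : n%:R <= _))// ?ler_nat//.
  by near: n; exact: nbhs_infty_ger.
have /cvg_ex[h /= xh] : cvg (x @ \oo).
  apply/cauchy_cvgP/cauchy_exP => eps e0.
  have e30 : 0 < eps / 3 by rewrite divr_gt0.
  have [N _ NP] := small _ e30.
  exists (x N); exists N => // n /= Nn; rewrite -ball_normE/=.
  rewrite (le_lt_trans (xx _ _))// (@le_lt_trans _ _ (eps / 3 + eps / 3))//.
    by rewrite lerD//; apply: NP => /=.
  by lra.
have xhn n : `|h - x n| <= n.+1%:R^-1.
  apply/ler_addgt0Pr => eps e0.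
  have e20 : 0 < eps / 2 by rewrite divr_gt0.
  have : \forall m \near \oo, `|h - x m| <= eps / 2.
    by move/cvgrPdist_le : xh; apply.
  move=> hx; near \oo => m.
  rewrite -(subrKA (x m)) (le_trans (ler_normD _ _))//.
  rewrite [eps]splitr addrCA lerD//; first by near: m.
  rewrite (le_trans (xx _ _))// [leLHS]addrC lerD2l; near: m; exact: small.
exists h; split.
  move=> e Be; apply/eqP; rewrite -subr_eq0 -normr_le0; apply/ler_addgt0Pr => eps e0.
  have e20 : 0 < eps / 2 by rewrite divr_gt0.
  near \oo => n; rewrite add0r.
  have n2 : n.+1%:R^-1 <= eps / 2 :> R by near: n; exact: small.
  rewrite -(subrKA << x n, e >>) -dotBl (le_trans (ler_normD _ _))// [leRHS]splitr.
  apply: lerD.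
    rewrite (le_trans (dot_cauchy_schwarz _ _))//.
    have -> : `|e| = 1.
      by apply/eqP; rewrite -sqrp_eq1// rkhs_normE onb1.
    by rewrite mulr1 (le_trans (xhn n)).
  rewrite dot_comb//; case: ifPn => eJ; first by rewrite subrr normr0 ltW.
  have := x_near n (e |` J n)%fset; rewrite fsubsetU1 => /(_ _ isT).
  rewrite comb_sub ?fsubsetU1// => xe; rewrite sub0r normrN (le_trans _ n2)//.
  have eB : [set` (e |` J n)%fset] `<=` basis.
    by move=> e' /=; rewrite inE => /orP[|/JB//]; rewrite inE => /eqP ->.
  apply: le_trans (xe eB); rewrite /onb_comb.
  have -> : ((e |` J n) `\` J n)%fset = [fset e]%fset.
    apply/fsetP => e'; rewrite !inE; case: eqP => [->|_] /=; first by rewrite eJ.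
    by rewrite andbC andbN.
  rewrite big_seq_fset1 normrZ.
  have -> : `|e| = 1 by apply/eqP; rewrite -sqrp_eq1// rkhs_normE onb1.
  by rewrite mulr1.
move=> eps e0; have e20 : 0 < eps / 2 by rewrite divr_gt0.
near \oo => n.
have n2 : n.+1%:R^-1 <= eps / 2 :> R by near: n; exact: small.
exists (J n) => // K KB JK.
rewrite -(subrKA (x n)) (le_trans (ler_normD _ _))// [leRHS]splitr lerD//.
  by rewrite (le_trans (xhn n)).
by rewrite distrC (le_trans (x_near _ _ KB JK)).
Unshelve. all: by end_near. Qed.

Lemma bessel h (J : {fset H}) : [set` J] `<=` basis ->
  \sum_(e <- J) << h, e >> ^+ 2 <= `|h| ^+ 2.
Proof.
move=> JB; pose p := onb_comb (fun e => << h, e >>) J.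
have hp : << h, p >> = \sum_(e <- J) << h, e >> ^+ 2.
  by rewrite dot_sumr; apply: eq_bigr => e _; rewrite dotZr expr2.
have := dot_ge0 (h - p); rewrite dotBl !dotBr (dotC p h) hp -!rkhs_normE norm_comb//.
by rewrite subrr subr0 subr_ge0.
Qed.

(** The vector that Riesz-Fischer gives for these coefficients differs from [h] by
    a vector orthogonal to the basis, which is zero. *)
Lemma fourier h eps : 0 < eps -> exists2 J : {fset H}, [set` J] `<=` basis &
  forall K : {fset H}, [set` K] `<=` basis -> (J `<=` K)%fset ->
    `|h - onb_comb (fun e => << h, e >>) K| <= eps.
Proof.
move=> e0; have [h' [h'E h'P]] := riesz_fischer (fun J => @bessel h J).
suff hE : h = h'.
  have [J JB JP] := h'P _ e0; exists J => // K KB JK.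
  by rewrite {1}hE; exact: JP.
apply/eqP; rewrite -subr_eq0; apply/eqP/onb_total => e Be.
by rewrite dotBl h'E// subrr.
Qed.

(** Boundedness of [l] on finite combinations bounds the sums of squares of its
    values on the basis, so Riesz-Fischer provides the representative. *)
Lemma riesz_representation (l : H -> R) (K : R) :
  (forall a f g, l (a *: f + g) = a * l f + l g) ->
  (forall f, `|l f| <= K * `|f|) ->
  exists m, forall f, << m, f >> = l f.
Proof.
move=> ll lK.
have l0 : l 0 = 0 by have := ll 1 0 0; rewrite scaler0 addr0 mul1r; lra.
have lsum (J : {fset H}) c : l (onb_comb c J) = \sum_(e <- J) c e * l e.
  rewrite /onb_comb; elim: (enum_fset J) => [|e s IH]; first by rewrite !big_nil.
  by rewrite !big_cons ll IH.
have K0 : 0 <= `|K| by [].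
have lK' f : `|l f| <= `|K| * `|f|.
  by rewrite (le_trans (lK f))// ler_wpM2r// ler_norm.
have [J JB|m [mE _]] := @riesz_fischer l (`|K| ^+ 2).
  have := lK' (onb_comb l J); rewrite lsum.
  under eq_bigr do rewrite -expr2.
  rewrite -norm_comb// ger0_norm ?sqr_ge0// [X in X <= _ -> _]expr2 => lJ.
  rewrite lerXn2r ?nnegrE//.
  have [->//|n0] := eqVneq `|onb_comb l J| 0.
  by move: lJ; rewrite ler_pM2r// lt_neqAle eq_sym n0/=.
exists m => f; apply/eqP; rewrite -subr_eq0 -normr_le0; apply/ler_addgt0Pr => eps e0.
rewrite add0r.
have M0 : 0 < `|m| + `|K| + 1 by rewrite ltr_wpDl// addr_ge0.
have [J JB /(_ J JB (fsubset_refl _)) fJ] := fourier f (divr_gt0 e0 M0).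
set p := onb_comb _ J in fJ.
have pE : << m, p >> = l p.
  rewrite lsum dot_sumr big_seq [RHS]big_seq; apply: eq_bigr => e eJ.
  by rewrite dotZr mE//; exact: JB.
have lB : l f - l p = l (f - p).
  by have := ll (-1) p f; rewrite scaleN1r addrC => ->; rewrite mulN1r addrC.
have -> : << m, f >> - l f = << m, f - p >> - l (f - p) by rewrite dotBr pE -lB; ring.
rewrite (le_trans (ler_normB _ _))//.
apply: (@le_trans _ _ ((`|m| + `|K|) * `|f - p|)).
  by rewrite mulrDl lerD// dot_cauchy_schwarz.
apply: (@le_trans _ _ ((`|m| + `|K| + 1) * `|f - p|)).
  by rewrite ler_wpM2r// lerDl.
by rewrite mulrC -ler_pdivlMr.
Qed.

End hilbert.

(** * Hilbert-Schmidt operators *)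

(** Unconditional summation over a possibly uncountable index set. In this form the
    linearity of [hs_dot] needs no bookkeeping of positive and negative parts. *)
Definition net_sum (R : realType) (T : choiceType) (D : set T) (t : T -> R) (l : R) :=
  forall eps, 0 < eps -> exists2 J : {fset T}, [set` J] `<=` D &
    forall K : {fset T}, [set` K] `<=` D -> (J `<=` K)%fset ->
      `|\sum_(x <- K) t x - l| <= eps.

Lemma fsetU_subset (T : choiceType) (D : set T) (A B : {fset T}) :
  [set` A] `<=` D -> [set` B] `<=` D -> [set` (A `|` B)%fset] `<=` D.
Proof. by move=> AD BD x /=; rewrite inE => /orP[/AD|/BD]. Qed.

Section net_sum.
Context (R : realType) (T : choiceType) (D : set T).
Implicit Types t u : T -> R.

Lemma net_sum_unique t l l' : net_sum D t l -> net_sum D t l' -> l = l'.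
Proof.
move=> tl tl'; apply/eqP; rewrite -subr_eq0 -normr_le0; apply/ler_addgt0Pr => e e0.
rewrite add0r; have e20 : 0 < e / 2 by rewrite divr_gt0.
have [J JD JP] := tl _ e20; have [K KD KP] := tl' _ e20.
have JKD := fsetU_subset JD KD.
rewrite -(subrKA (\sum_(x <- (J `|` K)%fset) t x)) (le_trans (ler_normD _ _))//.
rewrite [leRHS]splitr lerD//; first by rewrite distrC JP// fsubsetUl.
by rewrite KP// fsubsetUr.
Qed.

Lemma net_sumD t u l m : net_sum D t l -> net_sum D u m ->
  net_sum D (fun x => t x + u x) (l + m).
Proof.
move=> tl um e e0; have e20 : 0 < e / 2 by rewrite divr_gt0.
have [J JD JP] := tl _ e20; have [K KD KP] := um _ e20.
exists (J `|` K)%fset; first exact: fsetU_subset.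
move=> L LD; rewrite fsubUset => /andP[JL KL].
rewrite big_split/= opprD addrACA (le_trans (ler_normD _ _))// [leRHS]splitr.
by rewrite lerD ?JP ?KP.
Qed.

Lemma net_sumZ a t l : net_sum D t l -> net_sum D (fun x => a * t x) (a * l).
Proof.
move=> tl e e0; have a0 : 0 < `|a| + 1 by rewrite ltr_wpDl.
have [J JD JP] := tl _ (divr_gt0 e0 a0); exists J => // K KD JK.
rewrite -mulr_sumr -mulrBr normrM (@le_trans _ _ ((`|a| + 1) * (e / (`|a| + 1))))//.
  by rewrite ler_pM// ?JP// lerDl.
by rewrite mulrC divfK// gt_eqF.
Qed.

Lemma eq_net_sum t u l : {in D, t =1 u} -> net_sum D t l -> net_sum D u l.
Proof.
move=> tu tl e e0; have [J JD JP] := tl _ e0; exists J => // K KD JK.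
rewrite (_ : \sum_(x <- K) u x = \sum_(x <- K) t x) ?JP//.
rewrite big_seq [RHS]big_seq; apply: eq_bigr => x xK; rewrite tu//.
by rewrite inE; exact: KD.
Qed.

Lemma net_sum_ge t l (J : {fset T}) : (forall x, D x -> 0 <= t x) ->
  net_sum D t l -> [set` J] `<=` D -> \sum_(x <- J) t x <= l.
Proof.
move=> t0 tl JD; apply/ler_addgt0Pr => e e0; have [K KD KP] := tl _ e0.
have := KP (J `|` K)%fset (fsetU_subset JD KD) (fsubsetUr _ _).
rewrite ler_norml => /andP[_]; rewrite lerBlDl => /(le_trans _); apply.
rewrite (sum_fsubset _ (fsubsetUl J K)) lerDl big_seq sumr_ge0// => x.
rewrite !inE => /andP[xJ /orP[]]; first by rewrite (negbTE xJ).
by move=> xK; apply: t0; exact: KD.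
Qed.

Lemma net_sum_ge0 t l : (forall x, D x -> 0 <= t x) -> net_sum D t l -> 0 <= l.
Proof.
move=> t0 tl; have := net_sum_ge t0 tl (J := fset0).
by rewrite big_seq_fset0; apply => x.
Qed.

Lemma esum_le_bound t M : (forall J : {fset T}, [set` J] `<=` D -> \sum_(x <- J) t x <= M) ->
  (\esum_(x in D) (t x)%:E <= M%:E)%E.
Proof.
move=> tM; apply: ge_ereal_sup => _ [A [fA AD] <-].
rewrite fsbig_finite//= sumEFin lee_fin; apply: tM => x /=.
by rewrite in_fset_set// inE => /AD.
Qed.

Lemma net_sum_esum t : (forall x, D x -> 0 <= t x) ->
  (\esum_(x in D) (t x)%:E < +oo)%E ->
  net_sum D t (fine (\esum_(x in D) (t x)%:E)).
Proof.
move=> t0 toov; set s := (\esum_(x in D) (t x)%:E)%E in toov *.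
have s0 : (0 <= s)%E by apply: esum_ge0 => x /t0; rewrite lee_fin.
have fins : s \is a fin_num by rewrite ge0_fin_numE.
move=> e e0.
have [_ [A [fA AD] <-]] := @ub_ereal_sup_adherent R _ _ e0 fins.
rewrite fsbig_finite//= sumEFin -[ereal_sup _]/s -(fineK fins) -EFinD lte_fin => sA.
exists (fset_set A) => [x /=|K KD AK]; first by rewrite in_fset_set// inE => /AD.
have Ks : \sum_(x <- K) t x <= fine s.
  rewrite -lee_fin fineK// -sumEFin; apply: ereal_sup_ubound.
  by exists [set` K]; [split|rewrite fsbig_finite//= set_fsetK].
rewrite ler0_norm ?subr_le0// opprB lerBlDl -lerBlDr (le_trans (ltW sA))//.
rewrite (sum_fsubset _ AK) lerDl big_seq sumr_ge0// => x.
by rewrite inE => /andP[_ xK]; apply: t0; exact: KD.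
Qed.

End net_sum.

Section hilbert_schmidt.
Context (R : realType) (TX TY : Type) (HX : rkhs R TX) (HY : rkhs R TY).
Implicit Types (A B C : HY -> HX) (f : HX) (g : HY).

Local Notation basis := (@onb R TY HY).
Local Notation HS := (@hilbert_schmidt R TX TY HX HY).
Local Notation dotX := (rkhs_dot HX).
Local Notation dotY := (rkhs_dot HY).

Lemma hs_net A : HS A -> exists l, net_sum basis (fun e => `|A e| ^+ 2) l.
Proof.
by move=> [_ _ Aoo]; eexists; apply: net_sum_esum Aoo => e _; exact: sqr_ge0.
Qed.

Lemma hs_intro A M : linear A -> continuous A ->
  (forall J : {fset HY}, [set` J] `<=` basis -> \sum_(e <- J) `|A e| ^+ 2 <= M) ->
  HS A.
Proof.
by move=> lA cA AM; split => //; rewrite (le_lt_trans (esum_le_bound AM))// ltry.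
Qed.

Let hs_bound A : HS A -> exists M,
  forall J : {fset HY}, [set` J] `<=` basis -> \sum_(e <- J) `|A e| ^+ 2 <= M.
Proof.
move=> hA; have [l lP] := hs_net hA; exists l => J JB.
by apply: net_sum_ge lP JB => e _; exact: sqr_ge0.
Qed.

Lemma hs_linear A : HS A -> linear A. Proof. by case. Qed.

(** The splitting into positive and negative parts computes the sum of an
    absolutely convergent family. *)
Lemma hs_dotP A B : HS A -> HS B ->
  net_sum basis (fun e => dotX (A e) (B e)) (hs_dot A B).
Proof.
move=> hA hB; have [M AM] := hs_bound hA; have [N BN] := hs_bound hB.
pose t e := dotX (A e) (B e).
have tle e : `|t e| <= `|A e| ^+ 2 + `|B e| ^+ 2.
  rewrite (le_trans (dot_cauchy_schwarz _ _))//.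
  have : 0 <= (`|A e| - `|B e|) ^+ 2 by exact: sqr_ge0.
  have : 0 <= `|A e| ^+ 2 by exact: sqr_ge0.
  have : 0 <= `|B e| ^+ 2 by exact: sqr_ge0.
  by nra.
have sumle (u : HY -> R) : (forall e, u e <= `|t e|) ->
    (\esum_(e in basis) (u e)%:E < +oo)%E.
  move=> ut; rewrite (le_lt_trans (@esum_le_bound R HY basis u (M + N) _)) ?ltry//.
  move=> J JB; rewrite (@le_trans _ _ (\sum_(e <- J) (`|A e| ^+ 2 + `|B e| ^+ 2)))//.
    by apply: ler_sum => e _; rewrite (le_trans (ut e)).
  by rewrite big_split/= lerD ?AM ?BN.
pose tp e := Num.max (t e) 0; pose tn e := Num.max (- t e) 0.
have tpP : net_sum basis tp (fine (\esum_(e in basis) (tp e)%:E)).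
  apply: net_sum_esum => [e _|]; first by rewrite le_max lexx orbT.
  by apply: sumle => e; rewrite ge_max ler_norm normr_ge0.
have tnP : net_sum basis tn (fine (\esum_(e in basis) (tn e)%:E)).
  apply: net_sum_esum => [e _|]; first by rewrite le_max lexx orbT.
  by apply: sumle => e; rewrite ge_max normr_ge0 andbT -normrN ler_norm.
have fin u : (forall e, basis e -> 0 <= u e) -> (forall e, u e <= `|t e|) ->
    (\esum_(e in basis) (u e)%:E)%E \is a fin_num.
  move=> u0 ut; rewrite ge0_fin_numE ?sumle//.
  by apply: esum_ge0 => e /u0; rewrite lee_fin.
have -> : hs_dot A B =
    fine (\esum_(e in basis) (tp e)%:E) + (- 1) * fine (\esum_(e in basis) (tn e)%:E).
  rewrite /hs_dot /= mulN1r -fineN -fineD ?fin_numN ?fin//.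
  - congr (fine (_ - _)); apply: eq_esum => e _.
      by rewrite funeposE EFin_max.
    by rewrite funenegE -EFinN EFin_max.
  - by move=> e _; rewrite le_max lexx orbT.
  - by move=> e; rewrite ge_max ler_norm normr_ge0.
  - by move=> e _; rewrite le_max lexx orbT.
  - by move=> e; rewrite ge_max normr_ge0 andbT -normrN ler_norm.
have := net_sumD tpP (net_sumZ (-1) tnP); apply: eq_net_sum => e _.
rewrite /tp /tn mulN1r; case: (leP 0 (t e)) => t0.
  by rewrite max_r ?oppr_le0// subr0.
by rewrite max_l ?oppr_ge0 ?ltW// opprK add0r.
Qed.

Lemma hs_dot_eq A B l : HS A -> HS B ->
  net_sum basis (fun e => dotX (A e) (B e)) l -> hs_dot A B = l.
Proof. by move=> hA hB; exact: net_sum_unique (hs_dotP hA hB). Qed.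

Lemma hsD A B : HS A -> HS B -> HS (A + B).
Proof.
move=> hA hB; have [M AM] := hs_bound hA; have [N BN] := hs_bound hB.
apply: (@hs_intro _ (2 * M + 2 * N)).
- move=> a u v; rewrite !fctE (hs_linear hA) (hs_linear hB).
  by rewrite scalerDr addrACA.
- by move=> x; apply: continuousD; [case: hA => _ + _|case: hB => _ + _]; apply.
- move=> J JB.
  apply: (@le_trans _ _ (\sum_(e <- J) (2 * `|A e| ^+ 2 + 2 * `|B e| ^+ 2))).
    apply: ler_sum => e _; rewrite fctE.
    have := ler_normD (A e) (B e).
    have : 0 <= (`|A e| - `|B e|) ^+ 2 by exact: sqr_ge0.
    have : 0 <= `|A e + B e| by [].
    by nra.
  by rewrite big_split/= -!mulr_sumr lerD// ler_wpM2l// ?AM ?BN.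
Qed.

Lemma hsZ a A : HS A -> HS (a *: A).
Proof.
move=> hA; have [M AM] := hs_bound hA.
apply: (@hs_intro _ (a ^+ 2 * M)).
- move=> b u v; rewrite !fctE (hs_linear hA).
  by rewrite scalerDr !scalerA mulrC.
- by move=> x; apply: continuousZr; case: hA => _ + _; apply.
- move=> J JB; under eq_bigr do rewrite fctE normrZ exprMn real_normK ?num_real//.
  by rewrite -mulr_sumr ler_wpM2l ?sqr_ge0// AM.
Qed.

Lemma hsN A : HS A -> HS (- A).
Proof. by rewrite -scaleN1r; exact: hsZ. Qed.

Lemma hsB A B : HS A -> HS B -> HS (A - B).
Proof. by move=> hA hB; apply: hsD => //; exact: hsN. Qed.

Lemma hs_dotC A B : hs_dot A B = hs_dot B A.
Proof.
have tE : (fun e => (dotX (A e) (B e))%:E) = (fun e => (dotX (B e) (A e))%:E).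
  by apply/funext => e; rewrite dotC.
by rewrite /hs_dot tE.
Qed.

Lemma hs_dotDl A B C : HS A -> HS B -> HS C ->
  hs_dot (A + B) C = hs_dot A C + hs_dot B C.
Proof.
move=> hA hB hC; apply: hs_dot_eq => //; first exact: hsD.
have := net_sumD (hs_dotP hA hC) (hs_dotP hB hC).
by apply: eq_net_sum => e _; rewrite fctE dotDl.
Qed.

Lemma hs_dotZl a A B : HS A -> HS B -> hs_dot (a *: A) B = a * hs_dot A B.
Proof.
move=> hA hB; apply: hs_dot_eq => //; first exact: hsZ.
have := net_sumZ a (hs_dotP hA hB).
by apply: eq_net_sum => e _; rewrite fctE dotZl.
Qed.

Lemma hs_dotNl A B : HS A -> HS B -> hs_dot (- A) B = - hs_dot A B.
Proof. by move=> hA hB; rewrite -scaleN1r hs_dotZl// mulN1r. Qed.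

Lemma hs_dotBl A B C : HS A -> HS B -> HS C ->
  hs_dot (A - B) C = hs_dot A C - hs_dot B C.
Proof. by move=> hA hB hC; rewrite hs_dotDl ?hs_dotNl//; exact: hsN. Qed.

Lemma hs_dotDr A B C : HS A -> HS B -> HS C ->
  hs_dot C (A + B) = hs_dot C A + hs_dot C B.
Proof. by move=> hA hB hC; rewrite hs_dotC hs_dotDl// !(hs_dotC C). Qed.

Lemma hs_dotBr A B C : HS A -> HS B -> HS C ->
  hs_dot C (A - B) = hs_dot C A - hs_dot C B.
Proof. by move=> hA hB hC; rewrite hs_dotC hs_dotBl// !(hs_dotC C). Qed.

Lemma hs_dotZr a A B : HS A -> HS B -> hs_dot A (a *: B) = a * hs_dot A B.
Proof. by move=> hA hB; rewrite hs_dotC hs_dotZl// hs_dotC. Qed.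

Lemma hs_dot_ge0 A : HS A -> 0 <= hs_dot A A.
Proof.
by move=> hA; apply: net_sum_ge0 (hs_dotP hA hA) => e _; exact: dot_ge0.
Qed.

Lemma hs_cauchy_schwarz A B : HS A -> HS B ->
  hs_dot A B ^+ 2 <= hs_dot A A * hs_dot B B.
Proof.
move=> hA hB; apply: discriminant_le => [|t]; first exact: hs_dot_ge0.
have htB : HS (t *: B) by exact: hsZ.
have hAB : HS (A - t *: B) by exact: hsB.
have := hs_dot_ge0 hAB.
rewrite hs_dotBl// !hs_dotBr// !hs_dotZl// !hs_dotZr// (hs_dotC B A).
by move=> h; rewrite (le_trans h)// le_eqVlt; apply/orP; left; apply/eqP; ring.
Qed.

Lemma hs_tensor g f : HS (tensor g f).
Proof.
apply: (@hs_intro _ (`|g| ^+ 2 * `|f| ^+ 2)).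
- by move=> a u v; rewrite /tensor dotDr dotZr scalerDl scalerA.
- by move=> x; apply: continuousZl; exact: dot_continuous.
- move=> J JB; under eq_bigr do rewrite /tensor normrZ exprMn real_normK ?num_real//.
  by rewrite -mulr_suml ler_wpM2r ?sqr_ge0// bessel.
Qed.

Let hs_fourier B f g eps : HS B -> 0 < eps ->
  exists2 J : {fset HY}, [set` J] `<=` basis &
  forall K : {fset HY}, [set` K] `<=` basis -> (J `<=` K)%fset ->
    `|dotX f (B g) - \sum_(e <- K) dotY g e * dotX f (B e)| <= eps.
Proof.
move=> hB e0; have [lB cB _] := hB.
have B0 : B 0 = 0 by have := lB (-1) 0 0; rewrite scaler0 addr0 scaleN1r addNr.
have f1 : 0 < `|f| + 1 by rewrite ltr_wpDl.
have eta0 := divr_gt0 e0 f1.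
have /cvgrPdist_le/(_ _ eta0)/nbhs_normP[r /= r0 rP] := cB 0.
have r20 : 0 < r / 2 by rewrite divr_gt0.
have [J JB JP] := fourier g r20; exists J => // K KB JK.
have -> : \sum_(e <- K) dotY g e * dotX f (B e) =
    dotX f (B (onb_comb (fun e => dotY g e) K)).
  have -> : B (onb_comb (fun e => dotY g e) K) = \sum_(e <- K) dotY g e *: B e.
    rewrite /onb_comb; elim: (enum_fset K) => [|e s IH]; first by rewrite !big_nil.
    by rewrite !big_cons lB IH.
  by rewrite dot_sumr; apply: eq_bigr => e _; rewrite dotZr.
set p := onb_comb _ _.
have BB : B (g - p) = B g - B p.
  by have := lB (-1) p g; rewrite !scaleN1r [- p + g]addrC [- B p + _]addrC.
rewrite -dotBr -BB.
rewrite (le_trans (dot_cauchy_schwarz _ _))//.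
have : `|B (g - p)| <= eps / (`|f| + 1).
  have := rP (g - p); rewrite /= sub0r normrN B0 sub0r normrN; apply.
  by rewrite (le_lt_trans (JP K KB JK))// gtr_pMr// invf_lt1// ltr1n.
rewrite ler_pdivlMr// => h; rewrite (le_trans _ h)// mulrC ler_wpM2l//.
by rewrite lerDl.
Qed.

(** The tail of the Hilbert-Schmidt norm of [B] controls the error uniformly in
    [f] and [g]. *)
Lemma hs_fourier_uniform B eps : HS B -> 0 < eps ->
  exists2 J : {fset HY}, [set` J] `<=` basis &
  forall K : {fset HY}, [set` K] `<=` basis -> (J `<=` K)%fset -> forall f g,
    `|dotX f (B g) - \sum_(e <- K) dotY g e * dotX f (B e)| <=
      eps * (`|f| ^+ 2 + `|g| ^+ 2).
Proof.
move=> hB e0; have [l lP] := hs_net hB.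
have [J JB JP] := lP _ (exprn_gt0 2 e0); exists J => // K KB JK f g.
have tail (L : {fset HY}) : [set` L] `<=` basis -> (K `<=` L)%fset ->
    \sum_(e <- (L `\` K)%fset) `|B e| ^+ 2 <= eps ^+ 2.
  move=> LB KL; have := JP K KB JK; rewrite ler_norml => /andP[Kl _].
  have := net_sum_ge (fun e _ => sqr_ge0 `|B e|) lP LB.
  by rewrite (sum_fsubset _ KL); lra.
apply/ler_addgt0Pr => eta eta0.
have [L LB LP] := hs_fourier f g hB eta0.
have KLB := fsetU_subset KB LB.
have := LP _ KLB (fsubsetUr _ _).
rewrite (sum_fsubset _ (fsubsetUl K L)) opprD addrA.
set b := \sum_(e <- (_ `\` _)%fset) _; set a := dotX f (B g) - _ => ab.
have -> : a = b + (a - b) by ring.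
rewrite (le_trans (ler_normD _ _))// lerD// /b (le_trans (ler_norm_sum _ _ _))//.
set D := (_ `\` _)%fset.
apply: (@le_trans _ _ (\sum_(e <- D) (eps * dotY g e ^+ 2 +
    `|f| ^+ 2 / eps * `|B e| ^+ 2))).
  apply: ler_sum => e _; rewrite normrM.
  have := dot_cauchy_schwarz f (B e); set y := `|dotX _ _|; set x := dotY g e => yf.
  apply: (@le_trans _ _ (`|x| * (`|f| * `|B e|))); first by rewrite ler_wpM2l.
  rewrite mulrAC -exprMn; set z := _ * `|B e|.
  rewrite -(real_normK (num_real x)).
  have z0 : 0 <= z by rewrite mulr_ge0.
  rewrite -(ler_pM2r e0) mulrDl divfK ?gt_eqF//.
  have : 0 <= (eps * `|x| - z) ^+ 2 by exact: sqr_ge0.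
  have : 0 <= `|x| * z * eps by rewrite !mulr_ge0// ltW.
  by nra.
rewrite big_split/= -!mulr_sumr mulrDr addrC lerD//.
  rewrite -mulrA [eps * _]mulrC; apply: ler_wpM2l; first exact: sqr_ge0.
  by rewrite mulrC ler_pdivrMr// -expr2 tail// fsubsetUl.
rewrite ler_pM2l//; apply: bessel => e /=; rewrite inE => /andP[_].
exact: KLB.
Qed.

(** The series that defines the left-hand side is the image under [B] of the Fourier
    series of [g]. *)
Lemma hs_dot_tensor g f B : HS B -> hs_dot (tensor g f) B = dotX f (B g).
Proof.
move=> hB; apply: hs_dot_eq => //; first exact: hs_tensor.
move=> e e0; have [J JB JP] := hs_fourier f g hB e0; exists J => // K KB JK.
rewrite distrC (_ : \sum_(x <- K) _ = \sum_(e <- K) dotY g e * dotX f (B e)) ?JP//.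
by apply: eq_bigr => x _; rewrite /tensor dotZl.
Qed.

Lemma hs_dot_tensor2 g f g' f' :
  hs_dot (tensor g f) (tensor g' f') = dotY g g' * dotX f f'.
Proof. by rewrite hs_dot_tensor ?/tensor ?dotZr 1?dotC//; exact: hs_tensor. Qed.

End hilbert_schmidt.

(** * Continuity and measurability on compact metric spaces *)

Section borel.
Context (R : realType).

Let measurable_of_open d (T : measurableType d) (f : T -> R) :
  (forall A : set R, open A -> measurable (f @^-1` A)) ->
  measurable_fun [set: T] f.
Proof.
move=> fo; apply: (measurability _ (RGenOpens.measurableE R)) => //.
by move=> _ [_ [a [b ->] <-]]; rewrite setTI; apply: fo; exact: interval_open.
Qed.

Let measurable_countable_bigcup d (T : measurableType d) I (B : set I) (F : I -> set T) :
  countable B -> (forall i, B i -> measurable (F i)) ->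
  measurable (\bigcup_(i in B) F i).
Proof.
move=> /countable_injP[c cinj] mF.
have -> : \bigcup_(i in B) F i =
    \bigcup_n \bigcup_(i in [set i | B i /\ c i = n]) F i.
  apply/seteqP; split=> [x [i Bi Fx]|x [n _ [i [Bi _] Fx]]]; last by exists i.
  by exists (c i) => //; exists i.
apply: bigcupT_measurable => n.
have [[i [Bi cin]]|noi] := pselect (exists i, B i /\ c i = n).
  have -> : [set i | B i /\ c i = n] = [set i].
    apply/seteqP; split=> [j [Bj cjn]|j ->//].
    by apply: cinj; rewrite ?inE// cin.
  by rewrite bigcup_set1; exact: mF.
have -> : [set i | B i /\ c i = n] = set0.
  by apply/seteqP; split => // i iP; apply: noi; exists i.
by rewrite bigcup_set0; exact: measurable0.
Qed.

Lemma continuous_borel (T : pointedMetricType R) (f : T -> R) :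
  continuous f -> measurable_fun [set: borel T] f.
Proof.
move=> cf; apply: measurable_of_open => A oA.
by apply: sub_sigma_algebra; apply: open_comp => // x _; exact: cf.
Qed.

(** The two spaces are second countable, so an open set of the product is a
    countable union of open rectangles. *)
Lemma continuous_borel_prod (S T : pointedMetricType R) (f : S * T -> R) :
  compact [set: S] -> compact [set: T] -> continuous f ->
  measurable_fun [set: (borel S * borel T)%type] f.
Proof.
move=> cS cT cf; apply: measurable_of_open => A oA.
have : open (f @^-1` A) by apply: open_comp => // x _; exact: cf.
have [BS BSc [BSo BSb]] := compact_second_countable cS.
have [BT BTc [BTo BTb]] := compact_second_countable cT.
move: (f @^-1` A) => W oW.
have -> : W = \bigcup_(U in BS) \bigcup_(V in [set V | BT V /\ U `*` V `<=` W]) (U `*` V).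
  apply/seteqP; split=> [[x y] Wxy|z [U BU [V [BV UVW] /UVW//]]].
  have [[U V] /= [xU yV] UVW] : nbhs (x, y) W by exact: open_nbhs_nbhs.
  have [U' [BU' U'x] U'U] := BSb x _ xU.
  have [V' [BV' V'y] V'V] := BTb y _ yV.
  exists U' => //; exists V' => //; split => // -[x' y'] [/= x'U y'V].
  by apply: UVW; split; [exact: U'U|exact: V'V].
apply: measurable_countable_bigcup => // U BU.
apply: measurable_countable_bigcup => [|V [BV _]].
  by apply: sub_countable BTc; apply: subset_card_le => V [].
by apply: measurableX; apply: sub_sigma_algebra; [exact: BSo|exact: BTo].
Qed.

End borel.

Section feature_map.
Context (R : realType) (T : pointedMetricType R) (H : rkhs R T).

Local Notation phi := (rkhs_section H).
Local Notation dot := (rkhs_dot H).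

Lemma dot_section x y : dot (phi x) (phi y) = rkhs_kernel H x y.
Proof. by rewrite rkhs_reproducing rkhs_sectionE. Qed.

Lemma section_bound : kernel_bounded H -> exists2 k : R, 0 <= k & forall x, `|phi x| <= k.
Proof.
rewrite /kernel_bounded; set s := ereal_sup _ => soo.
have Kle x : ((rkhs_kernel H x x)%:E <= s)%E.
  by apply: ereal_sup_ubound; exists (x, x).
have [k kP] : exists k, forall x, rkhs_kernel H x x <= k.
  exists (fine s) => x; rewrite -lee_fin fineK ?Kle// fin_real// soo andbT.
  by rewrite (lt_le_trans (ltNyr _) (Kle x)).
have k0 : 0 <= k by rewrite (le_trans _ (kP point))// -dot_section dot_ge0.
exists (Num.sqrt k) => [|x]; first exact: sqrtr_ge0.
rewrite -ler_sqr ?nnegrE ?sqrtr_ge0// rkhs_normE sqr_sqrtr// dot_section.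
exact: kP.
Qed.

Hypothesis uH : universal H.

(** The squared distance between the sections at [x] and [y] is
    [K x x - 2 K x y + K y y]. *)
Lemma section_continuous : continuous phi.
Proof.
move=> x; have [cK _] := uH.
pose g y := rkhs_kernel H x x - 2 * rkhs_kernel H x y + rkhs_kernel H y y.
have gE y : `|phi x - phi y| ^+ 2 = g y.
  rewrite rkhs_normE dotBl !dotBr (dotC (phi y) (phi x)) !dot_section /g.
  by ring.
have Kc (h : T -> T * T) : continuous h -> continuous (fun y => rkhs_kernel H (h y).1 (h y).2).
  move=> ch y.
  exact: (@continuous_comp _ _ _ h (fun z => rkhs_kernel H z.1 z.2) y (ch y) (cK _)).
have cg : {for x, continuous g}.
  apply: cvgD.
    apply: cvgB; first exact: cvg_cst.
    apply: cvgM; first exact: cvg_cst.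
    by apply: (Kc (fun y => (x, y))) => y; apply: cvg_pair => //; exact: cvg_cst.
  by apply: (Kc (fun y => (y, y))) => y; apply: cvg_pair.
have gx : g x = 0 by rewrite /g; ring.
apply/cvgrPdist_le => e e0.
have /cvgrPdist_le/(_ _ (exprn_gt0 2 e0)) := cg.
apply: filterS => y; rewrite gx sub0r normrN -gE ger0_norm ?sqr_ge0//.
by rewrite ler_sqr ?nnegrE// ltW.
Qed.

End feature_map.

Section feature_maps.
Context (R : realType) (TX TY : pointedMetricType R).
Context (HX : rkhs R TX) (HY : rkhs R TY).
Hypotheses (uX : universal HX) (uY : universal HY).
Hypotheses (cX : compact [set: TX]) (cY : compact [set: TY]).

Lemma dot_section_measurable (h : HX) :
  measurable_fun [set: borel TX] (fun x => rkhs_dot HX (rkhs_section HX x) h).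
Proof.
apply: continuous_borel => x; under eq_fun do rewrite dotC.
apply: continuous_comp; first exact: section_continuous.
exact: dot_continuous.
Qed.

Lemma dot_section_op_measurable (B : HY -> HX) : continuous B ->
  measurable_fun [set: (borel TX * borel TY)%type]
    (fun z => rkhs_dot HX (rkhs_section HX z.1) (B (rkhs_section HY z.2))).
Proof.
move=> cB; apply: continuous_borel_prod => // z.
have c1 : {for z, continuous (rkhs_section HX \o fst)}.
  by apply: continuous_comp; [exact: cvg_fst|exact: section_continuous].
have c2 : {for z, continuous (B \o (rkhs_section HY \o snd))}.
  apply: continuous_comp; last exact: cB.
  by apply: continuous_comp; [exact: cvg_snd|exact: section_continuous].
exact: (dot_continuous2 c1 c2).
Qed.

End feature_maps.

(** * Kernel mean embeddings *)

Section mean_element.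
Context d (Omega : measurableType d) (R : realType) (P : probability Omega R).
Context (T : pointedMetricType R) (H : rkhs R T).
Hypotheses (uH : universal H) (bH : kernel_bounded H).

Local Notation dot := (rkhs_dot H).
Local Notation phi := (rkhs_section H).

Lemma bounded_dot_section h : bounded_mfun (fun x : borel T => dot (phi x) h).
Proof.
split; first exact: dot_section_measurable.
have [k k0 kP] := section_bound bH; exists (k * `|h|) => x.
by rewrite (le_trans (dot_cauchy_schwarz _ _))// ler_wpM2r.
Qed.

Variables (X : Omega -> T).
Hypothesis mX : measurable_fun [set: Omega] (X : Omega -> borel T).

Let bX h : bounded_mfun (fun w => dot (phi (X w)) h).
Proof. exact: (bounded_mfun_comp mX (bounded_dot_section h)). Qed.

(** The weak expectation is the Riesz representative of a bounded functional, as
    the feature map is bounded. *)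
Lemma mean_elementP h :
  dot (hilbert_expectation P setT dot (fun w => phi (X w))) h =
  mean P (fun w => dot (phi (X w)) h).
Proof.
have [k k0 kP] := section_bound bH.
have [m mP] : exists m, forall h, dot m h = mean P (fun w => dot (phi (X w)) h).
  apply: (@riesz_representation _ _ _ (fun h => mean P (fun w => dot (phi (X w)) h)) k).
    move=> a f g; rewrite -meanZ// -meanD//; last first.
      by apply: bounded_mfunM => //; exact: bounded_mfun_cst.
    by apply: eq_mean => w; rewrite dotDr dotZr.
  move=> f; apply: ler_norm_mean_cst => // w.
  by rewrite (le_trans (dot_cauchy_schwarz _ _))// ler_wpM2r.
rewrite /hilbert_expectation; case: xgetP => [m' _ [_ /(_ h I)[_]]|/(_ m)[]].
  by rewrite unlock meanE// => -[].
split=> // f _; split; first exact: bounded_mfun_integrable.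
by rewrite unlock meanE// mP.
Qed.

End mean_element.

Section mean_operator.
Context d (Omega : measurableType d) (R : realType) (P : probability Omega R).
Context (TX TY : pointedMetricType R) (HX : rkhs R TX) (HY : rkhs R TY).
Hypotheses (uX : universal HX) (uY : universal HY).
Hypotheses (cX : compact [set: TX]) (cY : compact [set: TY]).
Hypotheses (bX : kernel_bounded HX) (bY : kernel_bounded HY).

Local Notation HS := (@hilbert_schmidt R TX TY HX HY).
Local Notation dotX := (rkhs_dot HX).
Local Notation dotY := (rkhs_dot HY).
Local Notation phi := (rkhs_section HX).
Local Notation psi := (rkhs_section HY).
Local Notation basis := (@onb R TY HY).

Lemma bounded_hs_dot_tensor (B : HY -> HX) : HS B ->
  bounded_mfun (fun z : (borel TX * borel TY)%type => dotX (phi z.1) (B (psi z.2))).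
Proof.
move=> hB; split; first by apply: dot_section_op_measurable => //; case: hB.
have [k k0 kP] := section_bound bX; have [l l0 lP] := section_bound bY.
exists (1 + (l ^+ 2 * k ^+ 2) * hs_dot B B) => -[x y] /=.
set t := dotX _ _.
have t2 : t ^+ 2 <= (l ^+ 2 * k ^+ 2) * hs_dot B B.
  rewrite /t -hs_dot_tensor//.
  rewrite (le_trans (hs_cauchy_schwarz (hs_tensor _ _) hB))//.
  rewrite hs_dot_tensor2 -!rkhs_normE ler_wpM2r ?hs_dot_ge0//.
  by rewrite ler_pM// ?sqr_ge0// lerXn2r ?nnegrE.
apply: le_trans (lerD (lexx 1) t2); rewrite -(real_normK (num_real t)).
by have := sqr_ge0 (`|t| - 1); have := normr_ge0 t; nra.
Qed.

Variables (X : Omega -> TX) (Y : Omega -> TY).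
Hypothesis mX : measurable_fun [set: Omega] (X : Omega -> borel TX).
Hypothesis mY : measurable_fun [set: Omega] (Y : Omega -> borel TY).

Local Notation E := (mean P).

Let bXw f : bounded_mfun (fun w => dotX (phi (X w)) f).
Proof. exact: (bounded_mfun_comp mX (bounded_dot_section uX bX f)). Qed.

Let bYw g : bounded_mfun (fun w => dotY (psi (Y w)) g).
Proof. exact: (bounded_mfun_comp mY (bounded_dot_section uY bY g)). Qed.

Let bB (B : HY -> HX) : HS B ->
  bounded_mfun (fun w => dotX (phi (X w)) (B (psi (Y w)))).
Proof.
move=> hB; have mXY : measurable_fun [set: Omega]
    (fun w => (X w, Y w) : (borel TX * borel TY)%type).
  exact: measurable_fun_pair.
exact: (bounded_mfun_comp mXY (bounded_hs_dot_tensor hB)).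
Qed.

Let bYX g f : bounded_mfun (fun w => dotY (psi (Y w)) g * dotX (phi (X w)) f).
Proof. exact: bounded_mfunM. Qed.

(** The cross-covariance operator, obtained one value at a time by Riesz. *)
Let mu_weak : exists A : HY -> HX, forall g f,
  dotX (A g) f = E (fun w => dotY (psi (Y w)) g * dotX (phi (X w)) f).
Proof.
have [k k0 kP] := section_bound bX; have [l l0 lP] := section_bound bY.
suff /choice[A AP] : forall g : HY, exists m : HX, forall f,
    dotX m f = E (fun w => dotY (psi (Y w)) g * dotX (phi (X w)) f) by exists A.
move=> g; apply: (@riesz_representation _ _ _
  (fun f => E (fun w => dotY (psi (Y w)) g * dotX (phi (X w)) f)) (l * `|g| * k)).
  move=> a f f'; rewrite -meanZ// -meanD//; last first.
    by apply: bounded_mfunM => //; exact: bounded_mfun_cst.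
  by apply: eq_mean => w; rewrite dotDr dotZr mulrDr mulrCA.
move=> f; apply: ler_norm_mean_cst => // w; rewrite normrM -mulrA ler_pM//.
  by rewrite (le_trans (dot_cauchy_schwarz _ _))// ler_wpM2r.
by rewrite (le_trans (dot_cauchy_schwarz _ _))// ler_wpM2r.
Qed.

(** Cauchy-Schwarz for the expectation and Bessel's inequality bound the
    Hilbert-Schmidt sums of the weakly defined operator. The uniform Fourier
    expansion then lets the expectation and the sum over the basis be exchanged. *)
Let mu_exists : exists A : HY -> HX, HS A /\
  forall B, HS B -> hs_dot A B = E (fun w => dotX (phi (X w)) (B (psi (Y w)))).
Proof.
have [k k0 kP] := section_bound bX; have [l l0 lP] := section_bound bY.
have [A AP] := mu_weak; exists A.
have lA : linear A.
  move=> a u v; apply: dot_eq => f; rewrite dotDl dotZl !AP -meanZ// -meanD//.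
    by apply: eq_mean => w; rewrite dotDr dotZr mulrDl mulrA.
  by apply: bounded_mfunM => //; exact: bounded_mfun_cst.
(* Cauchy-Schwarz for the expectation, in the form needed for Bessel sums *)
have A2 g : `|A g| ^+ 2 <= k ^+ 2 * E (fun w => dotY (psi (Y w)) g ^+ 2).
  set n := `|A g|.
  have n0 : 0 <= n by exact: normr_ge0.
  have b2 : bounded_mfun (fun w => dotY (psi (Y w)) g ^+ 2) by exact: bounded_mfunX.
  have ge q : 0 <= E (fun w => dotY (psi (Y w)) g ^+ 2) - q * n ^+ 2 *+ 2 +
      q ^+ 2 * (k ^+ 2 * n ^+ 2).
    have b1 : bounded_mfun (fun w => (q *+ 2) * (dotY (psi (Y w)) g * dotX (phi (X w)) (A g))).
      by apply: bounded_mfunM => //; exact: bounded_mfun_cst.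
    have -> : q * n ^+ 2 *+ 2 = E (fun w => (q *+ 2) *
        (dotY (psi (Y w)) g * dotX (phi (X w)) (A g))).
      by rewrite meanZ// -AP -rkhs_normE mulrnAl.
    rewrite -[X in _ + X](mean_cst P) -meanB// -meanD//; last 2 first.
      exact: bounded_mfunB.
      exact: bounded_mfun_cst.
    apply: mean_ge0 => w; set a := dotY _ g.
    have := dot_cauchy_schwarz (phi (X w)) (A g); set b := dotX _ _ => bn.
    have bkn : b ^+ 2 <= k ^+ 2 * n ^+ 2.
      rewrite -(real_normK (num_real b)) -exprMn lerXn2r ?nnegrE ?mulr_ge0//.
      by rewrite (le_trans bn)// ler_wpM2r.
    have := sqr_ge0 (a - q * b); have := ler_wpM2l (sqr_ge0 q) bkn.
    by nra.
  have := discriminant_le (mulr_ge0 (sqr_ge0 k) (sqr_ge0 n)) ge.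
  set v := E _; have [->|nN0] := eqVneq n 0.
    by move=> _; rewrite expr0n/= mulr_ge0 ?sqr_ge0// mean_ge0// => w; exact: sqr_ge0.
  have n2 : 0 < n ^+ 2 by rewrite exprn_even_gt0.
  have -> : v * (k ^+ 2 * n ^+ 2) = k ^+ 2 * v * n ^+ 2 by ring.
  by rewrite [X in X <= _ -> _]expr2 ler_pM2r.
have cA : continuous A.
  have Ak g : `|A g| <= k * l * `|g|.
    have kl0 : 0 <= k * l * `|g| by rewrite !mulr_ge0.
    rewrite -ler_sqr ?nnegrE// (le_trans (A2 g))// -mulrA exprMn ler_wpM2l ?sqr_ge0//.
    apply: ler_mean_cst; first exact: bounded_mfunX.
    move=> w; rewrite -(real_normK (num_real (dotY _ _))) lerXn2r ?nnegrE ?mulr_ge0//.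
    by rewrite (le_trans (dot_cauchy_schwarz _ _))// ler_wpM2r.
  have AB u v : A u - A v = A (u - v).
    by have := lA (-1) v u; rewrite !scaleN1r [- v + u]addrC [- A v + _]addrC.
  move=> g; apply/cvgrPdist_le => e e0.
  have kl1 : 0 < k * l + 1 by rewrite ltr_wpDl// mulr_ge0.
  near=> h; rewrite AB (le_trans (Ak _))//.
  have gh : `|g - h| <= e / (k * l + 1).
    by near: h; apply: (@cvgr_dist_le _ _ _ (nbhs g) _ id g) => //; rewrite divr_gt0.
  move: gh; rewrite ler_pdivlMr// => gh; rewrite (le_trans _ gh)// mulrC ler_wpM2l//.
  by rewrite lerDl.
have hA : HS A.
  apply: (@hs_intro _ _ _ _ _ _ (k ^+ 2 * l ^+ 2)) => // J JB.
  rewrite (le_trans (ler_sum _ (fun e _ => A2 e)))// -mulr_sumr.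
  rewrite -mean_sum; last by move=> i; exact: bounded_mfunX.
  apply: ler_wpM2l; first exact: sqr_ge0.
  apply: ler_mean_cst; first by apply: bounded_mfun_sum => i; exact: bounded_mfunX.
  move=> w; rewrite (le_trans (bessel _ JB))//.
  by rewrite lerXn2r ?nnegrE.
split => // B hB; apply: hs_dot_eq => // e e0.
have K0 : 0 < k ^+ 2 + l ^+ 2 + 1 by rewrite ltr_wpDl// addr_ge0 ?sqr_ge0.
have [J JB JP] := hs_fourier_uniform hB (divr_gt0 e0 K0); exists J => // K KB JK.
have -> : \sum_(x <- K) dotX (A x) (B x) =
    E (fun w => \sum_(x <- K) dotY (psi (Y w)) x * dotX (phi (X w)) (B x)).
  by rewrite mean_sum//; apply: eq_bigr => x _; rewrite AP.
have bS : bounded_mfun (fun w => \sum_(x <- K) dotY (psi (Y w)) x * dotX (phi (X w)) (B x)).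
  exact: bounded_mfun_sum.
rewrite -meanB//; last exact: bB.
apply: ler_norm_mean_cst; first by apply: bounded_mfunB => //; exact: bB.
move=> w; rewrite distrC (le_trans (JP K KB JK _ _))//.
rewrite mulrAC ler_pdivrMr//; apply: ler_wpM2l; first exact: ltW.
by apply: ler_wpDr => //; apply: lerD; rewrite lerXn2r ?nnegrE.
Unshelve. all: by end_near. Qed.

Lemma hsic_muP : HS (hsic_mu P HX X Y) /\
  forall B, HS B -> hs_dot (hsic_mu P HX X Y) B =
    E (fun w => dotX (phi (X w)) (B (psi (Y w)))).
Proof.
have [A [hA AP]] := mu_exists.
have tE B w : HS B -> hs_dot (tensor (psi (Y w)) (phi (X w))) B =
    dotX (phi (X w)) (B (psi (Y w))).
  exact: hs_dot_tensor.
rewrite /hsic_mu /hilbert_expectation; case: xgetP => [m' _ [hm' m'P]|/(_ A)[]].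
  split => // B hB; have [_ ] := m'P B hB.
  rewrite unlock; under eq_integral do rewrite tE//.
  by rewrite meanE; [case|exact: bB].
split => // B hB.
have -> : (fun w => hs_dot (tensor (psi (Y w)) (phi (X w))) B) =
    (fun w => dotX (phi (X w)) (B (psi (Y w)))).
  by apply/funext => w; rewrite tE.
split; first by apply: bounded_mfun_integrable; exact: bB.
by rewrite unlock meanE ?AP//; exact: bB.
Qed.

End mean_operator.

(** * The expansion of the estimator *)

Section expansion.
Context d (Omega : measurableType d) (R : realType) (P : probability Omega R).
Context (TX TY : Type) (HX : rkhs R TX) (HY : rkhs R TY).
Variables (X : Omega -> TX) (Y : Omega -> TY).

Local Notation HS := (@hilbert_schmidt R TX TY HX HY).
Local Notation dotX := (rkhs_dot HX).
Local Notation dotY := (rkhs_dot HY).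
Local Notation phi := (rkhs_section HX).
Local Notation psi := (rkhs_section HY).
Local Notation mu := (@hsic_mu _ _ _ P _ _ HX HY X Y).
Local Notation nu := (@hsic_nu _ _ _ P _ _ HX HY X Y).
Local Notation mX := (meanX P HX X).
Local Notation mY := (meanY P HY Y).

Hypothesis hmu : HS mu.

Lemma hs_sum (r : seq nat) (c : nat -> R) (A : nat -> HY -> HX) :
  (forall i, HS (A i)) -> HS (\sum_(i <- r) c i *: A i).
Proof.
move=> hA; elim: r => [|i r IH].
  by rewrite big_nil -(scale0r (A 0%N)); exact: hsZ.
by rewrite big_cons; apply: hsD => //; exact: hsZ.
Qed.

Lemma hs_dot_suml (r : seq nat) (c : nat -> R) (A : nat -> HY -> HX) B :
  (forall i, HS (A i)) -> HS B ->
  hs_dot (\sum_(i <- r) c i *: A i) B = \sum_(i <- r) c i * hs_dot (A i) B.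
Proof.
move=> hA hB; elim: r => [|i r IH].
  by rewrite !big_nil -(scale0r (A 0%N)) hs_dotZl// mul0r.
by rewrite !big_cons hs_dotDl ?hs_dotZl ?IH//; [exact: hsZ|exact: hs_sum].
Qed.

Lemma hs_dot_sumr (r : seq nat) (c : nat -> R) (A : nat -> HY -> HX) B :
  (forall i, HS (A i)) -> HS B ->
  hs_dot B (\sum_(i <- r) c i *: A i) = \sum_(i <- r) c i * hs_dot B (A i).
Proof.
move=> hA hB; rewrite hs_dotC hs_dot_suml//.
by apply: eq_bigr => i _; rewrite hs_dotC.
Qed.

Variables (x : nat -> TX) (y : nat -> TY) (w : nat -> R) (n : nat).

Local Notation r := (index_iota 0 n).
Local Notation T i := (tensor (psi (y i)) (phi (x i))).

Definition centered_tensor (c : nat -> R) : HY -> HX :=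
  \sum_(i <- r) c i *: (T i - mu).

Definition centered_section (S : Type) (H : rkhs R S) (m : H) (s : nat -> S) : H :=
  \sum_(i <- r) n%:R^-1 *: (rkhs_section H (s i) - m).

Local Notation delta := (centered_tensor (fun _ => n%:R^-1)).
Local Notation deltaw := (centered_tensor (fun i => n%:R^-1 * w i)).
Local Notation a := (centered_section mX x).
Local Notation b := (centered_section mY y).
Local Notation wbar := (n%:R^-1 * \sum_(i <- r) w i).

Let hT i : HS (T i). Proof. exact: hs_tensor. Qed.

Let hnu : HS nu. Proof. exact: hs_tensor. Qed.

Let hTmu i : HS (T i - mu). Proof. exact: hsB. Qed.

Lemma hs_centered_tensor c : HS (centered_tensor c).
Proof. exact: hs_sum. Qed.

Hypothesis n0 : (0 < n)%N.

Let nV : n%:R^-1 * n%:R = 1 :> R.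
Proof. by rewrite mulVf// pnatr_eq0 -lt0n. Qed.

Let sum1 : \sum_(i <- r) n%:R^-1 = 1 :> R.
Proof. by rewrite big_mkord sumr_const card_ord -[_ *+ n]mulr_natr nV. Qed.

Let mhatE (S : Type) (H : rkhs R S) (m : H) (s : nat -> S) :
  n%:R^-1 *: (\sum_(i <- r) rkhs_section H (s i)) = m + centered_section m s.
Proof.
rewrite /centered_section -scaler_sumr sumrB scalerBr.
have -> : \sum_(i <- r) m = n%:R *: m.
  by rewrite big_mkord sumr_const card_ord scaler_nat.
by rewrite scalerA nV scale1r addrC subrK.
Qed.

Let tensor_sum c : \sum_(i <- r) c i *: T i =
  centered_tensor c + (\sum_(i <- r) c i) *: mu.
Proof.
rewrite /centered_tensor scaler_suml -big_split/=.
by apply: eq_bigr => i _; rewrite -scalerDr subrK.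
Qed.

Let tensorDl (g g' : HY) (f : HX) : tensor (g + g') f = tensor g f + tensor g' f.
Proof. by apply/funext => h; rewrite fctE /tensor dotDl scalerDl. Qed.

Let tensorDr (g : HY) (f f' : HX) : tensor g (f + f') = tensor g f + tensor g f'.
Proof. by apply/funext => h; rewrite fctE /tensor scalerDr. Qed.

(** The empirical [nu] minus [nu], expanded by bilinearity of the tensor product. *)
Definition centered_product : HY -> HX := tensor b mX + tensor mY a + tensor b a.

Local Notation eps := centered_product.

Let heps : HS eps.
Proof. by apply: hsD; [apply: hsD|]; exact: hs_tensor. Qed.

Let nuhatE : tensor (mY + b) (mX + a) = nu + eps.
Proof.
rewrite tensorDl !tensorDr /centered_product /hsic_nu -addrA; congr (_ + _).
by rewrite addrA [tensor mY a + _]addrC.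
Qed.

(** The three sums are the squared norm of the empirical cross-covariance operator,
    that of the tensor product of the empirical embeddings, and the inner product of
    the latter with the weighted empirical operator. *)
Lemma hsic_hatE (Xs : nat -> Omega -> TX) (Ys : nat -> Omega -> TY)
    (W : nat -> nat -> R) omega :
  (forall i, Xs i omega = x i) -> (forall i, Ys i omega = y i) ->
  (forall i, W n i = w i) ->
  hsic_hat HX HY Xs Ys W n omega =
    hs_dot (mu + delta) (mu + delta) + hs_dot (nu + eps) (nu + eps) -
    2 * hs_dot (deltaw + wbar *: mu) (nu + eps).
Proof.
move=> xE yE wE.
have kE i j : rkhs_kernel HX (Xs i omega) (Xs j omega) = dotX (phi (x i)) (phi (x j)).
  by rewrite !xE rkhs_reproducing rkhs_sectionE.
have lE i j : rkhs_kernel HY (Ys i omega) (Ys j omega) = dotY (psi (y i)) (psi (y j)).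
  by rewrite !yE rkhs_reproducing rkhs_sectionE.
have T1 : mu + delta = \sum_(i <- r) n%:R^-1 *: T i.
  by rewrite tensor_sum sum1 scale1r addrC.
have T2 : deltaw + wbar *: mu = \sum_(i <- r) (n%:R^-1 * w i) *: T i.
  by rewrite tensor_sum -mulr_sumr.
rewrite T1 T2 -nuhatE -!mhatE /hsic_hat; congr (_ + _ - _).
- rewrite hs_dot_suml//; last exact: hs_sum.
  rewrite -(big_mkord xpredT (fun i => \sum_(j < n)
    rkhs_kernel HX (Xs i omega) (Xs j omega) *
    rkhs_kernel HY (Ys i omega) (Ys j omega))).
  rewrite mulr_sumr; apply: eq_bigr => i _.
  rewrite hs_dot_sumr//.
  rewrite -(big_mkord xpredT (fun j =>
    rkhs_kernel HX (Xs i omega) (Xs j omega) *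
    rkhs_kernel HY (Ys i omega) (Ys j omega))).
  rewrite !mulr_sumr; apply: eq_bigr => j _.
  by rewrite hs_dot_tensor2 kE lE; field; rewrite pnatr_eq0 -lt0n.
- rewrite hs_dot_tensor2 !dotZl !dotZr !dot_suml.
  have -> : \sum_(i < n) \sum_(j < n) \sum_(q < n) \sum_(s < n)
      rkhs_kernel HX (Xs i omega) (Xs j omega) * rkhs_kernel HY (Ys q omega) (Ys s omega) =
    (\sum_(i <- r) dotX (phi (x i)) (\sum_(j <- r) phi (x j))) *
    (\sum_(q <- r) dotY (psi (y q)) (\sum_(s <- r) psi (y s))).
    rewrite -[RHS]/(_ * _) big_mkord mulr_suml; apply: eq_bigr => i _.
    rewrite dot_sumr big_mkord mulr_suml; apply: eq_bigr => j _.
    rewrite big_mkord mulr_sumr; apply: eq_bigr => q _.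
    rewrite dot_sumr big_mkord mulr_sumr; apply: eq_bigr => s _.
    by rewrite kE lE.
  by field; rewrite pnatr_eq0 -lt0n.
- rewrite hs_dot_suml//; last exact: hs_tensor.
  rewrite -mulrA; congr (2 * _).
  have -> : \sum_(i < n) \sum_(j < n) \sum_(q < n) W n i *
      rkhs_kernel HX (Xs i omega) (Xs j omega) * rkhs_kernel HY (Ys i omega) (Ys q omega) =
    \sum_(i <- r) w i * (dotX (phi (x i)) (\sum_(j <- r) phi (x j)) *
      dotY (psi (y i)) (\sum_(q <- r) psi (y q))).
    rewrite big_mkord; apply: eq_bigr => i _.
    rewrite !dot_sumr !big_mkord mulr_suml mulr_sumr; apply: eq_bigr => j _.
    rewrite mulr_sumr mulr_sumr; apply: eq_bigr => q _.
    by rewrite kE lE wE; ring.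
  rewrite mulr_sumr; apply: eq_bigr => i _.
  rewrite hs_dot_tensor2 !dotZr.
  by field; rewrite pnatr_eq0 -lt0n.
Qed.

Let tensor_suml (c : nat -> R) (g : nat -> HY) (f : HX) :
  tensor (\sum_(i <- r) c i *: g i) f = \sum_(i <- r) c i *: tensor (g i) f.
Proof.
elim: r => [|i s IH].
  by rewrite !big_nil; apply/funext => h; rewrite /tensor dot0l scale0r.
rewrite !big_cons tensorDl IH; congr (_ + _); apply/funext => h.
by rewrite fctE /tensor dotZl scalerA.
Qed.

Let tensor_sumr (c : nat -> R) (g : HY) (f : nat -> HX) :
  tensor g (\sum_(i <- r) c i *: f i) = \sum_(i <- r) c i *: tensor g (f i).
Proof.
elim: r => [|i s IH].
  by rewrite !big_nil; apply/funext => h; rewrite /tensor scaler0.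
rewrite !big_cons tensorDr IH; congr (_ + _); apply/funext => h.
by rewrite fctE /tensor !scalerA mulrC.
Qed.

Let tensorBl (g g' : HY) (f : HX) : tensor (g - g') f = tensor g f - tensor g' f.
Proof. by apply/funext => h; rewrite fctE /tensor dotBl scalerBl. Qed.

Let tensorBr (g : HY) (f f' : HX) : tensor g (f - f') = tensor g f - tensor g f'.
Proof. by apply/funext => h; rewrite fctE /tensor scalerBr. Qed.

Lemma mean_hsic_U : n%:R^-1 * (\sum_(i <- r) hsic_U P HX HY X Y (x i) (y i)) =
  hs_dot delta mu + hs_dot (tensor b mX + tensor mY a) (nu - mu).
Proof.
have hB : HS (nu - mu) by exact: hsB.
have ht (g : HY) (f : HX) : HS (tensor g f) by exact: hs_tensor.
rewrite hs_dotDl// tensor_suml tensor_sumr !hs_dot_suml// -!big_split/= mulr_sumr.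
apply: eq_bigr => i _; rewrite -!mulrDr /hsic_U; congr (_ * (_ + _)).
have -> : tensor (psi (y i)) mX + tensor mY (phi (x i)) - nu *+ 2 =
    tensor (psi (y i) - mY) mX + tensor mY (phi (x i) - mX).
  by rewrite tensorBl tensorBr addrACA -opprD mulr2n.
by rewrite hs_dotDl.
Qed.

Lemma mean_hsic_V : n%:R^-1 * (\sum_(i <- r) w i * hsic_V P HX HY X Y (x i) (y i)) =
  hs_dot deltaw nu.
Proof.
rewrite hs_dot_suml// mulr_sumr.
by apply: eq_bigr => i _; rewrite mulrA.
Qed.

(** What is left of the estimation error once its linear part is removed. *)
Definition expansion_remainder : R :=
  hs_dot delta delta + hs_dot eps eps + 2 * hs_dot (tensor b a) (nu - mu)
  - 2 * hs_dot deltaw eps - 2 * (wbar - 1) * hs_dot mu (nu + eps).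

(** The terms of first order around [mu], [mu] and [nu] are those that make up [U]
    and [V]. *)
Lemma hsic_expansion (Xs : nat -> Omega -> TX) (Ys : nat -> Omega -> TY)
    (W : nat -> nat -> R) omega :
  (forall i, Xs i omega = x i) -> (forall i, Ys i omega = y i) ->
  (forall i, W n i = w i) ->
  hsic_hat HX HY Xs Ys W n omega - hsic P HX HY X Y =
    n%:R^-1 * (\sum_(i <- r) 2 * (hsic_U P HX HY X Y (x i) (y i)
                             - w i * hsic_V P HX HY X Y (x i) (y i)))
    + expansion_remainder.
Proof.
move=> xE yE wE; rewrite (hsic_hatE xE yE wE) /expansion_remainder.
have hd c := hs_centered_tensor c.
have hB : HS (nu - mu) by exact: hsB.
have hB' : HS (mu - nu) by exact: hsB.
have ht (g : HY) (f : HX) : HS (tensor g f) by exact: hs_tensor.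
have -> : n%:R^-1 * (\sum_(i <- r) 2 * (hsic_U P HX HY X Y (x i) (y i)
      - w i * hsic_V P HX HY X Y (x i) (y i))) =
    2 * (hs_dot delta mu + hs_dot (tensor b mX + tensor mY a) (nu - mu)) -
    2 * hs_dot deltaw nu.
  by rewrite -mulr_sumr sumrB mulrCA mulrBr mean_hsic_U mean_hsic_V mulrBr.
have -> : hsic P HX HY X Y = hs_dot mu mu - 2 * hs_dot mu nu + hs_dot nu nu.
  rewrite /hsic /hs_norm sqr_sqrtr ?hs_dot_ge0// hs_dotBl// !hs_dotBr// (hs_dotC nu).
  by ring.
have -> : hs_dot (tensor b mX + tensor mY a) (nu - mu) =
    hs_dot eps nu - hs_dot eps mu - hs_dot (tensor b a) (nu - mu).
  have -> : tensor b mX + tensor mY a = eps - tensor b a by rewrite addrK.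
  by rewrite hs_dotBl// hs_dotBr.
move: (hs_dot (tensor b a) (nu - mu)) => t.
move: eps heps delta (hd (fun=> n%:R^-1)) deltaw (hd (fun i => n%:R^-1 * w i)) wbar.
move=> e he dl hdl dlw hdlw wb.
have hwmu : HS (wb *: mu) by exact: hsZ.
have hne : HS (nu + e) by exact: hsD.
have hmd : HS (mu + dl) by exact: hsD.
rewrite !(hs_dotDl, hs_dotDr, hs_dotZl)// (hs_dotC mu dl) (hs_dotC nu e) (hs_dotC mu e).
by ring.
Qed.

Let amgm A B : HS A -> HS B -> `|2 * hs_dot A B| <= hs_dot A A + hs_dot B B.
Proof.
move=> hA hB; have h1 := hs_dot_ge0 (hsD hA hB); have h2 := hs_dot_ge0 (hsB hA hB).
move: h1 h2; rewrite hs_dotBl ?hs_dotBr//; last exact: hsB.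
have hAB : HS (A + B) by exact: hsD.
rewrite hs_dotDl// !hs_dotDr// (hs_dotC B A) => h1 h2.
by rewrite ler_norml; apply/andP; split; lra.
Qed.

Variables (k l : R).
Hypotheses (k0 : 0 <= k) (l0 : 0 <= l).
Hypotheses (phik : forall z, `|phi z| <= k) (psil : forall z, `|psi z| <= l).

Let mhat_bound (S : Type) (H : rkhs R S) (m : H) (s : nat -> S) (K : R) :
  (forall z, `|rkhs_section H z| <= K) -> `|m + centered_section m s| <= K.
Proof.
move=> HK; rewrite -mhatE normrZ ger0_norm ?invr_ge0//.
rewrite mulrC ler_pdivrMr ?ltr0n// (le_trans (ler_norm_sum _ _ _))//.
rewrite (le_trans (ler_sum _ (fun i _ => HK (s i))))//.
by rewrite big_mkord sumr_const card_ord mulr_natr.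
Qed.

Let c1 : R := 6 * (`|mX| ^+ 2 + `|mY| ^+ 2 + (k + `|mX|) ^+ 2) + 3 +
  hs_dot (nu - mu) (nu - mu).
Let c2 : R := 2 * (1 + hs_dot mu mu * (l ^+ 2 * k ^+ 2)).

(** By Cauchy-Schwarz, each term is at most a constant times squared norms of centered
    averages or the deviation of the mean weight; the product [tensor b a] costs no
    more than [b], since [a] is bounded. *)
Lemma expansion_remainder_bound : `|expansion_remainder| <=
  c1 * (hs_dot delta delta + hs_dot deltaw deltaw + `|a| ^+ 2 + `|b| ^+ 2)
  + c2 * `|wbar - 1|.
Proof.
have hd c := hs_centered_tensor c.
have hB : HS (nu - mu) by exact: hsB.
have ht (g : HY) (f : HX) : HS (tensor g f) by exact: hs_tensor.
have Nt (g : HY) (f : HX) : hs_dot (tensor g f) (tensor g f) = `|g| ^+ 2 * `|f| ^+ 2.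
  by rewrite hs_dot_tensor2 -!rkhs_normE.
have aA : `|a| ^+ 2 <= (k + `|mX|) ^+ 2.
  rewrite lerXn2r ?nnegrE ?addr_ge0//.
  have -> : a = (mX + a) - mX by rewrite addrAC subrr add0r.
  by rewrite (le_trans (ler_normB _ _))// lerD// mhat_bound.
have epsN : hs_dot eps eps <= 3 * ((`|mX| ^+ 2 + (k + `|mX|) ^+ 2) * `|b| ^+ 2 +
    `|mY| ^+ 2 * `|a| ^+ 2).
  have ab : `|b| ^+ 2 * `|a| ^+ 2 <= `|b| ^+ 2 * (k + `|mX|) ^+ 2.
    by rewrite ler_wpM2l ?sqr_ge0.
  have := Nt b mX; have := Nt mY a; have := Nt b a.
  have := amgm (ht b mX) (ht mY a); have := amgm (ht b mX) (ht b a).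
  have := amgm (ht mY a) (ht b a).
  rewrite !ler_norml => /andP[_ h1] /andP[_ h2] /andP[_ h3] h4 h5 h6.
  have hs : HS (tensor b mX + tensor mY a) by exact: hsD.
  rewrite /centered_product !(hs_dotDl, hs_dotDr)//.
  rewrite (hs_dotC (tensor mY a) (tensor b mX)) (hs_dotC (tensor b a) (tensor b mX)).
  rewrite (hs_dotC (tensor b a) (tensor mY a)).
  by move: h1 h2 h3; rewrite h4 h5 h6 => h1 h2 h3; lra.
set A := `|a| ^+ 2 in aA epsN *; set B := `|b| ^+ 2 in epsN *.
have A0 : 0 <= A by exact: sqr_ge0.
have B0 : 0 <= B by exact: sqr_ge0.
set D := hs_dot (nu - mu) (nu - mu).
have D0 : 0 <= D by exact: hs_dot_ge0.
have tD : 2 * `|hs_dot (tensor b a) (nu - mu)| <= (A + B) * (1 + D).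
  set t := hs_dot _ _.
  have t2 : t ^+ 2 <= B * A * D by rewrite -[B * A]Nt; exact: hs_cauchy_schwarz.
  rewrite -ler_sqr ?nnegrE ?mulr_ge0 ?addr_ge0//.
  rewrite exprMn real_normK ?num_real//.
  have : 4 * (B * A) <= (A + B) ^+ 2 by have := sqr_ge0 (A - B); lra.
  have : 0 <= B * A by exact: mulr_ge0.
  have : D <= (1 + D) ^+ 2 by nra.
  rewrite exprMn; move: ((1 + D) ^+ 2) ((A + B) ^+ 2) (B * A) t2 => p q s.
  by nra.
have sM : 2 * `|hs_dot mu (nu + eps)| <= c2.
  set t := hs_dot _ _.
  have mu0 : 0 <= hs_dot mu mu by exact: hs_dot_ge0.
  have t2 : t ^+ 2 <= hs_dot mu mu * (l ^+ 2 * k ^+ 2).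
    rewrite (le_trans (hs_cauchy_schwarz hmu (hsD hnu heps)))//.
    rewrite -nuhatE Nt ler_wpM2l// ler_pM ?sqr_ge0//.
      by rewrite lerXn2r ?nnegrE ?mhat_bound.
    by rewrite lerXn2r ?nnegrE ?mhat_bound.
  rewrite /c2 ler_pM2l// (le_trans _ (lerD (lexx 1) t2))//.
  rewrite -(real_normK (num_real t)).
  by have := sqr_ge0 (`|t| - 1); have := normr_ge0 t; nra.
have dE := amgm (hd (fun i => n%:R^-1 * w i)) heps.
have N1 : 0 <= hs_dot delta delta by exact/hs_dot_ge0/hd.
have N2 : 0 <= hs_dot deltaw deltaw by exact/hs_dot_ge0/hd.
have N3 : 0 <= hs_dot eps eps by exact: hs_dot_ge0.
have w1 : 0 <= `|wbar - 1| by [].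
have wM : `|2 * (wbar - 1) * hs_dot mu (nu + eps)| <= c2 * `|wbar - 1|.
  by rewrite -mulrA normrM normrM (ger0_norm (ler0n R 2)) mulrCA [c2 * _]mulrC ler_wpM2l.
rewrite /expansion_remainder -/D /c1 -/D -/A -/B.
move: (hs_dot delta delta) (hs_dot deltaw deltaw) (hs_dot eps eps) N1 N2 N3 epsN dE.
move=> u v q u0 v0 q0 qe dE.
have -> (z1 z2 z3 z4 z5 : R) : z1 + z2 + z3 - z4 - z5 = (z1 + z2) + z3 - z4 - z5 by [].
rewrite (le_trans (ler_normB _ _))// lerD//.
rewrite (le_trans (ler_normB _ _))//.
apply: (@le_trans _ _ (u + q + (A + B) * (1 + D) + (v + q))).
  apply: lerD => //.
  rewrite (le_trans (ler_normD _ _))// lerD//; first by rewrite ger0_norm// addr_ge0.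
  by rewrite normrM (ger0_norm (ler0n R 2)).
move: (`|mX| ^+ 2) (`|mY| ^+ 2) ((k + `|mX|) ^+ 2) (sqr_ge0 `|mX|) (sqr_ge0 `|mY|)
  (sqr_ge0 (k + `|mX|)) qe => p1 p2 p3 p10 p20 p30 qe.
have : 0 <= p1 * (u + v + A) by rewrite mulr_ge0 ?addr_ge0.
have : 0 <= p2 * (u + v + B) by rewrite mulr_ge0 ?addr_ge0.
have : 0 <= p3 * (u + v + A) by rewrite mulr_ge0 ?addr_ge0.
have : 0 <= D * (u + v) by rewrite mulr_ge0 ?addr_ge0.
by lra.
Qed.

End expansion.

(** * Degenerate second moments *)

(** Off-diagonal terms vanish by independence, so the variance of a weighted
    average of centered Hilbert-valued variables is carried by the diagonal. *)
Lemma degenerate_second_moment d (Omega : measurableType d) (R : realType)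
    (P : probability Omega R) d' (T : measurableType d') (Z : nat -> Omega -> T)
    (kap : T * T -> R) (M : R) (c : nat -> R) (n : nat) :
  (forall i, measurable_fun [set: Omega] (Z i)) -> mutually_independent P Z ->
  bounded_mfun kap -> (forall z, kap (z, z) <= M) ->
  (forall z j, mean P (fun w => kap (z, Z j w)) = 0) ->
  mean P (fun w => \sum_(0 <= i < n) \sum_(0 <= j < n) c i * c j * kap (Z i w, Z j w))
    <= M * \sum_(0 <= i < n) c i ^+ 2.
Proof.
move=> mZ indZ bk kM k0.
have bkZ i j : bounded_mfun (fun w => kap (Z i w, Z j w)).
  by apply: (bounded_mfun_comp _ bk); exact: measurable_fun_pair.
have bck i j : bounded_mfun (fun w => c i * c j * kap (Z i w, Z j w)).
  by apply: bounded_mfunM => //; exact: bounded_mfun_cst.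
rewrite mean_sum; last by move=> i; exact: bounded_mfun_sum.
rewrite mulr_sumr big_nat [leRHS]big_nat; apply: ler_sum => i /andP[_ ni].
rewrite mean_sum// (bigD1_seq i) ?iota_uniq ?mem_index_iota//= [X in _ + X]big1 ?addr0.
  rewrite meanZ// -expr2 mulrC ler_wpM2r ?sqr_ge0//.
  by apply: ler_mean_cst => // w; exact: kM.
move=> j ji; rewrite meanZ// (mean_independent2 _ _ _ bk)//.
  rewrite (_ : mean P _ = 0) ?mulr0// -[RHS](mean_cst P).
  by apply: eq_mean => w; rewrite k0.
by apply: independent2_pair => //; rewrite eq_sym.
Qed.

Lemma mean_identically_distributed d (Omega : measurableType d) (R : realType)
    (P : probability Omega R) d' (T : measurableType d') (Z Z' : Omega -> T) (f : T -> R) :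
  measurable_fun [set: Omega] Z -> measurable_fun [set: Omega] Z' ->
  identically_distributed P Z Z' -> bounded_mfun f ->
  mean P (fun w => f (Z w)) = mean P (fun w => f (Z' w)).
Proof.
move=> mZ mZ' ZZ' bf.
have := mean_pushforward P (mfun_Sub (mem_set mZ)) bf.
have := mean_pushforward P (mfun_Sub (mem_set mZ')) bf.
rewrite /= => <- <-; apply: eq_mean_measure => A mA; exact: ZZ'.
Qed.

(** The constant is the same for all samples, weights and sample sizes. *)
Lemma expansion_remainder_le d (Omega : measurableType d) (R : realType)
    (P : probability Omega R) (TX TY : Type) (HX : rkhs R TX) (HY : rkhs R TY)
    (X : Omega -> TX) (Y : Omega -> TY) (k l : R) :
  hilbert_schmidt (@hsic_mu _ _ _ P _ _ HX HY X Y) -> 0 <= k -> 0 <= l ->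
  (forall x, `|rkhs_section HX x| <= k) -> (forall y, `|rkhs_section HY y| <= l) ->
  exists2 C, 0 <= C & forall x y w n, (0 < n)%N ->
    `|expansion_remainder P HX HY X Y x y w n| <=
    C * (hs_dot (@centered_tensor _ _ _ P _ _ HX HY X Y x y n (fun=> n%:R^-1))
                (@centered_tensor _ _ _ P _ _ HX HY X Y x y n (fun=> n%:R^-1)) +
         hs_dot (@centered_tensor _ _ _ P _ _ HX HY X Y x y n (fun i => n%:R^-1 * w i))
                (@centered_tensor _ _ _ P _ _ HX HY X Y x y n (fun i => n%:R^-1 * w i)) +
         `|centered_section n (meanX P HX X) x| ^+ 2 +
         `|centered_section n (meanY P HY Y) y| ^+ 2 +
         `|n%:R^-1 * (\sum_(0 <= i < n) w i) - 1|).
Proof.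
move=> hmu k0 l0 kP lP.
have := @expansion_remainder_bound _ _ _ P _ _ HX HY X Y hmu.
set mu := @hsic_mu _ _ _ _ _ _ _ HY _ _ in hmu *; set nu := @hsic_nu _ _ _ _ _ _ _ _ _ _.
move=> H.
have hD : hilbert_schmidt (nu - mu) by apply: hsB => //; exact: hs_tensor.
have D0 := hs_dot_ge0 hD; have M0 := hs_dot_ge0 hmu.
set C1 := 6 * (`|meanX P HX X| ^+ 2 + `|meanY P HY Y| ^+ 2 + (k + `|meanX P HX X|) ^+ 2) + 3 +
  hs_dot (nu - mu) (nu - mu).
set C2 := 2 * (1 + hs_dot mu mu * (l ^+ 2 * k ^+ 2)).
have C10 : 0 <= C1.
  have : 0 <= `|meanX P HX X| ^+ 2 by exact: sqr_ge0.
  have : 0 <= `|meanY P HY Y| ^+ 2 by exact: sqr_ge0.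
  have : 0 <= (k + `|meanX P HX X|) ^+ 2 by exact: sqr_ge0.
  by rewrite /C1; lra.
have C20 : 0 <= C2.
  by rewrite /C2 mulr_ge0// addr_ge0// !mulr_ge0 ?sqr_ge0.
exists (C1 + C2) => [|x y w n n0]; first exact: addr_ge0.
apply: (le_trans (H x y w n n0 k l k0 l0 kP lP)); rewrite -/C1 -/C2.
have := hs_dot_ge0 (hs_centered_tensor hmu x y n (fun=> n%:R^-1)).
have := hs_dot_ge0 (hs_centered_tensor hmu x y n (fun i => n%:R^-1 * w i)).
have := sqr_ge0 `|centered_section n (meanX P HX X) x|.
have := sqr_ge0 `|centered_section n (meanY P HY Y) y|.
have := normr_ge0 (n%:R^-1 * (\sum_(0 <= i < n) w i) - 1).
move: (hs_dot _ _) (hs_dot _ _) (_ ^+ 2) (_ ^+ 2) `|_| => t1 t2 t3 t4 t5 *.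
have : 0 <= C2 * (t1 + t2 + t3 + t4) by rewrite mulr_ge0// !addr_ge0.
have : 0 <= C1 * t5 by rewrite mulr_ge0.
by lra.
Qed.

(** * Asymptotic normality *)

Section asymptotics.
Context d (Omega : measurableType d) (R : realType) (P : probability Omega R).
Context (TX TY : pointedMetricType R) (HX : rkhs R TX) (HY : rkhs R TY).
Hypotheses (uX : universal HX) (uY : universal HY).
Hypotheses (cX : compact [set: TX]) (cY : compact [set: TY]).
Hypotheses (bX : kernel_bounded HX) (bY : kernel_bounded HY).
Variables (X : Omega -> TX) (Y : Omega -> TY).
Variables (Xs : nat -> Omega -> TX) (Ys : nat -> Omega -> TY).

Local Notation T := (borel TX * borel TY)%type.
Local Notation HS := (@hilbert_schmidt R TX TY HX HY).
Local Notation dotX := (rkhs_dot HX).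
Local Notation dotY := (rkhs_dot HY).
Local Notation phi := (rkhs_section HX).
Local Notation psi := (rkhs_section HY).
Local Notation mu := (@hsic_mu _ _ _ P _ _ HX HY X Y).
Local Notation nu := (@hsic_nu _ _ _ P _ _ HX HY X Y).
Local Notation mX := (meanX P HX X).
Local Notation mY := (meanY P HY Y).
Local Notation E := (mean P).

Hypothesis mesX : measurable_fun [set: Omega] (X : Omega -> borel TX).
Hypothesis mesY : measurable_fun [set: Omega] (Y : Omega -> borel TY).
Hypothesis mesXs : forall i, measurable_fun [set: Omega] (Xs i : Omega -> borel TX).
Hypothesis mesYs : forall i, measurable_fun [set: Omega] (Ys i : Omega -> borel TY).

Let XY w : T := (X w, Y w).
Let Z i w : T := (Xs i w, Ys i w).

Hypothesis indZ : mutually_independent P Z.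
Hypothesis idZ : forall i, identically_distributed P (Z i) XY.

Let mXY : measurable_fun [set: Omega] XY.
Proof. exact: measurable_fun_pair. Qed.

Let mZ i : measurable_fun [set: Omega] (Z i).
Proof. exact: measurable_fun_pair. Qed.

Let EZ i (F : T -> R) : bounded_mfun F -> E (fun w => F (Z i w)) = E (fun w => F (XY w)).
Proof. by move=> bF; apply: mean_identically_distributed. Qed.

Let hmu : HS mu.
Proof. by case: (hsic_muP P uX uY cX cY bX bY mesX mesY). Qed.

Let muP B : HS B -> hs_dot mu B = E (fun w => dotX (phi (X w)) (B (psi (Y w)))).
Proof. by case: (hsic_muP P uX uY cX cY bX bY mesX mesY) => _; apply. Qed.

Let hnu : HS nu. Proof. exact: hs_tensor. Qed.

Let hD : HS (nu - mu). Proof. exact: hsB. Qed.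

Let mXP h : dotX mX h = E (fun w => dotX (phi (X w)) h).
Proof. exact: mean_elementP. Qed.

Let mYP h : dotY mY h = E (fun w => dotY (psi (Y w)) h).
Proof. exact: mean_elementP. Qed.

Let bphi h : bounded_mfun (fun z : T => dotX (phi z.1) h).
Proof.
exact: (bounded_mfun_comp measurable_fst (bounded_dot_section uX bX h)).
Qed.

Let bpsi h : bounded_mfun (fun z : T => dotY (psi z.2) h).
Proof.
exact: (bounded_mfun_comp measurable_snd (bounded_dot_section uY bY h)).
Qed.

Let bop B : HS B -> bounded_mfun (fun z : T => dotX (phi z.1) (B (psi z.2))).
Proof. exact: bounded_hs_dot_tensor. Qed.

(** Through the adjoint of [B], the map [g |-> <f, B g>] becomes an inner product,
    whose expectation along [psi (Y w)] is known. *)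
Let adjoint (B : HY -> HX) (f : HX) : HS B -> exists r, forall g, dotX f (B g) = dotY r g.
Proof.
move=> hB; have D0 := hs_dot_ge0 hB.
pose L g := dotX f (B g).
have ll a g g' : L (a *: g + g') = a * L g + L g'.
  by rewrite /L (hs_linear hB) dotDr dotZr.
have lb g : `|L g| <= Num.sqrt (hs_dot B B) * `|f| * `|g|.
  rewrite -ler_sqr ?nnegrE ?mulr_ge0 ?sqrtr_ge0// real_normK ?num_real//.
  rewrite /L -hs_dot_tensor// (le_trans (hs_cauchy_schwarz (hs_tensor _ _) hB))//.
  rewrite hs_dot_tensor2 -!rkhs_normE !exprMn sqr_sqrtr//.
  by rewrite le_eqVlt; apply/orP; left; apply/eqP; ring.
by have [r rP] := riesz_representation ll lb; exists r => g; rewrite rP.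
Qed.

Let U (z : T) : R := hsic_U P HX HY X Y z.1 z.2.
Let V (z : T) : R := hsic_V P HX HY X Y z.1 z.2.

Let VE z : V z = dotX (phi z.1) (nu (psi z.2)) - hs_dot mu nu.
Proof. by rewrite /V /hsic_V hs_dotBl ?hs_dot_tensor//; exact: hs_tensor. Qed.

Let UE : exists2 r : HY, dotY r mY = hs_dot nu (nu - mu) & forall z,
  U z = dotX (phi z.1) (mu (psi z.2)) - hs_dot mu mu +
    (dotY (psi z.2) r + dotX (phi z.1) ((nu - mu) mY) - 2 * hs_dot nu (nu - mu)).
Proof.
have [r rP] := adjoint mX hD; exists r => [|z].
  by rewrite -rP -hs_dot_tensor.
have ht (g : HY) (f : HX) : HS (tensor g f) by exact: hs_tensor.
rewrite /U /hsic_U (hs_dotBl (ht _ _))// hs_dot_tensor//; congr (_ + _).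
have htt : HS (tensor (psi z.2) mX + tensor mY (phi z.1)) by exact: hsD.
have hnn : HS (nu *+ 2) by rewrite mulr2n; exact: hsD.
have n2 : hs_dot (nu *+ 2) (nu - mu) = 2 * hs_dot nu (nu - mu).
  by rewrite [nu *+ 2]mulr2n (hs_dotDl hnu)//; ring.
by rewrite (hs_dotBl htt)// n2 (hs_dotDl (ht _ _))// !(hs_dot_tensor _ _ hD) rP dotC.
Qed.

Let bV : bounded_mfun V.
Proof.
apply: (eq_bounded_mfun VE).
by apply: bounded_mfunB; [exact: bop|exact: bounded_mfun_cst].
Qed.

Let bU : bounded_mfun U.
Proof.
have [r _ rP] := UE; apply: (eq_bounded_mfun rP).
apply: bounded_mfunD; apply: bounded_mfunB; try exact: bounded_mfun_cst.
  exact: bop.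
by apply: bounded_mfunD; [exact: bpsi|exact: bphi].
Qed.

Let bXY (F : T -> R) : bounded_mfun F -> bounded_mfun (fun w => F (XY w)).
Proof. exact: bounded_mfun_comp mXY. Qed.

Let bZ i (F : T -> R) : bounded_mfun F -> bounded_mfun (fun w => F (Z i w)).
Proof. exact: bounded_mfun_comp (mZ i). Qed.

Let EV i : E (fun w => V (Z i w)) = 0.
Proof.
rewrite EZ//; under eq_mean do rewrite VE.
rewrite meanB; [|exact: (bXY (bop hnu))|exact: bounded_mfun_cst].
by rewrite mean_cst muP// subrr.
Qed.

Let EU i : E (fun w => U (Z i w)) = 0.
Proof.
rewrite EZ//; have [r rm rP] := UE; under eq_mean do rewrite rP.
have b1 := bXY (bop hmu); have b2 := bXY (bpsi r).
have b3 := bXY (bphi ((nu - mu) mY)).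
have bc (c : R) := @bounded_mfun_cst _ Omega R c.
rewrite meanD; [|exact: bounded_mfunB|]; last first.
  by apply: bounded_mfunB => //; exact: bounded_mfunD.
rewrite meanB// [X in _ + X]meanB//; last exact: bounded_mfunD.
rewrite meanD// !mean_cst -(muP hmu) -mYP -mXP dotC rm.
by rewrite -(hs_dot_tensor mY mX hD); ring.
Qed.

Let bK : bounded_mfun (fun z : T * T => dotX (phi z.1.1) (phi z.2.1)).
Proof.
have [k k0 kP] := section_bound bX.
split; last first.
  exists (k * k) => z; rewrite (le_trans (dot_cauchy_schwarz _ _))//.
  by rewrite ler_pM.
have cK : measurable_fun [set: (borel TX * borel TX)%type]
    (fun z : TX * TX => dotX (phi z.1) (phi z.2)).
  apply: continuous_borel_prod => //.
  under eq_fun do rewrite dot_section.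
  by case: uX.
pose h (z : T * T) : (borel TX * borel TX)%type := (z.1.1, z.2.1).
have mh : measurable_fun [set: (T * T)%type] h.
  apply: measurable_fun_pair.
    exact: (measurableT_comp measurable_fst measurable_fst).
  exact: (measurableT_comp measurable_fst measurable_snd).
exact: (measurableT_comp cK mh).
Qed.

Let bL : bounded_mfun (fun z : T * T => dotY (psi z.1.2) (psi z.2.2)).
Proof.
have [k k0 kP] := section_bound bY.
split; last first.
  exists (k * k) => z; rewrite (le_trans (dot_cauchy_schwarz _ _))//.
  by rewrite ler_pM.
have cL : measurable_fun [set: (borel TY * borel TY)%type]
    (fun z : TY * TY => dotY (psi z.1) (psi z.2)).
  apply: continuous_borel_prod => //.
  under eq_fun do rewrite dot_section.
  by case: uY.
pose h (z : T * T) : (borel TY * borel TY)%type := (z.1.2, z.2.2).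
have mh : measurable_fun [set: (T * T)%type] h.
  apply: measurable_fun_pair.
    exact: (measurableT_comp measurable_snd measurable_fst).
  exact: (measurableT_comp measurable_snd measurable_snd).
exact: (measurableT_comp cL mh).
Qed.

Let b1st (F : T -> R) : bounded_mfun F -> bounded_mfun (fun z : T * T => F z.1).
Proof. exact: bounded_mfun_comp measurable_fst. Qed.

Let b2nd (F : T -> R) : bounded_mfun F -> bounded_mfun (fun z : T * T => F z.2).
Proof. exact: bounded_mfun_comp measurable_snd. Qed.

Let Tz (z : T) : HY -> HX := tensor (psi z.2) (phi z.1).

(** The kernel of the centered tensors is bounded, and it is degenerate because
    [mu] is their weak expectation. *)
Let second_moment_tensor : exists M, forall c n,
  E (fun w => hs_dot (@centered_tensor _ _ _ P _ _ HX HY X Y (Xs^~ w) (Ys^~ w) n c)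
                     (@centered_tensor _ _ _ P _ _ HX HY X Y (Xs^~ w) (Ys^~ w) n c))
    <= M * \sum_(0 <= i < n) c i ^+ 2 /\
  bounded_mfun (fun w =>
    hs_dot (@centered_tensor _ _ _ P _ _ HX HY X Y (Xs^~ w) (Ys^~ w) n c)
           (@centered_tensor _ _ _ P _ _ HX HY X Y (Xs^~ w) (Ys^~ w) n c)).
Proof.
pose kap (z : T * T) := hs_dot (Tz z.1 - mu) (Tz z.2 - mu).
have hTz z : HS (Tz z) by exact: hs_tensor.
have hTm z : HS (Tz z - mu) by exact: hsB.
have kapE z : kap z = dotY (psi z.1.2) (psi z.2.2) * dotX (phi z.1.1) (phi z.2.1)
    - dotX (phi z.1.1) (mu (psi z.1.2)) - dotX (phi z.2.1) (mu (psi z.2.2))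
    + hs_dot mu mu.
  rewrite /kap hs_dotBl// !hs_dotBr// hs_dot_tensor2 (hs_dot_tensor _ _ hmu).
  by rewrite (hs_dotC mu) (hs_dot_tensor _ _ hmu); ring.
have bkap : bounded_mfun kap.
  apply: (eq_bounded_mfun kapE).
  apply: bounded_mfunD; last exact: bounded_mfun_cst.
  apply: bounded_mfunB; last exact: (b2nd (bop hmu)).
  by apply: bounded_mfunB; [exact: bounded_mfunM|exact: (b1st (bop hmu))].
have [_ [M kM]] := bkap; exists M => c n.
have NE w : hs_dot (@centered_tensor _ _ _ P _ _ HX HY X Y (Xs^~ w) (Ys^~ w) n c)
                     (@centered_tensor _ _ _ P _ _ HX HY X Y (Xs^~ w) (Ys^~ w) n c) =
    \sum_(0 <= i < n) \sum_(0 <= j < n) c i * c j * kap (Z i w, Z j w).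
  have hA i : HS (tensor (psi (Ys i w)) (phi (Xs i w)) - mu) by exact: (hTm (Z i w)).
  rewrite {1}/centered_tensor (hs_dot_suml _ _ hA); last exact: hs_centered_tensor.
  apply: eq_bigr => i _; rewrite (hs_dot_sumr _ _ hA (hA i)) mulr_sumr.
  by apply: eq_bigr => j _; rewrite mulrA.
split; last first.
  apply: (eq_bounded_mfun NE); apply: bounded_mfun_sum => i.
  apply: bounded_mfun_sum => j; apply: bounded_mfunM; first exact: bounded_mfun_cst.
  by apply: (bounded_mfun_comp _ bkap); exact: measurable_fun_pair.
rewrite (eq_mean P NE).
apply: degenerate_second_moment => //.
  by move=> z; rewrite (le_trans (ler_norm _)).
move=> z j.
have -> : E (fun w => kap (z, Z j w)) = E (fun w => kap (z, XY w)).
  apply: (EZ j (F := fun z' => kap (z, z'))).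
  exact: (bounded_mfun_comp (pair1_measurable z) bkap).
have -> : E (fun w => kap (z, XY w)) =
    E (fun w => dotX (phi (X w)) ((Tz z - mu) (psi (Y w))) - hs_dot mu (Tz z - mu)).
  apply: eq_mean => w; rewrite /kap hs_dotBr//=.
  by rewrite hs_dotC hs_dot_tensor// hs_dotC.
rewrite meanB; [|exact: (bXY (bop (hTm z)))|exact: bounded_mfun_cst].
by rewrite mean_cst -muP// subrr.
Qed.

(** The same for the centered sections; [pr] selects one of the two coordinates. *)
Let second_moment_section (TS : pointedMetricType R) (H : rkhs R TS) (m : H)
    (pr : T -> borel TS) (s : nat -> Omega -> TS) :
  measurable_fun [set: T] pr -> (forall i w, pr (Z i w) = s i w) ->
  universal H -> kernel_bounded H ->
  bounded_mfun (fun z : T * T => rkhs_dot H (rkhs_section H (pr z.1)) (rkhs_section H (pr z.2))) ->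
  (forall h, rkhs_dot H m h = E (fun w => rkhs_dot H (rkhs_section H (pr (XY w))) h)) ->
  exists M, forall n,
    E (fun w => `|centered_section n m (s^~ w)| ^+ 2)
      <= M * \sum_(0 <= i < n) n%:R^-1 ^+ 2 /\
    bounded_mfun (fun w => `|centered_section n m (s^~ w)| ^+ 2).
Proof.
move=> mpr prZ uH bH bS mP.
pose f z := rkhs_section H (pr z).
pose kap (z : T * T) := rkhs_dot H (f z.1 - m) (f z.2 - m).
have bf h : bounded_mfun (fun z : T => rkhs_dot H (f z) h).
  exact: (bounded_mfun_comp mpr (bounded_dot_section uH bH h)).
have bkap : bounded_mfun kap.
  rewrite (_ : kap = fun z => rkhs_dot H (f z.1) (f z.2) - rkhs_dot H (f z.1) m
      - rkhs_dot H (f z.2) m + rkhs_dot H m m).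
    apply: bounded_mfunD; last exact: bounded_mfun_cst.
    apply: bounded_mfunB; last exact: (b2nd (bf m)).
    by apply: bounded_mfunB => //; exact: (b1st (bf m)).
  by apply/funext => z; rewrite /kap dotBl !dotBr (dotC m); ring.
have [_ [M kM]] := bkap; exists M => n.
have NE w : `|centered_section n m (s^~ w)| ^+ 2 =
    \sum_(0 <= i < n) \sum_(0 <= j < n) n%:R^-1 * n%:R^-1 * kap (Z i w, Z j w).
  rewrite rkhs_normE {1}/centered_section dot_suml.
  apply: eq_bigr => i _; rewrite dot_sumr; apply: eq_bigr => j _.
  by rewrite dotZl dotZr mulrA /kap /f !prZ.
split; last first.
  apply: (eq_bounded_mfun NE); apply: bounded_mfun_sum => i.
  apply: bounded_mfun_sum => j; apply: bounded_mfunM; first exact: bounded_mfun_cst.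
  by apply: (bounded_mfun_comp _ bkap); exact: measurable_fun_pair.
rewrite (eq_mean P NE).
apply: (degenerate_second_moment (fun=> n%:R^-1)) => //.
  by move=> z; rewrite (le_trans (ler_norm _)).
move=> z j.
have -> : E (fun w => kap (z, Z j w)) = E (fun w => kap (z, XY w)).
  apply: (EZ j (F := fun z' => kap (z, z'))).
  exact: (bounded_mfun_comp (pair1_measurable z) bkap).
have -> : E (fun w => kap (z, XY w)) =
    E (fun w => rkhs_dot H (f (XY w)) (f z - m) - rkhs_dot H m (f z - m)).
  by apply: eq_mean => w; rewrite /kap -dotBl dotC.
rewrite meanB; [|exact: (bXY (bf _))|exact: bounded_mfun_cst].
by rewrite mean_cst -mP subrr.
Qed.

Variables (w : nat -> nat -> R) (w2 C : R).
Hypothesis w_ge0 : forall n i, (i < n)%N -> 0 <= w n i.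
Hypothesis w_le : forall n i, (i < n)%N -> w n i <= C.
Hypothesis w_mean : exists (tau : R) (n0 : nat), 0 < tau /\ forall n, (n0 < n)%N ->
  n%:R * `|n%:R^-1 * (\sum_(i < n) w n i) - 1| <= tau.
Hypothesis w_square : n%:R^-1 * (\sum_(i < n) w n i ^+ 2) @[n --> \oo] --> w2.

Let C0 : 0 <= C.
Proof. exact: le_trans (w_ge0 (ltn0Sn 0)) (w_le (ltn0Sn 0)). Qed.

Let nV_cvg0 (c : R) : c * n%:R^-1 @[n --> \oo] --> (0 : R).
Proof.
rewrite -[X in _ --> X](mulr0 c); apply: cvgM; first exact: cvg_cst.
rewrite -cvg_shiftS; exact: cvg_harmonic.
Qed.

Let w_mean_cvg : n%:R^-1 * (\sum_(i < n) w n i) @[n --> \oo] --> (1 : R).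
Proof.
have [tau [n0 [tau0 tauP]]] := w_mean.
apply/cvgrPdist_le => e e0.
have /cvgrPdist_le/(_ _ e0) taue := nV_cvg0 tau.
near=> n.
have n00 : (n0 < n)%N by near: n; exists n0.+1.
have nN0 : 0 < n%:R :> R by rewrite ltr0n (leq_ltn_trans _ n00).
have : `|0 - tau * n%:R^-1| <= e by near: n.
rewrite sub0r normrN ger0_norm; last by rewrite mulr_ge0 ?invr_ge0// ltW.
move=> h; rewrite distrC (le_trans _ h)// ler_pdivlMr// mulrC; exact: tauP.
Unshelve. all: by end_near. Qed.

(** The linear part of the rescaled estimation error is the sum of these divided
    by [sqrt n]. *)
Let summand n i (z : T) : R := 2 * (U z - w n i * V z).

Let bsummand n i : bounded_mfun (summand n i).
Proof.
apply: bounded_mfunM; first exact: bounded_mfun_cst.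
apply: bounded_mfunB => //; apply: bounded_mfunM => //; exact: bounded_mfun_cst.
Qed.

Let summand_bound : exists K, forall n i, (i < n)%N -> forall z, `|summand n i z| <= K.
Proof.
have [_ [A UA]] := bU; have [_ [B VB]] := bV.
exists (2 * (A + C * B)) => n i ni z.
rewrite normrM ger0_norm// ler_wpM2l// (le_trans (ler_normB _ _))// lerD//.
by rewrite normrM ler_pM// ger0_norm ?w_ge0// w_le.
Qed.

Let summand_mean n i : E (fun x => summand n i (Z i x)) = 0.
Proof.
rewrite meanZ; last first.
  apply: bounded_mfunB; first exact: bZ bU.
  by apply: bounded_mfunM; [exact: bounded_mfun_cst|exact: bZ bV].
rewrite meanB; [|exact: bZ bU|]; last first.
  by apply: bounded_mfunM; [exact: bounded_mfun_cst|exact: bZ bV].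
by rewrite meanZ ?EU ?EV ?mulr0 ?subr0 ?mulr0//; exact: bZ bV.
Qed.

Let eU := E (fun x => U (Z 0%N x) ^+ 2).
Let eV := E (fun x => V (Z 0%N x) ^+ 2).
Let eUV := E (fun x => U (Z 0%N x) * V (Z 0%N x)).

Let summand_variance n i : E (fun x => summand n i (Z i x) ^+ 2) =
  4 * eU - 8 * (w n i * eUV) + 4 * (w n i ^+ 2 * eV).
Proof.
have bUU : bounded_mfun (fun z => U z ^+ 2) by exact: bounded_mfunX.
have bVV : bounded_mfun (fun z => V z ^+ 2) by exact: bounded_mfunX.
have bUV : bounded_mfun (fun z => U z * V z) by exact: bounded_mfunM.
have bc (c : R) F : bounded_mfun F -> bounded_mfun (fun x => c * F (Z i x)).
  by move=> bF; apply: bounded_mfunM; [exact: bounded_mfun_cst|exact: bZ].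
have -> : E (fun x => summand n i (Z i x) ^+ 2) =
    E (fun x => 4 * U (Z i x) ^+ 2 - 8 * w n i * (U (Z i x) * V (Z i x))
              + 4 * w n i ^+ 2 * V (Z i x) ^+ 2).
  by apply: eq_mean => x; rewrite /summand; ring.
have b1 := bc 4 _ bUU; have b2 := bc (8 * w n i) _ bUV.
have b3 := bc (4 * w n i ^+ 2) _ bVV.
rewrite (meanD P (bounded_mfunB b1 b2) b3) (meanB P b1 b2).
rewrite (meanZ P _ (bZ i bUU)) (meanZ P _ (bZ i bUV)) (meanZ P _ (bZ i bVV)).
rewrite (EZ i bUU) (EZ i bVV) (EZ i bUV) -(EZ 0%N bUU) -(EZ 0%N bVV) -(EZ 0%N bUV).
by rewrite -!mulrA.
Qed.

Let variance_cvg :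
  n%:R^-1 * (\sum_(i < n) E (fun x => summand n i (Z i x) ^+ 2)) @[n --> \oo] -->
  4 * eU - 8 * eUV + 4 * (w2 * eV).
Proof.
rewrite -cvg_shiftS.
have -> : (fun n => n.+1%:R^-1 * (\sum_(i < n.+1) E (fun x => summand n.+1 i (Z i x) ^+ 2))) =
  (fun n => 4 * eU - 8 * ((n.+1%:R^-1 * (\sum_(i < n.+1) w n.+1 i)) * eUV) +
    4 * ((n.+1%:R^-1 * (\sum_(i < n.+1) w n.+1 i ^+ 2)) * eV)).
  apply/funext => n; under eq_bigr do rewrite summand_variance.
  rewrite big_split/= sumrB sumr_const card_ord -!mulr_sumr -!mulr_suml.
  have nn : n.+1%:R != 0 :> R by rewrite pnatr_eq0.
  by rewrite -[4 * eU *+ _]mulr_natl; move: (n.+1%:R : R) nn => N nn; field.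
rewrite -[X in _ - 8 * X + _](mul1r eUV).
have w2S := w_square; rewrite -cvg_shiftS in w2S.
have w1S := w_mean_cvg; rewrite -cvg_shiftS in w1S.
apply: cvgD; last by apply: cvgM; [exact: cvg_cst|apply: cvgM; [exact: w2S|exact: cvg_cst]].
apply: cvgB; first exact: cvg_cst.
by apply: cvgM; [exact: cvg_cst|apply: cvgM; [exact: w1S|exact: cvg_cst]].
Qed.

Let hat n x := hsic_hat HX HY Xs Ys w n x.
Let H := hsic P HX HY X Y.

Let bhat n : bounded_mfun (hat n).
Proof.
have bk i j : bounded_mfun (fun x => rkhs_kernel HX (Xs i x) (Xs j x)).
  apply: (eq_bounded_mfun (fun x => esym (dot_section HX (Xs i x) (Xs j x)))).
  have mZZ : measurable_fun [set: Omega] (fun x => (Z i x, Z j x)).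
    exact: measurable_fun_pair.
  exact: (bounded_mfun_comp mZZ bK).
have bl i j : bounded_mfun (fun x => rkhs_kernel HY (Ys i x) (Ys j x)).
  apply: (eq_bounded_mfun (fun x => esym (dot_section HY (Ys i x) (Ys j x)))).
  have mZZ : measurable_fun [set: Omega] (fun x => (Z i x, Z j x)).
    exact: measurable_fun_pair.
  exact: (bounded_mfun_comp mZZ bL).
have bc (c : R) := @bounded_mfun_cst _ Omega R c.
apply: bounded_mfunB; [apply: bounded_mfunD|]; apply: bounded_mfunM => //.
- by apply: bounded_mfun_sum => i; apply: bounded_mfun_sum => j; exact: bounded_mfunM.
- apply: bounded_mfun_sum => i; apply: bounded_mfun_sum => j.
  apply: bounded_mfun_sum => q; apply: bounded_mfun_sum => s; exact: bounded_mfunM.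
- apply: bounded_mfun_sum => i; apply: bounded_mfun_sum => j.
  apply: bounded_mfun_sum => q; apply: bounded_mfunM => //; exact: bounded_mfunM.
Qed.

Let rem n x := Num.sqrt n%:R * (hat n x - H)
  - (Num.sqrt n%:R)^-1 * (\sum_(i < n) summand n i (Z i x)).

Let brem n : bounded_mfun (rem n).
Proof.
have bc (c : R) := @bounded_mfun_cst _ Omega R c.
apply: bounded_mfunB; apply: bounded_mfunM => //; first exact: bounded_mfunB.
by apply: bounded_mfun_sum => i; exact: bZ (bsummand n i).
Qed.

Let remE n x : (0 < n)%N -> rem n x =
  Num.sqrt n%:R * expansion_remainder P HX HY X Y (Xs^~ x) (Ys^~ x) (w n) n.
Proof.
move=> n0; have n1 : 0 < n%:R :> R by rewrite ltr0n.
have := @hsic_expansion _ _ _ P _ _ HX HY X Y hmu (Xs^~ x) (Ys^~ x) (w n) n n0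
  Xs Ys w x (fun=> erefl) (fun=> erefl) (fun=> erefl).
have sn : Num.sqrt n%:R != 0 :> R by rewrite gt_eqF// sqrtr_gt0.
have nE : n%:R^-1 = (Num.sqrt n%:R)^-1 ^+ 2 :> R by rewrite exprVn sqr_sqrtr// ltW.
rewrite /rem /hat /H => ->; rewrite big_mkord -/(expansion_remainder _ _ _ _ _ _ _ _ _).
set S := \sum_(i < n) _; rewrite -/S.
rewrite mulrDr addrAC; apply/eqP; rewrite -subr_eq0 addrK; apply/eqP.
by rewrite nE; field.
Qed.

(** The centered averages have second moments of order [1 / n] and the mean weight
    is within [tau / n] of 1, so after multiplication by [sqrt n] the remainder is
    of order [1 / sqrt n]. *)
Let rem_cvg0 : E (fun x => `|rem n x|) @[n --> \oo] --> (0 : R).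
Proof.
have [k k0 kP] := section_bound bX; have [l l0 lP] := section_bound bY.
have [c c0 remC] := expansion_remainder_le hmu k0 l0 kP lP.
have [M1 M1P] := second_moment_tensor.
have [M2 M2P] := second_moment_section (s := Xs) measurable_fst (fun _ _ => erefl) uX bX bK mXP.
have [M3 M3P] := second_moment_section (s := Ys) measurable_snd (fun _ _ => erefl) uY bY bL mYP.
have [tau [n0 [tau0 tauP]]] := w_mean.
pose K := c * (`|M1| + `|M1| * C ^+ 2 + `|M2| + `|M3| + tau).
have K0 : 0 <= K.
  apply: mulr_ge0 => //; apply: addr_ge0; last exact: ltW.
  by rewrite !addr_ge0// mulr_ge0// sqr_ge0.
have bound n : (n0 < n)%N -> E (fun x => `|rem n x|) <= K * (Num.sqrt n%:R)^-1.
  move=> n0n; have npos : (0 < n)%N by rewrite (leq_ltn_trans _ n0n).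
  have n1 : 0 < n%:R :> R by rewrite ltr0n.
  have sn : 0 < Num.sqrt n%:R :> R by rewrite sqrtr_gt0.
  have sumV : \sum_(0 <= i < n) n%:R^-1 ^+ 2 = n%:R^-1 :> R.
    rewrite big_mkord sumr_const card_ord -[_ *+ n]mulr_natl expr2 mulrA divff ?mul1r//.
    by rewrite gt_eqF.
  have sumW : \sum_(0 <= i < n) (n%:R^-1 * w n i) ^+ 2 <= C ^+ 2 * n%:R^-1.
    rewrite -[X in _ <= _ * X]sumV mulr_sumr big_nat [leRHS]big_nat; apply: ler_sum => i /andP[_ ni].
    rewrite exprMn mulrC ler_wpM2r ?sqr_ge0//.
    by rewrite lerXn2r ?nnegrE ?w_ge0// w_le.
  have [E1 b1] := M1P (fun=> n%:R^-1) n.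
  have [E2 b2] := M1P (fun i => n%:R^-1 * w n i) n.
  have [E3 b3] := M2P n; have [E4 b4] := M3P n.
  set N1 := (fun w0 => _) in E1 b1; set N2 := (fun w0 => _) in E2 b2.
  set N3 := (fun w0 => _) in E3 b3; set N4 := (fun w0 => _) in E4 b4.
  set wd := `|n%:R^-1 * (\sum_(0 <= i < n) w n i) - 1|.
  have wdn : wd <= tau * n%:R^-1.
    by rewrite ler_pdivlMr// mulrC /wd big_mkord tauP.
  have b12 := bounded_mfunD b1 b2; have b123 := bounded_mfunD b12 b3.
  have b1234 := bounded_mfunD b123 b4.
  have bw : bounded_mfun (fun _ : Omega => wd) by exact: bounded_mfun_cst.
  have ball' := bounded_mfunD b1234 bw.
  apply: (@le_trans _ _ (E (fun x => (Num.sqrt n%:R * c) *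
      (N1 x + N2 x + N3 x + N4 x + wd)))).
    apply: le_mean; first exact: bounded_mfun_norm.
      by apply: bounded_mfunM => //; exact: bounded_mfun_cst.
    move=> x; rewrite remE// normrM ger0_norm ?sqrtr_ge0// -mulrA ler_wpM2l ?sqrtr_ge0//.
    exact: remC.
  rewrite meanZ// (meanD P b1234 bw) (meanD P b123 b4) (meanD P b12 b3) (meanD P b1 b2).
  rewrite mean_cst.
  have -> : K * (Num.sqrt n%:R)^-1 = Num.sqrt n%:R * c *
      (`|M1| * n%:R^-1 + `|M1| * (C ^+ 2 * n%:R^-1) + `|M2| * n%:R^-1
       + `|M3| * n%:R^-1 + tau * n%:R^-1).
    have -> : n%:R^-1 = (Num.sqrt n%:R)^-1 ^+ 2 :> R by rewrite exprVn sqr_sqrtr// ltW.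
    by rewrite /K; field; rewrite gt_eqF.
  have iv : 0 <= n%:R^-1 :> R by rewrite invr_ge0 ltW.
  apply: ler_wpM2l; first by rewrite mulr_ge0 ?sqrtr_ge0.
  apply: lerD => //; apply: lerD; last first.
    by rewrite (le_trans E4)// sumV ler_wpM2r// ler_norm.
  apply: lerD; last by rewrite (le_trans E3)// sumV ler_wpM2r// ler_norm.
  apply: lerD; first by rewrite (le_trans E1)// sumV ler_wpM2r// ler_norm.
  rewrite (le_trans E2)// (@le_trans _ _ (`|M1| * \sum_(0 <= i < n) (n%:R^-1 * w n i) ^+ 2))//.
    by rewrite ler_wpM2r ?ler_norm// sumr_ge0// => i _; exact: sqr_ge0.
  by rewrite ler_wpM2l.
apply/cvgrPdist_le => e e0.
have /cvgrPdist_le/(_ _ (exprn_gt0 2 e0)) Ke := nV_cvg0 (K ^+ 2).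
near=> n.
have n0n : (n0 < n)%N by near: n; exists n0.+1.
rewrite sub0r normrN ger0_norm; last exact: mean_ge0.
rewrite (le_trans (bound n n0n))//.
have : `|0 - K ^+ 2 * n%:R^-1| <= e ^+ 2 by near: n.
rewrite sub0r normrN ger0_norm; last by rewrite mulr_ge0 ?sqr_ge0 ?invr_ge0.
have -> : n%:R^-1 = (Num.sqrt n%:R)^-1 ^+ 2 :> R by rewrite exprVn sqr_sqrtr.
rewrite -exprMn ler_sqr// nnegrE; last exact: ltW.
by apply: mulr_ge0 => //; rewrite invr_ge0 sqrtr_ge0.
Unshelve. all: by end_near. Qed.

Let clt_variance : 4 * fine 'V_P[fun x => U (Z 0%N x)]
    + 4 * w2 * fine 'V_P[fun x => V (Z 0%N x)]
    - 8 * fine (covariance P (fun x => U (Z 0%N x)) (fun x => V (Z 0%N x))) =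
  4 * eU - 8 * eUV + 4 * (w2 * eV).
Proof.
rewrite /variance !mean_covariance EU EV.
rewrite (_ : mean P _ = eU); last by apply: eq_mean => x; rewrite !subr0.
rewrite (_ : mean P _ = eV); last by apply: eq_mean => x; rewrite !subr0.
rewrite (_ : mean P _ = eUV); last by apply: eq_mean => x; rewrite !subr0.
by ring.
Qed.

Lemma hsic_asymptotic_normality :
  let U1 := fun omega => hsic_U P HX HY X Y (Xs 0%N omega) (Ys 0%N omega) in
  let V1 := fun omega => hsic_V P HX HY X Y (Xs 0%N omega) (Ys 0%N omega) in
  cvg_in_distribution P
    (fun n omega => Num.sqrt n%:R * (hsic_hat HX HY Xs Ys w n omega - hsic P HX HY X Y))
    (gaussian 0 (4 * fine 'V_P[U1] + 4 * w2 * fine 'V_P[V1]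
                 - 8 * fine (covariance P U1 V1))).
Proof.
move=> U1 V1; rewrite clt_variance; split.
  move=> n; apply: measurable_funM; first exact: measurable_cst.
  by apply: measurable_funB; [case: (bhat n)|exact: measurable_cst].
move=> f cf [M fM]; have [K summandK] := summand_bound.
have := central_limit_theorem mZ indZ bsummand summandK (fun n i _ => summand_mean n i)
  variance_cvg brem rem_cvg0 cf fM.
apply: cvg_trans; apply: near_eq_cvg; near=> n.
by apply: eq_integral => x _; rewrite /rem addrC subrK.
Unshelve. all: by end_near. Qed.

End asymptotics.

Theorem theorem1 (R : realType) (d : measure_display)
    (Omega : measurableType d) (P : probability Omega R)
    (TX TY : pointedMetricType R) (HX : rkhs R TX) (HY : rkhs R TY)
    (X : {RV P >-> borel TX}) (Y : {RV P >-> borel TY})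
    (Xs : nat -> {RV P >-> borel TX}) (Ys : nat -> {RV P >-> borel TY})
    (w : R -> nat -> nat -> R) (w2 : R -> R) (gamma : R)
    (* the sample *)
    (hiid : iid_copies P
       (fun i omega => (Xs i omega, Ys i omega))
       (fun omega => (X omega, Y omega)))
    (* the weights *)
    (hw : forall g : R, 0 < g <= 1 -> forall r i : nat, (i < r)%N ->
       0 < w g r i)
    (* (A1) *)
    (hA1X : kernel_bounded HX) (hA1Y : kernel_bounded HY)
    (* (A2) *)
    (hA2X : universal HX) (hA2Y : universal HY)
    (hcX : compact [set: TX]) (hcY : compact [set: TY])
    (* (A3) *)
    (hA3 : forall g : R, 0 < g <= 1 -> exists (tau : R) (n0 : nat), 0 < tau /\
       forall r : nat, (n0 < r)%N ->
         r%:R * `|r%:R^-1 * (\sum_(i < r) w g r i) - 1| <= tau)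
    (* (A4) *)
    (hA4 : exists C : R, 0 < C /\
       forall (r : nat) (g : R), (0 < r)%N -> 0 < g <= 1 ->
         \big[Num.max/0]_(i < r) w g r i < C)
    (* (A5) *)
    (hA5 : forall g : R, 0 < g <= 1 ->
       (r%:R^-1 * (\sum_(i < r) w g r i ^+ 2)) @[r --> \oo] --> w2 g /\
       1 < w2 g)
    (hgamma : 0 < gamma <= 1) :
  let U1 := fun omega => hsic_U P HX HY X Y (Xs 0%N omega) (Ys 0%N omega) in
  let V1 := fun omega => hsic_V P HX HY X Y (Xs 0%N omega) (Ys 0%N omega) in
  let sigma2 := 4 * fine 'V_P[U1] + 4 * w2 gamma * fine 'V_P[V1]
                - 8 * fine (covariance P U1 V1) in
  cvg_in_distribution P
    (fun n omega => Num.sqrt n%:R *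
       (hsic_hat HX HY (fun i => Xs i) (fun i => Ys i) (w gamma) n omega
        - hsic P HX HY X Y))
    (gaussian 0 sigma2).
Proof.
have [C [_ CP]] := hA4; have [hind hid] := hiid.
have wle n i : (i < n)%N -> w gamma n i <= C.
  move=> ni; apply: ltW; apply: le_lt_trans (CP n gamma _ hgamma); last first.
    exact: leq_ltn_trans ni.
  exact: (le_bigmax _ (fun j : 'I_n => w gamma n j) (Ordinal ni)).
have [w2P _] := hA5 gamma hgamma.
apply: (@hsic_asymptotic_normality d Omega R P TX TY HX HY hA2X hA2Y hcX hcY
  hA1X hA1Y X Y (fun i => Xs i) (fun i => Ys i) _ _ _ _ hind hid (w gamma)
  (w2 gamma) C _ wle (hA3 gamma hgamma) w2P) => //.
by move=> n i ni; rewrite ltW// hw.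
Qed.
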